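(* Let $p\in\mathbb{N}_0$, $\mu\in\mathbb{N}$, $z\in\mathbb{C}\setminus(-\infty,1]$, $z-x\in\mathbb{C}\setminus(-\infty,0]$, where $x\in\mathbb{C}$ lies inside the ellipse with foci at $\pm1$ that passes through $z$. Put $A:=i\,\frac{2^{\mu+\frac12}}{\sqrt\pi}\,p!\,(\mu-1)!\,(z^2-1)^{\frac{p+\mu}{2}+\frac14}$. Then $$\begin{aligned} (z-x)^p\log(z-x)&=(z-x)^p\left(\log\frac{z+\sqrt{z^2-1}}{2}+2H_{2p+2\mu}+H_p-H_{p+\mu}\right)\\ &+(-1)^{p+\mu}A\sum_{n=0}^p\frac{(n+\mu)(-1)^nC_n^\mu(x)}{(p-n)!(p+n+2\mu)!}\left(H_{p+n+2\mu}+H_{p-n}\right)Q_{n+\mu-\frac12}^{p+\mu+\frac12}(z)\\ &+(-1)^{p+\mu+1}A\sum_{n=0}^{p-1}\frac{(n+\mu)(-1)^nC_n^\mu(x)}{(p+n+2\mu)!}\sum_{k=0}^{p-n-1}\frac{2n+2k+2\mu+1}{k!(p-n-k)(p+n+k+2\mu+1)}\left[1+\frac{k!(p+n+2\mu)!}{(k+2n+2\mu)!(p-n)!}\right]Q_{n+\mu-\frac12}^{k+n+\mu+\frac12}(z)\\ &+(-1)^{p+\mu+1}A\sum_{n=0}^{p}\frac{(n+\mu)(-1)^nC_n^\mu(x)}{(p-n)!}\sum_{k=0}^{n+\mu-1}\frac{2k+1}{(n+k+\mu)!(p+\mu-k)(p+k+\mu+1)}Q_{n+\mu-\frac12}^{k+\frac12}(z)\\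 &+(-1)^{\mu}A\sum_{n=p+1}^\infty\frac{(n+\mu)(n-p-1)!\,C_n^\mu(x)}{(p+n+2\mu)!}Q_{n+\mu-\frac12}^{p+\mu+\frac12}(z). \end{aligned}$$
   Context: $\mathbb{N}=\{1,2,\ldots\}$, $\mathbb{N}_0=\{0\}\cup\mathbb{N}$. $H_n=\sum_{k=1}^n\frac1k$ for $n\ge1$ and $H_n=0$ for $n\le 0$ are the harmonic numbers. Empty sums are $0$. For $\alpha\in\mathbb{C}$ and $z\in\mathbb{C}\setminus(-\infty,1]$, $(z^2-1)^\alpha:=(z+1)^\alpha(z-1)^\alpha$, and $\sqrt{z^2-1}=(z^2-1)^{1/2}$. $C_n^\mu(x)=\frac{(2\mu)_n}{n!}\,{}_2F_1\!\left(-n,n+2\mu;\mu+\tfrac12;\tfrac{1-x}{2}\right)$ is the Gegenbauer polynomial, where $(a)_0=1$, $(a)_n=a(a+1)\cdots(a+n-1)$ and ${}_2F_1$ is the Gauss hypergeometric function. The associated Legendre function of the second kind on $\mathbb{C}\setminus(-\infty,1]$ is $$Q_\nu^\kappa(z)=\frac{\sqrt{\pi}\,e^{i\pi\kappa}\,\Gamma(\nu+\kappa+1)(z^2-1)^{\kappa/2}}{2^{\nu+1}\Gamma(\nu+\frac32)z^{\nu+\kappa+1}}\,{}_2F_1\!\left(\tfrac{\nu+\kappa+1}{2},\tfrac{\nu+\kappa+2}{2};\nu+\tfrac32;\tfrac1{z^2}\right)$$ for $|z|>1$, and by analytic continuation elsewhere.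
   Formalization: With principal log the identity fails (by 2πi(z−x)^p up to sign) if the segment from z to z−x meets (−∞,0], e.g. p=0, μ=1, z=−3+i, x=2i; it is proved when the segment avoids (−∞,0], and always with log(z−x) read as log z+log(1−x/z). *)

(* Defs.v *)
From HB Require Import structures.
From mathcomp Require Import all_boot all_order all_algebra.
From mathcomp Require Import complex ring.
From mathcomp Require Import all_classical all_reals all_analysis.

Set Implicit Arguments.
Unset Strict Implicit.
Unset Printing Implicit Defensive.

Import Order.TTheory GRing.Theory Num.Theory.
Import numFieldNormedType.Exports.

Local Open Scope classical_set_scope.
Local Open Scope complex_scope.
Local Open Scope ring_scope.

(* R[i] with the topology of its norm: numFieldNormedType gives it to abstract
   numFieldTypes only, not to the concrete type R[i]. *)
HB.instance Definition _ (R : realType) :=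
  PseudoPointedMetric.copy R[i] (R[i] : numClosedFieldType)^o.
HB.instance Definition _ (R : realType) :=
  GRing.ComAlgebra.copy R[i] (R[i] : numClosedFieldType)^o.
HB.instance Definition _ (R : realType) :=
  Vector.copy R[i] (R[i] : numClosedFieldType)^o.
HB.instance Definition _ (R : realType) :=
  NormedModule.copy R[i] (R[i] : numClosedFieldType)^o.

Section Elementary.
Variable R : realType.
Local Notation C := R[i].
Local Notation re := (@complex.Re R).
Local Notation im := (@complex.Im R).
Local Notation normc := (@Normc.normc R).

Definition cexp (z : C) : C := (expR (re z))%:C * (cos (im z) +i* sin (im z)).

(* Principal argument, in ]-pi, pi] for z != 0. *)
Definition carg (z : C) : R :=
  let t := acos (re z / normc z) in if 0 <= im z then t else - t.

Definition clog (z : C) : C := ln (normc z) +i* carg z.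

Definition cpow (z a : C) : C := cexp (a * clog z).

(* C \ ]-oo, a] *)
Definition cutplane (a : R) : set C := [set z | ~ (im z = 0 /\ re z <= a)].

(* (z^2 - 1)^a, which is not the principal power of z^2 - 1 *)
Definition cpow_sqr_sub1 (z a : C) : C := cpow (z + 1) a * cpow (z - 1) a.

(* The branch, in the variable x, of log (z - x) that is principal at x = 0.
   For z outside ]-oo, 1] it is analytic on the whole interior of the ellipse
   with foci -1 and 1 through z, since x / z is never in [1, +oo[ there.
   The principal logarithm clog (z - x) is not: if Re z < 0, its cut
   z + [0, +oo[ crosses that ellipse, and on the far side of the cut
   clog (z - x) differs from this branch by 2 i pi or - 2 i pi. *)
Definition clog_sub (z x : C) : C := clog z + clog (1 - x / z).

Definition analytic_on (D : set C) (f : C -> C) : Prop :=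
  forall z0, D z0 -> exists a : nat -> C,
    \forall z \near z0,
      series (fun n => a n * (z - z0) ^+ n) @ \oo --> f z.

Lemma cexpD (u v : C) : cexp (u + v) = cexp u * cexp v.
Proof.
case: u => a b; case: v => c d; rewrite /cexp /= expRD cosD sinD.
by apply/eqP; rewrite eq_complex /=; apply/andP; split; apply/eqP; ring.
Qed.

Lemma cexp_clog (z : C) : z != 0 -> cexp (clog z) = z.
Proof.
case: z => a b z0.
have n0 : 0 < Num.sqrt (a ^+ 2 + b ^+ 2).
  rewrite sqrtr_gt0 lt_neqAle addr_ge0 ?sqr_ge0 // andbT eq_sym.
  by rewrite paddr_eq0 ?sqr_ge0 // !sqrf_eq0; apply: contra z0 => /andP[/eqP-> /eqP->].
rewrite /cexp /clog /carg /= lnK //; set r := Num.sqrt _ in n0 *.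
have r2 : r ^+ 2 = a ^+ 2 + b ^+ 2 by rewrite sqr_sqrtr // addr_ge0 ?sqr_ge0.
have ar : -1 <= a / r <= 1.
  rewrite -ler_norml normrM normfV (gtr0_norm n0) ler_pdivrMr // mul1r.
  by rewrite -sqrtr_sqr -(ger0_norm (ltW n0)) -sqrtr_sqr r2 ler_sqrt ?addr_ge0 ?sqr_ge0 // lerDl sqr_ge0.
have ca : cos (acos (a / r)) = a / r by rewrite acosK // in_itv.
have sa : sin (acos (a / r)) = `|b| / r.
  rewrite sin_acos // -[RHS]ger0_norm ?divr_ge0 ?(ltW n0) // -sqrtr_sqr; congr Num.sqrt.
  rewrite !exprMn exprVn real_normK ?num_real // -(divff (lt0r_neq0 (exprn_gt0 2 n0))).
  by rewrite -mulrBl r2 addrAC subrr add0r.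
have rK y : r * (y / r) = y by rewrite mulrCA divff ?mulr1 // lt0r_neq0.
apply/eqP; rewrite eq_complex /= !mul0r subr0 addr0; apply/andP; split; apply/eqP.
  by case: ifP => _; rewrite ?cosN ca rK.
case: ifP => b0; rewrite ?sinN sa ?mulrN rK; first by rewrite ger0_norm.
by rewrite ltr0_norm ?opprK // ltNge b0.
Qed.

Lemma cexp_clog_sub (z x : C) : z != 0 -> x != z -> cexp (clog_sub z x) = z - x.
Proof.
move=> z0 xz; rewrite cexpD !cexp_clog //; first by rewrite mulrBr mulr1 mulrCA divff ?mulr1.
by rewrite subr_eq0 eq_sym; apply: contra xz => /eqP h; rewrite -(divfK z0 x) h mul1r.
Qed.

End Elementary.

Section Special.
Variable R : realType.
Local Notation C := R[i].

Definition harm (n : nat) : C := \sum_(1 <= k < n.+1) k%:R^-1.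

Definition poch (a : C) (n : nat) : C := \prod_(0 <= j < n) (a + j%:R).

(* Gauss's limit formula, valid at every s that is not a nonpositive integer *)
Definition cGamma (s : C) : C :=
  limn (fun n : nat => n`!%:R * cpow n%:R s / poch s n.+1).

Definition hyp2F1 (a b c z : C) : C :=
  limn (series (fun n => poch a n * poch b n / (poch c n * n`!%:R) * z ^+ n)).

Definition gegenbauer (n : nat) (mu x : C) : C :=
  poch (2 * mu) n / n`!%:R
  * hyp2F1 (- n%:R) (n%:R + 2 * mu) (mu + 2^-1) ((1 - x) / 2).

Definition legendreQ_series (nu ka z : C) : C :=
  (Num.sqrt pi)%:C * cexp ('i%C * pi%:C * ka) * cGamma (nu + ka + 1)
    * cpow_sqr_sub1 z (ka / 2)
  / (cpow 2 (nu + 1) * cGamma (nu + 3 / 2) * cpow z (nu + ka + 1))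
  * hyp2F1 ((nu + ka + 1) / 2) ((nu + ka + 2) / 2) (nu + 3 / 2) (z ^- 2).

Definition is_legendreQ (nu ka : C) (f : C -> C) : Prop :=
  analytic_on (@cutplane R 1) f /\
  (forall z, cutplane 1 z -> 1 < `|z| -> f z = legendreQ_series nu ka z).

(* By the identity theorem, any two functions satisfying is_legendreQ agree on
   cutplane 1, so that the choice made by xget is immaterial there. *)
Definition legendreQ (nu ka : C) : C -> C :=
  xget (legendreQ_series nu ka) [set f | is_legendreQ nu ka f].

End Special.

(* Main.v *)
Require Import Defs.
From HB Require Import structures.
From mathcomp Require Import all_boot all_order all_algebra.
From mathcomp Require Import complex ring lra.
From mathcomp Require Import all_classical all_reals all_analysis.

Set Implicit Arguments.
Unset Strict Implicit.
Unset Printing Implicit Defensive.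

Import Order.TTheory GRing.Theory Num.Theory.
Import numFieldNormedType.Exports.

Local Open Scope classical_set_scope.
Local Open Scope complex_scope.
Local Open Scope ring_scope.

(* Write w = z + sqrt (z^2 - 1), t = 1 / w and x = (u + 1/u) / 2; x is inside
   the ellipse iff |u| and |1/u| are less than |w|, and then
     z - x = (w / 2) (1 - u t) (1 - t / u),
   so that the logarithm series expands (z - x)^K (log (z - x) - log (w / 2))
   as a Laurent series in u that is symmetric under u -> 1/u.  Subtract H_K times
   the coefficients of (z - x)^K and multiply by (-2)^K / K!; the resulting d^K_m
   satisfy m d^(K+1)_m = d^K_(m-1) - d^K_(m+1).  As
     (n + mu) C_n^mu = mu (C_n^(mu+1) - C_(n-2)^(mu+1)),
   summation by parts turns the Laurent series for K = p into a series of C_n^1,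
   then of C_n^2, up to C_n^mu, with coefficients d^(p+mu)_(n+mu).
   The Legendre functions in the statement have half-integer parameters and are
   elementary: up to a factor, Q_(m-1/2)^(k+1/2) is t^m (z^2 - 1)^(-1/4) times a
   polynomial W_k^m in t / (2 sqrt (z^2 - 1)), for |z| > 1 by summing its series
   and elsewhere by the identity theorem along rays.  The coefficient for
   m > K is a multiple of W_K^m; for m <= K the partial fraction identity
   [alpha_sum] rewrites the harmonic numbers in it as a combination of the
   W_k^m with k <= K. *)

(** The harmonic numbers of the closed part have two sources. [alpha_sum] compares every
    [harm R (K + i)] with the single reference [harm R (K + K)], where K = p + mu, once for m and
    once for - m: this gives 2 H_(2K). The multiple of the coefficients that is subtracted is H_p
    before the summations by parts and H_(p+mu) after them: this gives H_p - H_(p+mu). The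
    polynomials in t / (2 s), where s = sqrt (z^2 - 1), come from a second factorization, z - x = s
    (1 + v) (1 + t (1 + v) / (2 s v)) with v = - u t. There log (1 - u t) is log (1 + v), the effect
    of differentiating a power of 1 + v in its exponent. Two obstacles lie outside this algebra. The
    logarithms must be split without a stray multiple of 2 i pi, which is done by following segments
    ([clogM_segment]). And [legendreQ] is a choice among analytic continuations, whose values are
    known only once one continuation is exhibited ([legQ], through local power series) and any two
    are shown to agree. *)

Section ComplexConvergence.
Variable R : realType.
Local Notation C := R[i].
Local Notation re := (@complex.Re R).
Local Notation im := (@complex.Im R).
Local Notation nc := (@Normc.normc R).
Implicit Types (u v : nat -> C) (l z : C).

(** * Convergence in [R[i]] through the real-valued modulus *)

Lemma normcE_real z : `|z| = (nc z)%:C.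
Proof. by case: z. Qed.

Lemma nc_ge0 z : 0 <= nc z.
Proof. by case: z => a b; exact: sqrtr_ge0. Qed.

Lemma ncD z1 z2 : nc (z1 + z2) <= nc z1 + nc z2.
Proof. exact: le_normcD. Qed.

Lemma ncN z : nc (- z) = nc z.
Proof. by rewrite normcN. Qed.

Lemma ncB z1 z2 : nc (z1 - z2) <= nc z1 + nc z2.
Proof. by rewrite -(ncN z2) ncD. Qed.

Lemma ncBC z1 z2 : nc (z1 - z2) = nc (z2 - z1).
Proof. by rewrite -ncN opprB. Qed.

Lemma ncM z1 z2 : nc (z1 * z2) = nc z1 * nc z2.
Proof. exact: Normc.normcM. Qed.

Lemma ncV z : nc z^-1 = (nc z)^-1.
Proof. exact: Normc.normcV. Qed.

Lemma nc1 : nc 1 = 1.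
Proof. exact: Normc.normc1. Qed.

Lemma nc0 : nc 0 = 0.
Proof. exact: Normc.normc0. Qed.

Lemma ncX z n : nc (z ^+ n) = nc z ^+ n.
Proof. by elim: n => [|n IH]; rewrite ?expr0 ?nc1 // !exprS ncM IH. Qed.

Lemma nc_real (r : R) : nc r%:C = `|r|.
Proof. by rewrite /= expr0n /= addr0 sqrtr_sqr. Qed.

Lemma nc_nat n : nc n%:R = n%:R.
Proof.
have -> : n%:R = (n%:R : R)%:C by rewrite rmorph_nat.
by rewrite nc_real ger0_norm.
Qed.

Lemma nc_eq0 z : (nc z == 0) = (z == 0).
Proof. by apply/eqP/eqP => [/Normc.eq0_normc//|->]; rewrite nc0. Qed.

Lemma nc_gt0 z : (0 < nc z) = (z != 0).
Proof. by rewrite lt_neqAle nc_ge0 andbT eq_sym nc_eq0. Qed.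

Lemma nc_sum (I : Type) (r : seq I) (P : pred I) (F : I -> C) :
  nc (\sum_(i <- r | P i) F i) <= \sum_(i <- r | P i) nc (F i).
Proof.
elim/big_rec2: _ => [|i y x _ h]; first by rewrite nc0.
by apply: le_trans (ncD _ _) _; rewrite lerD2l.
Qed.

Lemma re_le_nc z : `|re z| <= nc z.
Proof. by rewrite -lecR -normcE_real; exact: normc_ge_Re. Qed.

Lemma im_le_nc z : `|im z| <= nc z.
Proof.
by case: z => a b /=; rewrite -sqrtr_sqr ler_wsqrtr // lerDr sqr_ge0.
Qed.

Lemma nc_le_reim z : nc z <= `|re z| + `|im z|.
Proof.
rewrite {1}(complexE z); apply: le_trans (ncD _ _) _; rewrite ncM !nc_real /=.
by rewrite expr0n /= add0r expr1n sqrtr1 mul1r.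
Qed.

Lemma cvgC_nc u l : (u @ \oo --> l) <-> ((fun n => nc (u n - l)) @ \oo --> (0 : R)).
Proof.
split=> [/cvgrPdist_lt h|/cvgrPdist_lt h]; apply/cvgrPdist_lt => e e0.
  have e0' : (0 : C) < e%:C by rewrite ltcR.
  have := h _ e0'; apply: filterS => n.
  by rewrite normcE_real ltcR sub0r normrN ger0_norm ?nc_ge0 // ncBC.
(* The radii in [cvgrPdist_lt] are elements of [R[i]]; a positive one is real. *)
have [e1 e1E] : exists r, e = r%:C.
  by exists (re e); move: e0; rewrite ltcE /= => /andP[/eqP i0 _]; case: (e) i0 => a b /= ->.
have e0' : (0 : R) < e1 by rewrite -ltcR -e1E.
have := h _ e0'; apply: filterS => n.
by rewrite normcE_real e1E ltcR sub0r normrN ger0_norm ?nc_ge0 // ncBC.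
Qed.

Lemma squeezeC u l (v : nat -> R) :
  (forall n, nc (u n - l) <= v n) -> v @ \oo --> (0 : R) -> u @ \oo --> l.
Proof.
move=> h v0; apply/cvgC_nc; apply: (squeeze_cvgr _ (cvg_cst 0) v0).
by near=> n; rewrite nc_ge0 h.
Unshelve. all: by end_near. Qed.

Lemma cvgC_ncl u l : u @ \oo --> l -> (fun n => nc (u n)) @ \oo --> nc l.
Proof.
move=> /cvgC_nc h; apply/subr_cvg0; apply/norm_cvg0P.
apply: (squeeze_cvgr _ (cvg_cst 0) h); near=> n.
rewrite normr_ge0 /= ler_norml; apply/andP; split.
  rewrite lerNl opprB lerBlDr ncBC.
  by rewrite -[X in nc X <= _](subrK (u n)) ncD.
by rewrite lerBlDr -[X in nc X <= _](subrK l) ncD.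
Unshelve. all: by end_near. Qed.

Lemma cvgC_reim u l : (fun n => re (u n)) @ \oo --> re l ->
  (fun n => im (u n)) @ \oo --> im l -> u @ \oo --> l.
Proof.
move=> hr hi; apply: (@squeezeC _ _ (fun n => `|re (u n) - re l| + `|im (u n) - im l|)).
  by move=> n; apply: le_trans (nc_le_reim _) _; case: (u n) => ? ?; case: (l).
have h (f : nat -> R) (a : R) : f @ \oo --> a -> (fun n => `|f n - a|) @ \oo --> (0 : R).
  by move=> fa; apply/norm_cvg0P; apply/subr_cvg0.
by rewrite -[X in _ --> X](addr0 0); apply: cvgD; exact: h.
Qed.

Lemma lim_leR u l (M : R) : u @ \oo --> l -> (forall n, nc (u n) <= M) -> nc l <= M.
Proof.
move=> /cvgC_ncl h hM; rewrite -(cvg_lim (@Rhausdorff R) h).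
apply: limr_le; first exact: cvgP h.
by near=> n.
Unshelve. all: by end_near. Qed.

Lemma cvgC_unique u l1 l2 : u @ \oo --> l1 -> u @ \oo --> l2 -> l1 = l2.
Proof. by move=> h1 h2; apply: (cvg_unique _ h1 h2). Qed.

Lemma cvgC_shift u l k : (fun n => u (n + k)%N) @ \oo --> l <-> u @ \oo --> l.
Proof. by rewrite cvg_shiftn. Qed.

Lemma cvgX_lt1 (q : R) : 0 <= q < 1 -> (fun n => q ^+ n) @ \oo --> (0 : R).
Proof. by move=> /andP[q0 q1]; apply: cvg_expr; rewrite ger0_norm. Qed.

Lemma geom_sum_le (q : R) n : 0 <= q < 1 -> \sum_(0 <= i < n) q ^+ i <= (1 - q)^-1.
Proof.
move=> /andP[q0 q1]; rewrite -[_^-1]mul1r ler_pdivlMr ?subr_gt0 //.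
elim: n => [|n IH]; first by rewrite big_nil mul0r.
suff -> : (\sum_(0 <= i < n.+1) q ^+ i) * (1 - q) = 1 - q ^+ n.+1.
  by rewrite gerBl exprn_ge0.
elim: {IH} n => [|n IH]; first by rewrite big_nat1 expr0 expr1 mul1r.
by rewrite big_nat_recr //= mulrDl IH !exprS; ring.
Qed.

(** With r = sqrt q, n^(e+1) q^n = (n^e r^n) (n r^n), and n r^n is at most the sum of the r^i over i
    < n, which the geometric series bounds by 1 / (1 - r). *)
Lemma polygeom_bounded (e : nat) (q : R) : 0 <= q < 1 ->
  exists2 B : R, 0 <= B & forall n, n%:R ^+ e * q ^+ n <= B.
Proof.
elim: e q => [|e IH] q /andP[q0 q1].
  by exists 1 => // n; rewrite expr0 mul1r exprn_ile1 // ltW.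
have s0 : 0 <= Num.sqrt q by exact: sqrtr_ge0.
have s1 : Num.sqrt q < 1 by rewrite -sqrtr1 ltr_sqrt.
have [|B B0 hB] := IH (Num.sqrt q); first by rewrite s0.
exists (B * (1 - Num.sqrt q)^-1) => [|n].
  by rewrite mulr_ge0 // invr_ge0 subr_ge0 ltW.
have -> : n%:R ^+ e.+1 * q ^+ n = (n%:R ^+ e * Num.sqrt q ^+ n) * (n%:R * Num.sqrt q ^+ n).
  by rewrite -{1}(sqr_sqrtr q0) exprAC expr2 exprS; ring.
apply: ler_pM => //; rewrite ?mulr_ge0 ?exprn_ge0 //.
apply: le_trans (geom_sum_le n (q := Num.sqrt q) _); last by rewrite s0.
rewrite mulr_natl -[X in _ *+ X](subn0 n) -sumr_const_nat.
apply: ler_sum_nat => i /andP[_ ni]; by apply: ler_wiXn2l; rewrite ?(ltW s1) ?(ltnW ni).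
Qed.

Lemma polygeom_cvg0 (e : nat) (q : R) : 0 <= q < 1 ->
  (fun n => n%:R ^+ e * q ^+ n) @ \oo --> (0 : R).
Proof.
move=> /andP[q0 q1].
have s0 : 0 <= Num.sqrt q by exact: sqrtr_ge0.
have s1 : Num.sqrt q < 1 by rewrite -sqrtr1 ltr_sqrt.
have [|B B0 hB] := @polygeom_bounded e (Num.sqrt q); first by rewrite s0.
apply: (@squeeze_cvgr _ _ _ _ (fun=> 0) (fun n => B * Num.sqrt q ^+ n)).
- near=> n; rewrite mulr_ge0 ?exprn_ge0 //= -{1}(sqr_sqrtr q0) exprAC expr2 mulrA.
  by rewrite ler_wpM2r // exprn_ge0.
- exact: cvg_cst.
- rewrite -(mulr0 B); apply: cvgMr; apply: cvgX_lt1; by rewrite s0.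
Unshelve. all: by end_near. Qed.

Lemma series_geom_cvg (a : nat -> C) (M q : R) : 0 <= q < 1 ->
  (forall n, nc (a n) <= M * q ^+ n) -> exists l, series a @ \oo --> l.
Proof.
move=> /andP[q0 q1] h.
have gc : cvgn (series (geometric M q)) by apply: is_cvg_geometric_series; rewrite ger0_norm.
have H (f : C -> R) : (forall z, `|f z| <= nc z) -> cvgn (series (fun n => f (a n))).
  move=> hf; apply: normed_cvg; apply: series_le_cvg gc => n //=.
  - by apply: le_trans (h n); exact: nc_ge0.
  - by apply: le_trans (h n).
have /cvg_ex[/= x hx] := H re re_le_nc.
have /cvg_ex[/= y hy] := H im im_le_nc.
exists (x +i* y); apply: cvgC_reim => /=.
  suff -> : (fun n => re (series a n)) = series (fun n => re (a n)) by [].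
  by apply/funext => n; rewrite /series /= (big_morph re (id1 := 0) (op1 := +%R)) // => -[? ?] [? ?].
suff -> : (fun n => im (series a n)) = series (fun n => im (a n)) by [].
by apply/funext => n; rewrite /series /= (big_morph im (id1 := 0) (op1 := +%R)) // => -[? ?] [? ?].
Qed.

Lemma series_geom_le (a : nat -> C) (M q : R) l : 0 <= q < 1 ->
  (forall n, nc (a n) <= M * q ^+ n) -> series a @ \oo --> l -> nc l <= M / (1 - q).
Proof.
move=> q01 h hl; apply: lim_leR hl _ => n; rewrite /series /=.
have M0 : 0 <= M by have := h 0%N; rewrite expr0 mulr1; apply: le_trans; exact: nc_ge0.
apply: le_trans (nc_sum _ _ _) _.
apply: le_trans (ler_wpM2l M0 (geom_sum_le n q01)).
by rewrite mulr_sumr; apply: ler_sum => i _.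
Qed.

Lemma cvgC_bound u l : u @ \oo --> l -> exists M, forall n, nc (u n) <= M.
Proof.
move=> /cvgC_ncl/cvgP h.
have /(cvg_seq_bounded) := h; rewrite /bounded_fun => -[M [_ hM]].
exists (M + 1) => n; have := hM (M + 1); rewrite ltrDl ltr01 => /(_ isT n I).
by rewrite /= ger0_norm // nc_ge0.
Qed.

Lemma series_cvg0 (a : nat -> C) l : series a @ \oo --> l -> a @ \oo --> (0 : C).
Proof.
move=> h; have h1 : (fun n => series a (n + 1)%N) @ \oo --> l by apply/cvgC_shift.
have -> : a = (fun n => series a (n + 1)%N - series a n).
  by apply/funext => n; rewrite addn1 /series /= big_nat_recr //= addrAC subrr add0r.
by rewrite -(subrr l); apply: cvgB.
Qed.

Lemma series0_cvg (a : nat -> C) l : series a @ \oo --> l ->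
  series (fun n => a n.+1) @ \oo --> l - a 0%N.
Proof.
move=> h; have -> : series (fun n => a n.+1) = (fun n => series a (n + 1)%N - a 0%N).
  by apply/funext => n; rewrite addn1 /series /= big_nat_recl //= addrAC subrr add0r.
by apply: cvgB; [apply/cvgC_shift | exact: cvg_cst].
Qed.

End ComplexConvergence.

Lemma natSC_neq0 (R : realType) n : (n.+1%:R : R[i]) != 0.
Proof. by rewrite pnatr_eq0. Qed.

Lemma factC_neq0 (R : realType) n : (n`!%:R : R[i]) != 0.
Proof. by rewrite pnatr_eq0 -lt0n fact_gt0. Qed.

Arguments natSC_neq0 {R} n.
Arguments factC_neq0 {R} n.

Ltac nat_neq0 :=
  rewrite ?(nat1r, natr1, =^~ natrD) ?(natSC_neq0, factC_neq0) ?andbT //.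

(** * Coefficients in u of (z - x)^K and of its product with the logarithm *)

Section BinomialTables.
Variable R : realType.
Local Notation C := R[i].

Lemma factCS n : (n.+1`!%:R : C) = n.+1%:R * n`!%:R.
Proof. by rewrite factS natrM. Qed.

Lemma harm0 : harm R 0 = 0.
Proof. by rewrite /harm big_geq. Qed.

Lemma harmS n : harm R n.+1 = harm R n + n.+1%:R^-1.
Proof. by rewrite /harm big_nat_recr. Qed.

Definition binz (a : nat) (n : int) : C :=
  if n is Posz n then 'C(a, n)%:R else 0.

(* The derivative at a of the binomial coefficient with variable upper index. *)
Definition dbinz (a : nat) (n : int) : C :=
  if n is Posz n then
    if (n <= a)%N then 'C(a, n)%:R * (harm R a - harm R (a - n))
    else (-1) ^+ (n - a.+1) * a`!%:R * (n - a.+1)`!%:R / n`!%:R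
  else 0.

Lemma binz_pascal a n : binz a.+1 (n + 1)%R = binz a n + binz a (n + 1)%R.
Proof.
case: n => [n|[|n]] /=; first by rewrite addn1 /= binS natrD addrC.
  by rewrite subnn /= !bin0 add0r.
by rewrite add0r.
Qed.

Lemma dbinz_pascal a n : dbinz a.+1 (n + 1)%R = dbinz a n + dbinz a (n + 1)%R.
Proof.
case: n => [n|[|n]] /=; last by rewrite add0r.
  rewrite addn1 /=; case: (ltngtP n a) => [na|na|<-].
  - rewrite ltnS (ltnW na) binS natrD subSS.
    have [d ->] : exists d, a = (n + d.+1)%N.
      by exists (a - n.+1)%N; rewrite addnS -addSn subnKC.
    have -> : (n + d.+1 - n = d.+1)%N by rewrite addKn.
    have -> : (n + d.+1 - n.+1 = d)%N by rewrite addnS subSS addKn.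
    rewrite !harmS; set X := ('C(_, n)%:R : C); set Y := ('C(_, n.+1)%:R : C).
    have XY : X = Y * n.+1%:R / d.+1%:R.
      apply/eqP; rewrite eq_sym (can2_eq (divfK (natSC_neq0 _)) (mulfK (natSC_neq0 _))).
      by rewrite -!natrM mulnC mul_bin_left addKn mulnC.
    by rewrite XY; field; nat_neq0.
  - rewrite ltnS leqNgt na /= subSS.
    have [d ->] : exists d, n = (a + d.+1)%N.
      by exists (n - a.+1)%N; rewrite addnS -addSn subnKC.
    have -> : (a + d.+1 - a.+1 = d)%N by rewrite addnS subSS addKn.
    have -> : ((a + d.+1).+1 - a.+1 = d.+1)%N by rewrite subSS addKn.
    rewrite (factCS a) (factCS d) (factCS (a + d.+1)) exprS.
    by field; nat_neq0.
  - rewrite ltnS leqnn ?ltnn !subnn !binn harm0 expr0 fact0 harmS factCS.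
    by field; nat_neq0.
by rewrite subnn /= !bin0 subrr subn0 !subrr mulr0 addr0.
Qed.

Lemma binz_ge a n : (a < n)%N -> binz a n = 0.
Proof. by move=> h; rewrite /binz bin_small. Qed.

Variables s t : C.
Hypotheses (s0 : s != 0) (t0 : t != 0) (st : 2 * s * t = 1 - t ^+ 2).

Local Notation tau := (t / (2 * s)).
Local Notation z := (s + t).

Let c2 : (2 : C) != 0. Proof. by rewrite pnatr_eq0. Qed.

Section Table.
Variable G : nat -> int -> C.
Hypothesis G_pascal : forall a n, G a.+1 (n + 1)%R = G a n + G a (n + 1)%R.

(** With v = - u t, the relation [st] gives z - x = s (1 + v) (1 + tau (1 + v) / v). Expanding the
    K-th power of the last factor makes (z - x)^K equal to s^K times the sum of C(K, i) tau^i (1 +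
    v)^(K+i) v^(-i), whose coefficient of v^m is [tabsum] for G = [binz]. Differentiating (1 + v)^a
    in a replaces [binz] by [dbinz] and yields (z - x)^K log (1 - u t). Pascal's rule is the only
    property of G that the recurrence in K needs. *)
Definition tabsum (K : nat) (m : int) : C :=
  \sum_(0 <= i < K.+1) 'C(K, i)%:R * G (K + i) (m + i%:Z) * tau ^+ i.

Definition tabcoef (K : nat) (m : int) : C := s ^+ K * (- t) ^ m * tabsum K m.

(** Multiplication by (1 + v) + tau (1 + v)^2 / v. Pascal's rule absorbs 1 + v once in the first
    part ([G1]) and twice in the second ([G2]), where the index i also moves by one; the two parts
    recombine through C(K, i) + C(K, i - 1). *)
Lemma tabsumS K m : tabsum K.+1 m = (tabsum K m + tabsum K (m - 1)%R)
  + tau * (tabsum K (m - 1)%R + 2 * tabsum K m + tabsum K (m + 1)%R).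
Proof.
have G1 a n : G a n + G a (n - 1)%R = G a.+1 n by rewrite addrC -{2 3}(subrK 1 n) G_pascal.
have G2 a n : G a (n - 1)%R + 2 * G a n + G a (n + 1)%R = G a.+2 (n + 1)%R.
  rewrite G_pascal -(G1 a n) G_pascal; ring.
have E1 : tabsum K m + tabsum K (m - 1)%R =
    \sum_(0 <= i < K.+2) 'C(K, i)%:R * G (K + i).+1 (m + i%:Z) * tau ^+ i.
  rewrite big_nat_recr //= bin_small // !mul0r addr0 -big_split /=.
  apply: eq_bigr => i _; rewrite -G1 (_ : m - 1 + i%:Z = m + i%:Z - 1); last by ring.
  ring.
have E2 : tau * (tabsum K (m - 1)%R + 2 * tabsum K m + tabsum K (m + 1)%R) =
    \sum_(0 <= i < K.+2) (if i is i'.+1 then 'C(K, i')%:R else 0) * G (K + i).+1 (m + i%:Z) * tau ^+ i.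
  rewrite big_nat_recl //= !mul0r add0r [X in _ + X + _]mulr_sumr -!big_split /= mulr_sumr.
  apply: eq_bigr => i _.
  rewrite addnS (_ : m + i.+1%:Z = m + i%:Z + 1); last by rewrite intS; ring.
  rewrite -G2 exprS (_ : m - 1 + i%:Z = m + i%:Z - 1); last by ring.
  rewrite (_ : m + 1 + i%:Z = m + i%:Z + 1); last by ring.
  ring.
rewrite E1 E2 -big_split /=; apply: eq_bigr => i _.
rewrite addSn -mulrDl -mulrDl; congr (_ * _ * _).
by case: i => [|i]; rewrite ?bin0 ?addr0 // binS natrD.
Qed.

(** Multiplication by z - (u + 1/u) / 2. The passage from powers of v to powers of u brings in 1 /
    t, which [st] rewrites as 2 s + t. *)
Lemma tabcoefS K m :
  tabcoef K.+1 m = z * tabcoef K m - (tabcoef K (m - 1)%R + tabcoef K (m + 1)%R) / 2.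
Proof.
rewrite /tabcoef tabsumS.
have nt0 : - t != 0 by rewrite oppr_eq0.
rewrite [(- t) ^ (m - 1)%R]expfzDr // [(- t) ^ (m + 1)%R]expfzDr // expr1z exprN1.
have -> : (- t)^-1 = - (2 * s + t).
  apply: (mulfI nt0); rewrite divff // mulrNN mulrC mulrDl st; ring.
rewrite exprS; field.
by rewrite s0.
Qed.

End Table.

(* The coefficients of u^m in (z - x)^K and in (z - x)^K log ((1 - u t) (1 - t / u)),
   for x = (u + 1/u) / 2. *)
Definition bcoef := tabcoef binz.
Definition ccoef K m := tabcoef dbinz K m + tabcoef dbinz K (- m).

Lemma bcoefS K m : bcoef K.+1 m = z * bcoef K m - (bcoef K (m - 1)%R + bcoef K (m + 1)%R) / 2.
Proof. exact: (tabcoefS binz_pascal). Qed.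

Lemma ccoefS K m : ccoef K.+1 m = z * ccoef K m - (ccoef K (m - 1)%R + ccoef K (m + 1)%R) / 2.
Proof.
rewrite /ccoef !(tabcoefS dbinz_pascal) -!opprD !opprB !opprD.
rewrite (_ : 1 - m = - m + 1); last by ring.
by field.
Qed.

Lemma bcoef0 m : bcoef 0 m = (m == 0)%:R.
Proof.
rewrite /bcoef /tabcoef /tabsum big_nat1 expr0 mul1r bin0 addn0 addr0 expr0 mul1r mulr1.
by case: m => [[|m]|m] /=; rewrite ?bin0 ?mulr1 ?expr0z ?bin_small ?mulr0.
Qed.

Lemma ccoef00 : ccoef 0 0 = 0.
Proof.
rewrite /ccoef oppr0 /tabcoef /tabsum big_nat1 /= addn0 subnn harm0.
by rewrite !(mul0r, mulr0, subr0, addr0).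
Qed.

Lemma ccoef0S (m : nat) : ccoef 0 m.+1%:Z = - t ^+ m.+1 / m.+1%:R.
Proof.
rewrite /ccoef /tabcoef /tabsum !big_nat1 /= !addn0 bin0 !expr0 !mulr1 ?mul0r !mulr0 addr0.
rewrite subn1 /= factCS !mul1r -exprnP (exprNn t).
have -> : (-1) ^+ m.+1 * t ^+ m.+1 * ((-1) ^+ m * m`!%:R / (m.+1%:R * m`!%:R))
  = ((-1) ^+ m * (-1) ^+ m) * - t ^+ m.+1 / m.+1%:R :> C.
  by rewrite exprS; field; rewrite factC_neq0 /= nat1r natSC_neq0.
by rewrite -expr2 sqrr_sign mul1r.
Qed.

Lemma ccoefN K m : ccoef K (- m) = ccoef K m.
Proof. by rewrite /ccoef opprK addrC. Qed.

(** The formula of the table is not visibly even in m; evenness is clear at K = 0, and the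
    recurrence in K preserves it. *)
Lemma bcoefN K m : bcoef K (- m) = bcoef K m.
Proof.
elim: K m => [|K IH] m; first by rewrite !bcoef0 oppr_eq0.
rewrite !bcoefS IH -opprD IH (_ : - m + 1 = - (m - 1)%R) ?IH; last by ring.
by rewrite [bcoef K (m + 1)%R + _]addrC.
Qed.

(* m times the coefficient is the logarithmic derivative u d/du, and
   u d/du (z - x) = - (u - u^-1) / 2 when x = (u + u^-1) / 2. *)
Lemma bcoef_mul K m :
  m%:~R * bcoef K.+1 m = - (K.+1%:R / 2) * (bcoef K (m - 1)%R - bcoef K (m + 1)%R).
Proof.
elim: K m => [|K IH] m.
  rewrite bcoefS !bcoef0 subr_eq0 addr_eq0; have [->|m0] := eqVneq m 0.
    by rewrite mul0r; field.
  rewrite mulr0 sub0r; have [->|m1] := eqVneq m 1; first by rewrite /=; field.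
  by have [->|m2] := eqVneq m (-1); rewrite /= ?mulr0n; field.
have mE : m%:~R = (m - 1)%:~R + 1 :> C by rewrite rmorphB /= subrK.
have mE' : m%:~R = (m + 1)%:~R - 1 :> C by rewrite rmorphD /= addrK.
have -> : m%:~R * bcoef K.+2 m = z * (m%:~R * bcoef K.+1 m)
    - ((m - 1)%:~R * bcoef K.+1 (m - 1)%R + bcoef K.+1 (m - 1)%R
       + ((m + 1)%:~R * bcoef K.+1 (m + 1)%R - bcoef K.+1 (m + 1)%R)) / 2.
  by rewrite bcoefS [in LHS]mulrBr [m%:~R * (_ / 2)]mulrA mulrDr {2}mE {2}mE'; ring.
rewrite !IH; move: (bcoefS K (m - 1)%R) (bcoefS K (m + 1)%R).
by rewrite !(addrK, subrK) => -> ->; field.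
Qed.

(** The last term is the contribution of the logarithm to the product rule: u d/du log (z - x) = -
    (u - 1/u) / (2 (z - x)), which lowers (z - x)^(K+1) to (z - x)^K. *)
Lemma ccoef_mul K m :
  m%:~R * ccoef K.+1 m = - (K.+1%:R / 2) * (ccoef K (m - 1)%R - ccoef K (m + 1)%R)
    - (bcoef K (m - 1)%R - bcoef K (m + 1)%R) / 2.
Proof.
have step (F : int -> C) (G : int -> C) : (forall m, F m = z * G m - (G (m - 1)%R + G (m + 1)%R) / 2) ->
  forall m, m%:~R * F m = z * (m%:~R * G m)
    - ((m - 1)%:~R * G (m - 1)%R + G (m - 1)%R + ((m + 1)%:~R * G (m + 1)%R - G (m + 1)%R)) / 2.
  by move=> FG n; rewrite FG rmorphB rmorphD /=; field.
elim: K m => [|K IH] m; last first.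
  rewrite (step _ _ (ccoefS _)) !IH.
  move: (bcoefS K (m - 1)%R) (bcoefS K (m + 1)%R) (ccoefS K (m - 1)%R) (ccoefS K (m + 1)%R).
  by rewrite !(addrK, subrK) => -> -> -> ->; field.
have cP k : k.+1%:R * ccoef 0 k.+1%:Z = - t ^+ k.+1.
  by rewrite ccoef0S mulrC divfK // natSC_neq0.
have zt : z * t = (1 + t ^+ 2) / 2.
  by have st2 : s * t = (1 - t ^+ 2) / 2 by [rewrite -st; field]; rewrite mulrDl st2; field.
have iS (k : nat) : k.+1%:Z - 1 = k by rewrite intS addrC addKr.
have jS (k : nat) : k%:Z + 1 = k.+1%:Z by rewrite intS addrC.
rewrite (step _ _ (ccoefS _)) !bcoef0 mul1r.
have cA : ccoef 0 1%Z = - t by rewrite ccoef0S expr1 divr1.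
(* The cases are m = 0, m = 1, m >= 2, m = -1 and m <= -2. At K = 0, m c_m = - t^m holds only for m
   > 0, while c_0 = 0 and c is even, so the neighbours of 0 are special. A remaining factor z
   disappears by [zt]. *)
case: m => [[|[|m]]|[|m]].
- rewrite sub0r add0r ccoefN mul0r mulr0 rmorphN /= !mulN1r; by field.
- rewrite iS jS mul0r (cP 1%N) mul1r.
  rewrite cA; by rewrite mulrN zt /= ccoef00; field.
- rewrite iS jS !cP !exprS /= mulrN.
  have -> : z * (t * (t * t ^+ m)) = (1 + t ^+ 2) / 2 * (t * t ^+ m) by rewrite -zt; ring.
  by field.
- rewrite NegzE addrC subrr -opprD addrC jS.
  rewrite !ccoefN cA ccoef00 [(- 2%Z)%:~R * _](_ : _ = t ^+ 2).
    have -> : (- 1%Z)%:~R = -1 :> C by [].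
    by rewrite mulrNN mul1r zt /=; field.
  by rewrite rmorphN mulNr (cP 1%N) opprK.
- rewrite NegzE -!opprD jS (_ : - m.+2%:Z + 1 = - m.+1%:Z); last by rewrite -(iS m.+1) opprB addrC.
  rewrite !ccoefN !rmorphN /= !mulNr !cP !exprS.
  have -> : z * - (- (t * (t * t ^+ m))) = (1 + t ^+ 2) / 2 * (t * t ^+ m) by rewrite -zt; ring.
  by field.
Qed.

End BinomialTables.

(** * Closed forms of the coefficients in terms of the polynomials W *)

Section CoefficientsClosedForm.
Variable R : realType.
Local Notation C := R[i].
Implicit Types (k i m K : nat) (e : int).

Let c2 : (2 : C) != 0. Proof. by rewrite pnatr_eq0. Qed.

(* (k + i)! / (k - i)!, and 0 for i > k *)
Definition cffact k i : C := ((k + i) ^_ (i + i))%:R.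

Lemma cffact0 k : cffact k 0 = 1.
Proof. by rewrite /cffact addn0 ffactn0. Qed.

Lemma cffactSr k i : cffact k i.+1 = cffact k i * ((k%:R - i%:R) * (k%:R + i%:R + 1)).
Proof.
rewrite /cffact !addnS !addSn ffactSS ffactnSr !natrM.
rewrite [X in X * _](_ : _ = k%:R + i%:R + 1); last by rewrite -natrD natr1.
have [ki|ki] := leqP i k; last by rewrite ffact_small ?ltn_add2r // !(mul0r, mulr0).
by rewrite subnDr natrB //; ring.
Qed.

Lemma cffactSS k i : cffact k.+1 i.+1 = cffact k i * ((k%:R + i%:R + 1) * (k%:R + i%:R + 2)).
Proof.
rewrite /cffact !addnS !addSn !ffactSS !natrM.
rewrite -(natr1 (k + i).+1) -(natr1 (k + i)) natrD; ring.
Qed.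

Lemma cffact_fact k i : (i <= k)%N -> cffact k i = (k + i)`!%:R / (k - i)`!%:R.
Proof.
move=> ik; rewrite -[LHS](mulfK (factC_neq0 (k - i))) -natrM; congr (_%:R / _).
by rewrite -(ffact_fact (leq_add ik (leqnn i))) subnDr.
Qed.

Lemma cffact_gt k i : (k < i)%N -> cffact k i = 0.
Proof. by move=> ki; rewrite /cffact ffact_small // ltn_add2r. Qed.

(** The function 1 / Gamma (e + 1) on integers; negative e are needed for the coefficient of
    u^(-m). *)
Definition ifact e : C := if e is Posz n then n`!%:R^-1 else 0.

(** For e = m >= 0 this is 2F1 (- k, k + 1; m + 1; - tau) / m!, up to an elementary factor the
    Legendre function of the first kind of degree k and order - m at 1 + 2 tau. *)
Definition legW (tau : C) k e : C :=
  \sum_(0 <= i < k.+1) cffact k i * ifact (e + i%:Z) / i`!%:R * tau ^+ i.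

Lemma legW_widen (tau : C) k e N : (k < N)%N ->
  legW tau k e = \sum_(0 <= i < N) cffact k i * ifact (e + i%:Z) / i`!%:R * tau ^+ i.
Proof.
move=> kN; rewrite (big_cat_nat (leq0n k.+1) kN) //= [X in _ + X]big_nat_cond [X in _ + X]big1 ?addr0 //.
by move=> i /andP[/andP[ki _] _]; rewrite cffact_gt // !mul0r.
Qed.

Lemma legW0 (tau : C) m : legW tau 0 m = m`!%:R^-1.
Proof. by rewrite /legW big_nat1 cffact0 expr0 mulr1 mul1r /= addn0 fact0 divr1. Qed.

Lemma legW1 (tau : C) m : legW tau 1 m = m`!%:R^-1 * (1 + 2 * tau / m.+1%:R).
Proof.
rewrite /legW big_nat_recr //= big_nat1 cffactSr !cffact0 expr0 addn0 addn1 factCS /= !divr1.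
by field; nat_neq0.
Qed.

(** The three-term recurrence of Legendre functions in the degree, at the argument 1 + 2 tau. It is
    checked on each power of tau, after the sums are padded with zero terms to a common length. *)
Lemma legW_rec (tau : C) k m :
  (m + k).+2%:R * legW tau k.+2 m - (2 * k + 3)%:R * (1 + 2 * tau) * legW tau k.+1 m
  + (k.+1%:R - m%:R) * legW tau k m = 0.
Proof.
set N := k.+4; have kN : (k.+1 < N)%N by exact: (leq_addl 2 k.+2).
rewrite -[(2 * k + 3)%:R * _ * _]mulrA.
have -> : (1 + 2 * tau) * legW tau k.+1 m = \sum_(0 <= i < N)
    (cffact k.+1 i * ifact (m%:Z + i%:Z) / i`!%:R * tau ^+ i
     + (if i is j.+1 then 2 * (cffact k.+1 j * ifact (m%:Z + j%:Z) / j`!%:R * tau ^+ i) else 0)).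
  rewrite big_split /= -(@legW_widen tau k.+1 m%:Z N) // mulrDl mul1r; apply: (congr1 (fun y => _ + y)).
  rewrite big_nat_recl //= add0r (legW_widen tau m (N := k.+3)) // -mulrA !mulr_sumr.
  by apply: eq_bigr => i _; rewrite exprS /=; ring.
rewrite (legW_widen tau m (N := N)) // (legW_widen tau m (N := N) (k := k)); last by rewrite /N; do 3 apply: ltnW.
rewrite !mulr_sumr -sumrB -big_split /=; apply: big1 => i _.
have mE : (m + k).+2%:R = m%:R + k%:R + 2 :> C by rewrite -natr1 -natr1 natrD; ring.
have kE : (2 * k + 3)%:R = 2 * k%:R + 3 :> C by rewrite natrD natrM.
rewrite mE kE -(natr1 k); case: i => [|[|i]].
- by rewrite !cffact0 /= addn0 fact0; field; nat_neq0.
- rewrite !cffactSr !cffact0 /= addn0 addn1 factCS -?(natr1 k.+1) -?(natr1 k) -?(natr1 m).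
  by field; rewrite natr1; nat_neq0.
rewrite !cffactSS !cffactSr /= !addnS !factCS.
have [->|f0] := eqVneq (cffact k i) 0; first by rewrite !(mul0r, mulr0); ring.
by rewrite -?natr1 ?natrD; field; rewrite -?natrD ?natr1; nat_neq0.
Qed.

(** As (k - i) (k + i + 1) = (K - i) (K + i + 1) - (K - k) (K + k + 1), passing from i to i + 1
    multiplies the sum by (K - i) (K + i + 1) and adds a sum without denominators, which [tele]
    evaluates. Hence a descending induction on i from i = K, where both sides vanish. *)
Lemma alpha_sum K i : (i <= K)%N ->
  cffact K i * (harm R (K + i) - harm R (K + K)) =
  \sum_(0 <= k < K) (-1) ^+ (K + k) * (2 * k + 1)%:R
    / ((K - k)%:R * (K + k + 1)%:R) * cffact k i.
Proof.
set coef := fun k => (-1) ^+ (K + k) * (2 * k + 1)%:R / ((K - k)%:R * (K + k + 1)%:R) : C.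
rewrite -[X in _ = X]/(\sum_(0 <= k < K) coef k * cffact k i).
have tele j : \sum_(0 <= k < K) (-1) ^+ k * (2 * k + 1)%:R * cffact k j =
    - (-1) ^+ K * cffact K j * (K%:R - j%:R).
  elim: {coef} K j => [|K IH] j.
    rewrite big_nil mulN1r; case: j => [|j]; first by rewrite subrr mulr0.
    by rewrite cffact_gt // oppr0 mul0r.
  rewrite big_nat_recr //= IH natrD natrM exprS.
  case: j => [|j]; first by rewrite !cffact0 -natr1; ring.
  rewrite cffactSr cffactSS -!natr1; ring.
have step j : \sum_(0 <= k < K) coef k * cffact k j.+1 =
    (K%:R - j%:R) * (K%:R + j%:R + 1) * (\sum_(0 <= k < K) coef k * cffact k j)
    + cffact K j * (K%:R - j%:R).
  transitivity ((K%:R - j%:R) * (K%:R + j%:R + 1) * (\sum_(0 <= k < K) coef k * cffact k j)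
     - (-1) ^+ K * \sum_(0 <= k < K) (-1) ^+ k * (2 * k + 1)%:R * cffact k j).
    rewrite !mulr_sumr -sumrB; apply: eq_big_nat => k /andP[_ kK].
    rewrite cffactSr /coef exprD natrB ?(ltnW kK) // !natrD.
    have nz1 : K%:R - k%:R != 0 :> C by rewrite -natrB ?(ltnW kK) // pnatr_eq0 -lt0n subn_gt0.
    by field; rewrite nz1; nat_neq0.
  have e1 : (-1) ^+ K * (-1) ^+ K = 1 :> C by rewrite -expr2 sqrr_sign.
  rewrite tele -[cffact K j * _ in RHS]mul1r.
  by rewrite -[X in X * (cffact K j * _)]e1; ring.
move=> iK; have [d] : exists d, (i + d = K)%N by exists (K - i)%N; rewrite subnKC.
elim: d i iK => [|d IH] i iK iE.
  rewrite addn0 in iE; rewrite iE subrr mulr0 big_nat_cond big1 // => k /andP[/andP[_ kK] _].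
  by rewrite cffact_gt ?mulr0.
have iK' : (i < K)%N by rewrite -iE addnS ltnS leq_addr.
have := IH i.+1 iK'; rewrite addSnnS iE => /(_ erefl); rewrite step.
have d0 : K%:R - i%:R != 0 :> C by rewrite -iE natrD addrAC subrr add0r natSC_neq0.
have k0 : K%:R + i%:R + 1 != 0 :> C by rewrite -natrD natr1 natSC_neq0.
rewrite cffactSr addnS harmS -natr1 natrD => E.
apply: (mulfI (mulf_neq0 d0 k0)); move: E => /eqP; rewrite -subr_eq => /eqP <-.
by field.
Qed.

Variables s t : C.
Hypotheses (s0 : s != 0) (t0 : t != 0) (st : 2 * s * t = 1 - t ^+ 2).

Local Notation tau := (t / (2 * s)).
Local Notation z := (s + t).
Local Notation bcoef := (@bcoef R s t).
Local Notation ccoef := (@ccoef R s t).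
Local Notation W := (legW tau).

(** The natural number d = K - e expresses e <= K for an integer e of either sign. It is also (K +
    i) - (e + i), the same for every i. *)
Let bin_ifact K i e d : (i <= K)%N -> e + d%:Z = K%:Z ->
  'C(K, i)%:R * binz R (K + i) (e + i%:Z) =
  K`!%:R / d`!%:R * (cffact K i * ifact (e + i%:Z) / i`!%:R).
Proof.
move=> iK eK; rewrite cffact_fact //.
case En: (e + i%:Z) => [n|n] /=; last by rewrite !(mulr0, mul0r).
have nE : (n + d = K + i)%N.
  by apply/eqP; rewrite -eqz_nat !PoszD -En -eK addrAC.
have nK : (n <= K + i)%N by rewrite -nE leq_addr.
have dE : (K + i - n = d)%N by rewrite -nE addKn.
have E1 : 'C(K, i)%:R = K`!%:R / (i`!%:R * (K - i)`!%:R) :> C.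
  by rewrite -(bin_fact iK) !natrM mulfK // mulf_neq0 // factC_neq0.
have E2 : 'C(K + i, n)%:R = (K + i)`!%:R / (n`!%:R * d`!%:R) :> C.
  by rewrite -(bin_fact nK) dE !natrM mulfK // mulf_neq0 // factC_neq0.
by rewrite E1 E2; field; nat_neq0.
Qed.

Lemma bcoef_legW K e d : e + d%:Z = K%:Z ->
  bcoef K e = s ^+ K * (- t) ^ e * (K`!%:R / d`!%:R * W K e).
Proof.
move=> eK; rewrite /bcoef /tabcoef /tabsum /legW; congr (_ * _); rewrite mulr_sumr.
apply: eq_big_nat => i /andP[_ iK].
by rewrite (bin_ifact _ eK) // -!mulrA.
Qed.

Lemma legW_neg k m : (k < m)%N -> W k (- m%:Z) = 0.
Proof.
move=> km; rewrite /legW big_nat_cond big1 // => i /andP[/andP[_ ik] _].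
have im : (i < m)%N by apply: leq_ltn_trans km.
have -> : - m%:Z + i%:Z = Negz (m - i).-1.
  by rewrite NegzE prednK ?subn_gt0 // -subzn ?(ltnW im) // opprB addrC.
by rewrite /= mulr0 !mul0r.
Qed.

(** This is the evenness [bcoefN], with both coefficients written by [bcoef_legW]. *)
Lemma legW_sym k m : (m <= k)%N ->
  (- t) ^ (- m%:Z) * W k (- m%:Z) = (- t) ^ m * ((k + m)`!%:R / (k - m)`!%:R) * W k m.
Proof.
move=> mk; have := bcoefN s0 t0 st k m.
rewrite (@bcoef_legW k (- m%:Z) (k + m)) ?PoszD; last by rewrite addrCA addNr addr0.
rewrite (@bcoef_legW k m (k - m)); last by rewrite -subzn // addrCA subrr addr0.
rewrite -!mulrA => /(mulfI (expf_neq0 k s0)) E.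
have E0 : k`!%:R / (k + m)`!%:R != 0 :> C by rewrite mulf_neq0 ?invr_eq0 ?factC_neq0.
apply: (mulfI E0); transitivity ((- t) ^ (- m%:Z) * (k`!%:R * ((k + m)`!%:R^-1 * W k (- m%:Z)))).
  by ring.
by rewrite E; field; nat_neq0.
Qed.

Definition wgt K k : C := (-1) ^+ (K + k) * (2 * k + 1)%:R / ((K - k)%:R * (K + k + 1)%:R).

(** In the derivative of each binomial coefficient, harm R (K + i) - harm R d, only the first
    harmonic number depends on i. It is split into [harm R (K + K)] and a difference that
    [alpha_sum] expands; exchanging the two sums then produces the W_k. *)
Lemma dbinz_tabcoef K e d : e + d%:Z = K%:Z ->
  tabcoef s t (@dbinz R) K e = bcoef K e * (harm R (K + K) - harm R d)
    + s ^+ K * (- t) ^ e * (K`!%:R / d`!%:R * \sum_(0 <= k < K) wgt K k * W k e).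
Proof.
move=> eK; rewrite (bcoef_legW eK) /tabcoef /tabsum -!mulrA -!mulrDr; congr (_ * (_ * _)).
have -> : \sum_(0 <= k < K) wgt K k * W k e = \sum_(0 <= i < K.+1)
    cffact K i * (harm R (K + i) - harm R (K + K)) * (ifact (e + i%:Z) / i`!%:R * tau ^+ i).
  under eq_big_nat => k /andP[_ kK] do rewrite (@legW_widen _ _ _ K.+1) 1?ltnW // mulr_sumr.
  rewrite exchange_big_nat /=; apply: eq_big_nat => i /andP[_ iK].
  rewrite alpha_sum // mulr_suml; apply: eq_bigr => k _.
  by rewrite -/(wgt K k); ring.
rewrite /legW mulr_suml -big_split /= !mulr_sumr; apply: eq_big_nat => i /andP[_ iK].
have -> : dbinz R (K + i) (e + i%:Z) = binz R (K + i) (e + i%:Z) * (harm R (K + i) - harm R d).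
  case En: (e + i%:Z) => [n|n] /=; last by rewrite mul0r.
  have nE : (n + d = K + i)%N.
    by apply/eqP; rewrite -eqz_nat !PoszD -En -eK addrAC.
  by rewrite -nE leq_addr addKn.
by rewrite mulrA (bin_ifact _ eK) //; ring.
Qed.

(** The halves at m and - m have d = K - m and d = K + m. In the second one W_k^(-m) vanishes for k
    < m, so the sum starts at m, and [legW_sym] reflects the other terms. *)
Lemma ccoef_le K m : (m <= K)%N ->
  ccoef K m = bcoef K m * (2 * harm R (K + K) - harm R (K - m) - harm R (K + m))
    + s ^+ K * (- t) ^+ m * K`!%:R * ((\sum_(0 <= k < K) wgt K k * W k m) / (K - m)`!%:R
      + (\sum_(m <= k < K) wgt K k * ((k + m)`!%:R / (k - m)`!%:R) * W k m) / (K + m)`!%:R).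
Proof.
move=> mK; rewrite /ccoef (@dbinz_tabcoef K m (K - m)); last by rewrite -subzn // addrCA subrr addr0.
rewrite (@dbinz_tabcoef K (- m%:Z) (K + m)) ?PoszD; last by rewrite addrCA addNr addr0.
rewrite (bcoefN s0 t0 st).
have -> : s ^+ K * (- t) ^ (- m%:Z) * (K`!%:R / (K + m)`!%:R * \sum_(0 <= k < K) wgt K k * W k (- m%:Z)) =
    s ^+ K * (- t) ^+ m * (K`!%:R / (K + m)`!%:R
      * (\sum_(m <= k < K) wgt K k * ((k + m)`!%:R / (k - m)`!%:R) * W k m)).
  rewrite -!mulrA; congr (_ * _).
  rewrite mulrCA [RHS]mulrCA; congr (_ * _); rewrite mulrCA [RHS]mulrCA; congr (_ * _).
  rewrite (big_cat_nat (leq0n m) mK) /= big_nat_cond big1 ?add0r; last first.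
    by move=> k /andP[/andP[_ km] _]; rewrite legW_neg ?mulr0.
  rewrite !mulr_sumr; apply: eq_big_nat => k /andP[mk kK].
  by rewrite mulrCA legW_sym // -exprnP; ring.
by rewrite -exprnP; ring.
Qed.

Lemma bcoef_le K m : (m <= K)%N ->
  bcoef K m = s ^+ K * (- t) ^+ m * K`!%:R / (K - m)`!%:R * W K m.
Proof.
move=> mK; rewrite (@bcoef_legW K m (K - m)) -?exprnP; first by ring.
by rewrite -subzn // addrCA subrr addr0.
Qed.

Lemma bcoef_gt K m : (K < m)%N -> bcoef K m = 0.
Proof.
move=> Km; rewrite /bcoef /tabcoef /tabsum big1 ?mulr0 // => i _.
have -> : binz R (K + i) (m%:Z + i%:Z) = 0 by apply: (@binz_ge R _ (m + i)); rewrite ltn_add2r.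
by rewrite mulr0 mul0r.
Qed.

(** Here m + i exceeds K + i for every i, so that [dbinz] is always in its second branch and no
    harmonic number appears; the half at - m only has negative lower indices. *)
Lemma ccoef_gt K m : (K < m)%N ->
  ccoef K m = - (-1) ^+ K * (m - K.+1)`!%:R * K`!%:R * s ^+ K * t ^+ m * W K m.
Proof.
move=> Km; rewrite /ccoef.
have -> : tabcoef s t (@dbinz R) K (- m%:Z) = 0.
  rewrite /tabcoef /tabsum big_nat_cond big1 ?mulr0 // => i /andP[/andP[_ iK] _].
  have im : (i < m)%N by apply: leq_ltn_trans Km.
  have -> : - m%:Z + i%:Z = Negz (m - i).-1.
    by rewrite NegzE prednK ?subn_gt0 // -subzn ?(ltnW im) // opprB addrC.
  by rewrite /= mulr0 mul0r.
rewrite addr0 /tabcoef -exprnP (exprNn t) /tabsum /legW !mulr_sumr.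
apply: eq_big_nat => i /andP[_ iK] /=.
rewrite [(m + i <= _)%N]leqNgt ltn_add2r Km /= -addSn subnDr.
have mE : (m - K.+1 + K.+1 = m)%N by rewrite subnK.
have -> : (-1) ^+ m = - ((-1) ^+ (m - K.+1) * (-1) ^+ K) :> C.
  by rewrite -{1}mE exprD exprS mulN1r mulrN.
have E1 : 'C(K, i)%:R = K`!%:R / (i`!%:R * (K - i)`!%:R) :> C.
  by rewrite -(bin_fact (iK : i <= K)%N) !natrM mulfK // mulf_neq0 // factC_neq0.
rewrite E1 cffact_fact //.
set e1 := (-1) ^+ (m - _).
have e1e : e1 * e1 = 1 by rewrite -expr2 sqrr_sign.
transitivity (- (e1 * e1) * (-1) ^+ K * (m - K.+1)`!%:R * K`!%:R * s ^+ K * t ^+ m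
   * ((K + i)`!%:R / (K - i)`!%:R / (m + i)`!%:R / i`!%:R * tau ^+ i)).
  by rewrite [(K + i)%N]addnC; field; nat_neq0.
by rewrite e1e; ring.
Qed.

(** The prefactor removes - (K + 1) / 2 from [ccoef_mul], and subtracting H_K times [bcoef] cancels
    the extra term there, because H_(K+1) - H_K = 1 / (K + 1). *)
Definition dcoef K e : C := (-2) ^+ K / K`!%:R * (ccoef K e - harm R K * bcoef K e).

Lemma dcoef_mul K e : e%:~R * dcoef K.+1 e = dcoef K (e - 1)%R - dcoef K (e + 1)%R.
Proof.
transitivity ((-2) ^+ K.+1 / K.+1`!%:R *
   (e%:~R * ccoef K.+1 e - harm R K.+1 * (e%:~R * bcoef K.+1 e))).
  by rewrite /dcoef; ring.
rewrite (ccoef_mul s0 t0 st) (bcoef_mul s0 t0 st) /dcoef harmS factCS exprS.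
by field; nat_neq0.
Qed.

Definition ebcoef K e : C := (-2) ^+ K / K`!%:R * bcoef K e.

Lemma ebcoef_mul K e : e%:~R * ebcoef K.+1 e = ebcoef K (e - 1)%R - ebcoef K (e + 1)%R.
Proof.
transitivity ((-2) ^+ K.+1 / K.+1`!%:R * (e%:~R * bcoef K.+1 e)).
  by rewrite /ebcoef; ring.
rewrite (bcoef_mul s0 t0 st) /ebcoef factCS exprS.
by field; nat_neq0.
Qed.

End CoefficientsClosedForm.

(** * The principal logarithm, its additivity, and the Joukowski map *)

Section ComplexLogarithm.
Variable R : realType.
Local Notation C := R[i].
Local Notation re := (@complex.Re R).
Local Notation im := (@complex.Im R).
Local Notation nc := (@Normc.normc R).
Implicit Types (y z a c : C).

Lemma eqC_reim y z : re y = re z -> im y = im z -> y = z.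
Proof. by case: y z => ? ? [? ?] /= -> ->. Qed.

Lemma reD y z : re (y + z) = re y + re z. Proof. by case: y z => ? ? [? ?]. Qed.
Lemma imD y z : im (y + z) = im y + im z. Proof. by case: y z => ? ? [? ?]. Qed.
Lemma reN y : re (- y) = - re y. Proof. by case: y. Qed.
Lemma imN y : im (- y) = - im y. Proof. by case: y. Qed.
Lemma reM y z : re (y * z) = re y * re z - im y * im z. Proof. by case: y z => ? ? [? ?]. Qed.
Lemma imM y z : im (y * z) = re y * im z + im y * re z.
Proof. by case: y z => ? ? [? ?] /=; rewrite addrC. Qed.

Lemma sqr_nc y : nc y ^+ 2 = re y ^+ 2 + im y ^+ 2.
Proof. by case: y => a b /=; rewrite sqr_sqrtr // addr_ge0 ?sqr_ge0. Qed.

Lemma re_cexp z : re (cexp z) = expR (re z) * cos (im z).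
Proof. by rewrite /cexp reM /= mul0r subr0. Qed.

Lemma im_cexp z : im (cexp z) = expR (re z) * sin (im z).
Proof. by rewrite /cexp imM /= mul0r addr0. Qed.

Lemma nc_cexp z : nc (cexp z) = expR (re z).
Proof.
apply/eqP; rewrite -(eqrXn2 (n := 2)) ?nc_ge0 ?expR_ge0 // sqr_nc re_cexp im_cexp.
by rewrite !exprMn -mulrDr cos2Dsin2 mulr1.
Qed.

Lemma cexp_neq0 z : cexp z != 0.
Proof. by rewrite -nc_gt0 nc_cexp expR_gt0. Qed.

Lemma cexp0 : cexp 0 = 1 :> C.
Proof. by apply: eqC_reim; rewrite ?re_cexp ?im_cexp /= expR0 mul1r ?cos0 ?sin0. Qed.

Lemma cexpN z : cexp (- z) = (cexp z)^-1.
Proof.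
apply: (mulfI (cexp_neq0 z)); rewrite -cexpD subrr cexp0 divff ?cexp_neq0 //.
Qed.

Lemma cexpMn z n : cexp (z *+ n) = cexp z ^+ n.
Proof. by elim: n => [|n IH]; rewrite ?mulr0n ?cexp0 // mulrS cexpD IH exprS. Qed.

Lemma clog_unique z y : - pi < im z <= pi -> cexp z = y -> clog y = z.
Proof.
move=> /andP[h1 h2] <-; apply: eqC_reim.
  by rewrite -[LHS]/(ln (nc (cexp z))) nc_cexp expRK.
rewrite -[LHS]/(carg (cexp z)).
rewrite /carg nc_cexp re_cexp im_cexp mulrAC divff ?lt0r_neq0 ?expR_gt0 // mul1r.
rewrite pmulr_rge0 ?expR_gt0 //; have [z0|z0] := leP 0 (im z).
  by rewrite sin_ge0_pi ?z0 // cosK // in_itv /= z0.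
have -> : (0 <= sin (im z)) = false.
  by apply/negbTE; rewrite -ltNge -oppr_gt0 -sinN sin_gt0_pi // oppr_gt0 z0 ltrNl.
by rewrite cosKN ?opprK // !ltW.
Qed.

Lemma re_carg y : y != 0 -> re y = nc y * cos (carg y).
Proof.
move=> y0; rewrite -{1}(cexp_clog y0) re_cexp /= lnK //.
by rewrite posrE nc_gt0.
Qed.

Lemma im_carg y : y != 0 -> im y = nc y * sin (carg y).
Proof.
move=> y0; rewrite -{1}(cexp_clog y0) im_cexp /= lnK //.
by rewrite posrE nc_gt0.
Qed.

Let acos_itv y : y != 0 -> -1 <= re y / nc y <= 1.
Proof.
move=> y0; have n0 : 0 < nc y by rewrite nc_gt0.
by rewrite -ler_norml normrM normfV (gtr0_norm n0) ler_pdivrMr // mul1r re_le_nc.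
Qed.

Lemma carg_bound y : y != 0 -> - pi < carg y <= pi.
Proof.
move=> y0; have hy := acos_itv y0; have [p0 p1] := (acos_ge0 hy, acos_lepi hy).
have pp := pi_gt0 R.
have := im_carg y0; rewrite /carg; case: ifPn => [i0 _|].
  by rewrite p1 andbT (lt_le_trans _ p0) // oppr_lt0.
rewrite -ltNge => i0 e; apply/andP; split; last by lra.
rewrite lt_neqAle lerN2 p1 andbT; apply: contraTneq i0 => h.
by rewrite -leNgt e -h sinN sinpi oppr0 mulr0.
Qed.

Lemma cutplane0P y : cutplane 0 y <-> y != 0 /\ carg y < pi.
Proof.
split=> [h|[y0 h] [i0 r0]].
  have y0 : y != 0 by apply/eqP => y0; apply: h; rewrite y0.
  split=> //; have /andP[_ h2] := carg_bound y0; rewrite lt_neqAle h2 andbT.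
  apply/eqP => e; apply: h; rewrite im_carg // re_carg // e sinpi cospi mulr0 mulrN1.
  by rewrite oppr_le0 nc_ge0.
have n0 : 0 < nc y by rewrite nc_gt0.
have n2 := sqr_nc y; rewrite i0 expr0n addr0 in n2.
have nE : nc y = - re y.
  by apply/eqP; rewrite -(eqrXn2 (n := 2)) ?nc_ge0 ?oppr_ge0 // sqrrN n2.
by move: h; rewrite /carg i0 lexx nE invrN mulrN divff ?acosN1 ?ltxx // -oppr_eq0 -nE lt0r_neq0.
Qed.

Lemma cutplane0_neq0 y : cutplane 0 y -> y != 0.
Proof. by move=> /cutplane0P[]. Qed.

Lemma carg_cut y : cutplane 0 y -> - pi < carg y < pi.
Proof. by move=> /cutplane0P[y0 ->]; case/andP: (carg_bound y0) => ->. Qed.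

Lemma cutplane0_re y : 0 < re y -> cutplane 0 y.
Proof. by move=> h [_]; rewrite leNgt h. Qed.

Lemma carg_re_gt0 y : 0 < re y -> - (pi / 2) < carg y < pi / 2.
Proof.
move=> r0; have y0 := cutplane0_neq0 (cutplane0_re r0).
have hy := acos_itv y0; have n0 : 0 < nc y by rewrite nc_gt0.
have p2 : acos (re y / nc y) < pi / 2.
  rewrite ltNge; apply/negP => h.
  have := acosK (x := re y / nc y); rewrite in_itv /= => /(_ hy) e.
  have : 0 < re y / nc y by rewrite divr_gt0.
  rewrite -e ltNge => /negP; apply.
  have := sin_ge0_pi (x := acos (re y / nc y) - pi / 2).
  rewrite sinB cos_pihalf sin_pihalf mulr0 mulr1 sub0r oppr_ge0; apply.
  by have := acos_lepi hy; have := pi_gt0 R; lra.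
have := acos_ge0 hy; have := pi_gt0 R.
by rewrite /carg; case: ifP => _; lra.
Qed.

Lemma clogM y z : y != 0 -> z != 0 -> - pi < carg y + carg z <= pi ->
  clog (y * z) = clog y + clog z.
Proof.
move=> y0 z0 h; apply: clog_unique; first by rewrite imD.
by rewrite cexpD !cexp_clog.
Qed.

Lemma clogM_re y z : 0 < re y -> 0 < re z -> clog (y * z) = clog y + clog z.
Proof.
move=> ry rz; have := carg_re_gt0 ry; have := carg_re_gt0 rz.
move=> /andP[h1 h2] /andP[h3 h4].
apply: clogM; rewrite ?(cutplane0_neq0 (cutplane0_re _)) //.
by lra.
Qed.

Lemma cutplane0M_re y z : 0 < re y -> 0 < re z -> cutplane 0 (y * z).
Proof.
move=> ry rz; have := carg_re_gt0 ry; have := carg_re_gt0 rz.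
move=> /andP[h1 h2] /andP[h3 h4].
have := cutplane0_neq0 (cutplane0_re ry); have := cutplane0_neq0 (cutplane0_re rz).
move=> z0 y0; apply/cutplane0P; split; first by rewrite mulf_neq0.
have := clogM_re ry rz => /(congr1 im); rewrite imD /= => ->; lra.
Qed.

(* A segment from the upper to the lower half plane crosses the real axis; at
   the crossing point q c > 0, while q stays in the upper half plane. *)
Let no_crossing (c1 c2 a1 a2 : R) :
  (forall t, 0 <= t <= 1 -> ~ (c2 * (1 - t) + t * (c1 * a2 + c2 * a1) = 0 /\
      c1 * (1 - t) + t * (c1 * a1 - c2 * a2) <= 0)) ->
  0 < c2 -> 0 < a2 -> c1 * a2 + c2 * a1 < 0 -> False.
Proof.
move=> h c20 a20; set m := c1 * a2 + c2 * a1 => m0.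
have d0 : 0 < c2 - m by lra.
pose t := c2 / (c2 - m).
have t01 : 0 <= t <= 1.
  by apply/andP; split; [rewrite /t divr_ge0 // ltW | rewrite /t ler_pdivrMr // mul1r; lra].
have t0 : 0 < t by rewrite /t divr_gt0.
have e1 : c2 * (1 - t) + t * m = 0 by rewrite /t; field; rewrite lt0r_neq0.
apply: (h t t01); split=> //.
set p := c1 * (1 - t) + _.
have pE : p * c2 = - ((c1 ^+ 2 + c2 ^+ 2) * (t * a2)).
  have e2 : c2 * (1 - t + t * a1) = - (c1 * (t * a2)) by move: e1; rewrite /m; lra.
  rewrite /p; transitivity (c1 * (c2 * (1 - t + t * a1)) - c2 ^+ 2 * (t * a2)); first by ring.
  by rewrite e2; ring.
by rewrite -(pmulr_lle0 _ c20) pE oppr_le0 mulr_ge0 ?addr_ge0 ?sqr_ge0 // mulr_ge0 // ltW.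
Qed.

(** The points c (1 - t + t a) run from c to c a. If the arguments added up to more than pi in
    absolute value, c and a would lie in one open half plane and c a in the other, and the segment
    would cross the negative real axis by [no_crossing]. *)
Lemma clogM_segment c a : cutplane 0 a ->
  (forall t : R, 0 <= t <= 1 -> cutplane 0 (c * (1 - t%:C + t%:C * a))) ->
  clog (c * a) = clog c + clog a.
Proof.
move=> ha h.
have hc : cutplane 0 c by have := h 0; rewrite lexx ler01 mul0r subr0 addr0 mulr1; apply.
have hca : cutplane 0 (c * a).
  by have := h 1; rewrite lexx ler01 mul1r subrr add0r; apply.
have [c0 a0] := (cutplane0_neq0 hc, cutplane0_neq0 ha).
have := carg_cut hc; have := carg_cut ha; move=> /andP[a1 a2] /andP[c1 c2].
have pp := pi_gt0 R.
have segE t : c * (1 - t%:C + t%:C * a) = (re c * (1 - t) + t * (re c * re a - im c * im a))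
    +i* (im c * (1 - t) + t * (re c * im a + im c * re a)).
  by apply: eqC_reim; rewrite ?reM ?imM !(reD, imD, reN, imN, reM, imM) /=; ring.
have imE : im (c * a) = nc (c * a) * sin (carg c + carg a).
  by rewrite ncM imM (re_carg c0) (im_carg c0) (re_carg a0) (im_carg a0) sinD; ring.
have n0 : 0 < nc (c * a) by rewrite nc_gt0 mulf_neq0.
have gt0 y : y != 0 -> 0 < carg y < pi -> 0 < im y.
  by move=> y0 hy; rewrite im_carg // mulr_gt0 ?nc_gt0 // sin_gt0_pi.
have lt0 y : y != 0 -> - pi < carg y < 0 -> im y < 0.
  move=> y0 /andP[hy1 hy2]; rewrite im_carg // pmulr_rlt0 ?nc_gt0 // -oppr_gt0 -sinN.
  by rewrite sin_gt0_pi // oppr_gt0 hy2 ltrNl.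
apply: clogM => //; apply/andP; split.
- rewrite ltNge; apply/negP => hs.
  (* At exactly - pi the product c a itself lies on the cut. *)
  have [hs1|hs1] := eqVneq (carg c + carg a) (- pi).
    apply: hca; split; first by rewrite imE hs1 sinN sinpi oppr0 mulr0.
    rewrite reM (re_carg c0) (im_carg c0) (re_carg a0) (im_carg a0).
    have -> : forall A B x y x' y' : R, A * x * (B * y) - A * x' * (B * y') = A * B * (x * y - x' * y').
      by move=> *; ring.
    by rewrite -cosD hs1 cosN cospi mulrN1 oppr_le0 mulr_ge0 ?nc_ge0.
  have hs2 : carg c + carg a < - pi by rewrite lt_neqAle hs1.
  have ia : im a < 0 by apply: lt0 => //; lra.
  have ic : im c < 0 by apply: lt0 => //; lra.
  have ica : 0 < im (c * a).
    rewrite imE mulr_gt0 //; have -> : carg c + carg a = (carg c + carg a + pi) - pi by ring.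
    rewrite sinB cospi sinpi mulr0 subr0 mulrN1 -sinN sin_gt0_pi //; lra.
  (* Complex conjugation brings the lower half plane to the upper one. *)
  apply: (@no_crossing (re c) (- im c) (re a) (- im a)); rewrite ?oppr_gt0 //.
    move=> t t01 [h1 h2]; apply: (h t t01); rewrite segE; split=> /=; lra.
  by move: ica; rewrite imM; lra.
- rewrite leNgt; apply/negP => hs.
  have ia : 0 < im a by apply: gt0 => //; lra.
  have ic : 0 < im c by apply: gt0 => //; lra.
  have ica : im (c * a) < 0.
    rewrite imE pmulr_rlt0 //; have -> : carg c + carg a = (carg c + carg a - pi) + pi by ring.
    rewrite sinD cospi sinpi mulr0 addr0 mulrN1 oppr_lt0 sin_gt0_pi //; lra.
  apply: (@no_crossing (re c) (im c) (re a) (im a)) => //.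
    move=> t t01 [h1 h2]; apply: (h t t01); rewrite segE; split=> /=; lra.
  by move: ica; rewrite imM; lra.
Qed.

Lemma cpow_neq0 y a : cpow y a != 0.
Proof. exact: cexp_neq0. Qed.

Lemma cpowD y a c : cpow y (a + c) = cpow y a * cpow y c.
Proof. by rewrite /cpow mulrDl cexpD. Qed.

Lemma cpowN y a : cpow y (- a) = (cpow y a)^-1.
Proof. by rewrite /cpow mulNr cexpN. Qed.

Lemma cpow1 y : y != 0 -> cpow y 1 = y.
Proof. by move=> y0; rewrite /cpow mul1r cexp_clog. Qed.

Lemma cpowX y a n : cpow y (n%:R * a) = cpow y a ^+ n.
Proof. by rewrite /cpow -mulrA mulr_natl cexpMn. Qed.

Lemma cpow_nat y n : y != 0 -> cpow y n%:R = y ^+ n.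
Proof. by move=> y0; rewrite -[n%:R]mulr1 cpowX cpow1. Qed.

Lemma cpow_half_sqr y : y != 0 -> cpow y 2^-1 ^+ 2 = y.
Proof. by move=> y0; rewrite -cpowX divff ?pnatr_eq0 // cpow1. Qed.

Lemma re_cpow_gt0 y (a : R) : cutplane 0 y -> 0 <= a <= 2^-1 -> 0 < re (cpow y a%:C).
Proof.
move=> /carg_cut/andP[h1 h2] /andP[a0 a1]; rewrite /cpow re_cexp mulr_gt0 ?expR_gt0 //.
rewrite imM /= mul0r addr0; apply: cos_gt0_pihalf; apply/andP; split; nra.
Qed.

Lemma cutplane0_sub (r : R) y : 0 <= r -> cutplane r y -> cutplane 0 y.
Proof. by move=> r0 h [i0 h0]; apply: h; split => //; exact: le_trans h0 r0. Qed.

Lemma cutplane1_sub1 z : cutplane 1 z -> cutplane 0 (z - 1).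
Proof. by move=> h [i0 r0]; apply: h; move: i0 r0; case: z => a b /=; rewrite subr0 subr_le0. Qed.

Lemma cutplane1_add1 z : cutplane 1 z -> cutplane 0 (z + 1).
Proof.
move=> h [i0 r0]; apply: h; move: i0 r0; case: z => a b /=; rewrite addr0 => -> r0; split=> //.
lra.
Qed.

Section Joukowski.
Variable z : C.
Hypothesis zcut : cutplane 1 z.

Local Notation s := (cpow_sqr_sub1 z 2^-1).

Lemma sqr_sub1_sqr : s ^+ 2 = z ^+ 2 - 1.
Proof.
rewrite /cpow_sqr_sub1 exprMn !cpow_half_sqr; first by ring.
  exact: cutplane0_neq0 (cutplane1_sub1 zcut).
exact: cutplane0_neq0 (cutplane1_add1 zcut).
Qed.

Lemma sqr_sub1_neq0 : s != 0.
Proof. by rewrite mulf_neq0 ?cpow_neq0. Qed.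

Lemma jouk_mul : (z + s) * (z - s) = 1.
Proof. by rewrite mulrC -subr_sqr sqr_sub1_sqr; ring. Qed.

(** With a and b the square roots of z + 1 and z - 1, w = (a + b)^2 / 2 and |a + b| |a - b| = 2, so
    the claim is |a - b| < |a + b|, that is Re a Re b + Im a Im b > 0. This follows from Re a > 0,
    Re b > 0 and Re a Im a = Re b Im b, as a^2 and b^2 have the same imaginary part. *)
Lemma jouk_out : 1 < nc (z + s).
Proof.
set a := cpow (z + 1) 2^-1; set b := cpow (z - 1) 2^-1.
have halfE : 2^-1 = (2^-1 : R)%:C :> C by rewrite fmorphV rmorph_nat.
have ha := cutplane1_add1 zcut; have hb := cutplane1_sub1 zcut.
have h2 : ((0 : R) <= 2^-1) && ((2^-1 : R) <= 2^-1) by rewrite invr_ge0 ler0n lexx.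
have a0 : 0 < re a by rewrite /a halfE re_cpow_gt0.
have b0 : 0 < re b by rewrite /b halfE re_cpow_gt0.
have a2 : a ^+ 2 = z + 1 by rewrite cpow_half_sqr ?cutplane0_neq0.
have b2 : b ^+ 2 = z - 1 by rewrite cpow_half_sqr ?cutplane0_neq0.
have iab : re a * im a = re b * im b.
  have := congr1 im a2; have := congr1 im b2.
  rewrite !expr2 !imM imD imN /= subr0 imD /= addr0; lra.
have pos : 0 < re a * re b + im a * im b.
  have : 0 < re a * (re a * re b + im a * im b).
    have -> : re a * (re a * re b + im a * im b) = re b * (re a ^+ 2 + im b ^+ 2).
      by rewrite mulrDr [re a * (im a * im b)]mulrA iab; ring.
    by rewrite mulr_gt0 // ltr_wpDr ?sqr_ge0 // exprn_gt0.
  by rewrite pmulr_rgt0.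
have lt_n : nc (a - b) ^+ 2 < nc (a + b) ^+ 2.
  rewrite !sqr_nc !(reD, imD, reN, imN); nra.
have e1 : nc (a + b) * nc (a - b) = 2.
  rewrite -ncM (_ : _ * _ = 2%:R) ?nc_nat //.
  transitivity (a ^+ 2 - b ^+ 2); first by ring.
  by rewrite a2 b2; ring.
have e2 : nc (z + s) = nc (a + b) ^+ 2 / 2.
  apply: (canRL (mulfK _)); first by rewrite pnatr_eq0.
  have <- : nc 2%:R = 2 by rewrite nc_nat.
  rewrite -ncM -ncX; congr nc.
  transitivity (a ^+ 2 + b ^+ 2 + 2 * (a * b)); last by ring.
  by rewrite a2 b2 /cpow_sqr_sub1 -/a -/b; ring.
rewrite e2 ltr_pdivlMr // mul1r -e1 expr2 ltr_pM2l; last first.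
  by rewrite lt_neqAle nc_ge0 andbT; apply: contra_eqN e1 => /eqP <-; rewrite mul0r lt_eqF.
by move: lt_n; rewrite ltr_pXn2r ?nnegrE ?nc_ge0.
Qed.

End Joukowski.

End ComplexLogarithm.

(** * The logarithm series, the ellipse, and the branch [clog_sub] *)

Section LogarithmSeries.
Variable R : realType.
Local Notation C := R[i].
Local Notation re := (@complex.Re R).
Local Notation im := (@complex.Im R).
Local Notation nc := (@Normc.normc R).
Implicit Types (y z x u : C).

Lemma carg_atan y : 0 < re y -> carg y = atan (im y / re y).
Proof.
move=> r0; have y0 := cutplane0_neq0 (cutplane0_re r0).
set q := im y / re y.
have ncE : nc y = re y * Num.sqrt (1 + q ^+ 2).
  apply/eqP; rewrite -(eqrXn2 (n := 2)) ?nc_ge0 ?mulr_ge0 ?(ltW r0) ?sqrtr_ge0 //.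
  rewrite sqr_nc exprMn sqr_sqrtr ?addr_ge0 ?sqr_ge0 // /q; apply/eqP; field.
  by rewrite lt0r_neq0.
have n0 : 0 < nc y by rewrite nc_gt0.
have s0 : Num.sqrt (1 + q ^+ 2) != 0.
  by apply: contraTneq n0 => e; rewrite ncE e mulr0 ltxx.
suff : clog y = (ln (nc y)) +i* atan q by move=> /(congr1 im).
apply: clog_unique.
  have := atan_gtNpi2 q; have := atan_ltpi2 q; have := pi_gt0 R => /= *; lra.
have cE : cos (atan q) = (Num.sqrt (1 + q ^+ 2))^-1 by rewrite cos_atan.
have sE : sin (atan q) = q * (Num.sqrt (1 + q ^+ 2))^-1.
  have := atanK q; rewrite /tan cE => /(canRL (divfK _)) -> //.
  by rewrite invr_eq0.
apply: eqC_reim; rewrite ?re_cexp ?im_cexp /= lnK ?posrE // ncE ?cE ?sE.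
  by rewrite mulfK.
move: s0; move: (Num.sqrt _) => S S0; rewrite /q; field.
by rewrite S0 lt0r_neq0.
Qed.

Lemma mvt01 (F dF : R -> R) (B : R) :
  (forall t : R, 0 <= t <= 1 -> is_derive t 1 F (dF t)) ->
  (forall t : R, 0 <= t <= 1 -> `|dF t| <= B) -> `|F 1 - F 0| <= B.
Proof.
move=> hd hB; have [||c] := @MVT R F dF 0 1 ltr01.
- by move=> t; rewrite in_itv /= => /andP[t0 t1]; apply: hd; rewrite !ltW.
- by apply: derivable_within_continuous => t; rewrite in_itv /= => /hd[].
rewrite in_itv /= => /andP[c0 c1] ->; rewrite subr0 mulr1; apply: hB.
by rewrite !ltW.
Qed.

Lemma reV y : re y^-1 = re y / nc y ^+ 2.
Proof. by rewrite sqr_nc; case: y. Qed.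
Lemma imV y : im y^-1 = - (im y / nc y ^+ 2).
Proof. by rewrite sqr_nc; case: y. Qed.

Lemma re_sum (I : Type) (r : seq I) (F : I -> C) :
  re (\sum_(i <- r) F i) = \sum_(i <- r) re (F i).
Proof. by apply: big_morph => //; exact: reD. Qed.
Lemma im_sum (I : Type) (r : seq I) (F : I -> C) :
  im (\sum_(i <- r) F i) = \sum_(i <- r) im (F i).
Proof. by apply: big_morph => //; exact: imD. Qed.

Let is_derive_psum (p : nat -> R) N (t : R) :
  is_derive t 1 (fun t : R => \sum_(0 <= n < N) p n / n.+1%:R * t ^+ n.+1)
    (\sum_(0 <= n < N) p n * t ^+ n).
Proof.
elim: N => [|N IH].
  rewrite big_nil (_ : (fun _ => _) = cst 0); first exact: is_derive_cst.
  by apply/funext => r; rewrite big_nil.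
rewrite (_ : (fun _ => _) = (fun t : R => \sum_(0 <= n < N) p n / n.+1%:R * t ^+ n.+1)
   \+ (fun t : R => p N / N.+1%:R * t ^+ N.+1)); last first.
  by apply/funext => r; rewrite big_nat_recr.
rewrite big_nat_recr //=; apply: is_deriveD.
have dX := @is_deriveX _ _ id N.+1 t 1 1 (is_derive_id t 1).
have := @is_deriveZ _ _ _ _ (p N / N.+1%:R) t 1 _ dX.
have -> : (p N / N.+1%:R) \*: id ^+ N.+1 = (fun t0 : R => p N / N.+1%:R * t0 ^+ N.+1).
  by apply/funext => r; rewrite /= exprfctE.
suff -> : (p N / N.+1%:R) *: (N.+1%:R * id t ^+ N.+1.-1)%:A = p N * t ^+ N by [].
rewrite /GRing.scale /= mulr1; field; by rewrite nat1r pnatr_eq0.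
Qed.

Lemma re_1sub_gt0 y : nc y < 1 -> 0 < re (1 - y).
Proof.
move=> h; rewrite reD reN /= subr_gt0; apply: le_lt_trans h.
exact: le_trans (ler_norm _) (re_le_nc _).
Qed.

Section Remainder.
Variables (y : C) (N : nat).
Hypothesis y1 : nc y < 1.

Let ty1 (t : R) : 0 <= t <= 1 -> nc (t%:C * y) < 1.
Proof.
move=> /andP[t0 t1]; rewrite ncM nc_real ger0_norm //.
by apply: le_lt_trans y1; rewrite ler_piMl // nc_ge0.
Qed.

(** The derivative in t of log (1 - t y) plus the sum of (t y)^(n+1) / (n + 1) over n < N. The real
    mean value theorem on [0, 1] is applied to the real part, half the logarithm of |1 - t y|^2, and
    to the imaginary part, an arctangent. *)
Let rem (t : R) : C := - y * (t%:C * y) ^+ N / (1 - t%:C * y).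

Let remE (t : R) : 0 <= t <= 1 ->
  rem t = - y / (1 - t%:C * y) + \sum_(0 <= n < N) y ^+ n.+1 * (t ^+ n)%:C.
Proof.
move=> /ty1 h; have d0 : 1 - t%:C * y != 0 by exact: cutplane0_neq0 (cutplane0_re (re_1sub_gt0 h)).
rewrite /rem; elim: (N) => [|M IH]; first by rewrite big_nil expr0 mulr1 addr0.
rewrite big_nat_recr //= addrA -IH rmorphXn /= exprS exprS exprMn; field; exact: d0.
Qed.

Let rem_le (t : R) : 0 <= t <= 1 -> nc (rem t) <= nc y ^+ N / (1 - nc y).
Proof.
move=> ht; have h := ty1 ht; rewrite /rem !ncM ncN ncX ncV.
have d0 : 0 < 1 - nc y by rewrite subr_gt0.
have le1 : nc (t%:C * y) <= nc y.
  case/andP: ht => t0 t1; rewrite ncM nc_real ger0_norm //.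
  by rewrite ler_piMl // nc_ge0.
apply: ler_pM; rewrite ?mulr_ge0 ?exprn_ge0 ?invr_ge0 ?nc_ge0 //.
  rewrite -[leRHS]mul1r ler_pM ?nc_ge0 ?exprn_ge0 ?nc_ge0 ?(ltW y1) //.
  by rewrite lerXn2r ?nnegrE ?nc_ge0.
rewrite lef_pV2 ?posrE //; last first.
  by rewrite nc_gt0 (cutplane0_neq0 (cutplane0_re (re_1sub_gt0 h))).
apply: (@le_trans _ _ (1 - nc (t%:C * y))); first by rewrite lerD2l lerN2.
by rewrite lerBlDr; have := ncD (1 - t%:C * y) (t%:C * y); rewrite subrK nc1.
Qed.

Let Q (t : R) : R := (1 - t * re y) ^+ 2 + (t * im y) ^+ 2.

Let ncQ (t : R) : nc (1 - t%:C * y) ^+ 2 = Q t.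
Proof.
by rewrite sqr_nc !(reD, imD, reN, imN, reM, imM) /= /Q; ring.
Qed.

Let clog_rem_re : `|re (clog (1 - y) + \sum_(0 <= n < N) y ^+ n.+1 / n.+1%:R)|
   <= nc y ^+ N / (1 - nc y).
Proof.
pose F t := ln (Q t) / 2 + \sum_(0 <= n < N) re (y ^+ n.+1) / n.+1%:R * t ^+ n.+1.
have -> : re (clog (1 - y) + \sum_(0 <= n < N) y ^+ n.+1 / n.+1%:R) = F 1 - F 0.
  have -> : F 0 = 0.
    rewrite /F /Q !mul0r subr0 expr1n expr0n addr0 ln1 mul0r add0r.
    by rewrite big1 // => i _; rewrite expr0n mulr0.
  rewrite /F subr0 -ncQ mul1r lnXn ?nc_gt0 ?(cutplane0_neq0 (cutplane0_re (re_1sub_gt0 y1))) //.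
  have -> : forall a : R, a *+ 2 / 2 = a by move=> a; field.
  rewrite reD re_sum -[re (clog _)]/(ln (nc (1 - y))).
  congr (_ + _); apply: eq_bigr => n _; rewrite expr1n mulr1.
  have -> : n.+1%:R^-1 = (n.+1%:R^-1 : R)%:C :> C by rewrite fmorphV rmorph_nat.
  by rewrite reM /= mulr0 subr0.
apply: (@mvt01 F (fun t => re (rem t))) => t ht; last first.
  exact: le_trans (re_le_nc _) (rem_le ht).
have h := ty1 ht; have q0 : 0 < Q t.
  by rewrite -ncQ exprn_gt0 // nc_gt0 (cutplane0_neq0 (cutplane0_re (re_1sub_gt0 h))).
rewrite remE // reD re_sum.
have -> : \sum_(0 <= n < N) re (y ^+ n.+1 * (t ^+ n)%:C) = \sum_(0 <= n < N) re (y ^+ n.+1) * t ^+ n.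
  by apply: eq_bigr => n _; rewrite reM /= mulr0 subr0.
apply: is_deriveD; last exact: is_derive_psum.
have dQ : is_derive t 1 Q (- 2 * re y * (1 - t * re y) + 2 * im y * (t * im y)).
  rewrite /Q; apply: is_derive_eq; rewrite /GRing.scale /=; ring.
have dL := is_derive1_comp (is_derive1_ln q0) dQ.
have -> : (fun t => ln (Q t) / 2) = (2^-1 : R) \*: ((@ln R) \o Q).
  by apply/funext => r /=; rewrite mulrC.
apply: is_derive_eq; rewrite /GRing.scale /= reM reV imV ncQ !(reD, imD, reN, imN, reM, imM) /=.
by field; rewrite lt0r_neq0.
Qed.

Let clog_rem_im : `|im (clog (1 - y) + \sum_(0 <= n < N) y ^+ n.+1 / n.+1%:R)|
   <= nc y ^+ N / (1 - nc y).
Proof.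
pose g (t : R) : R := (- (t * im y)) / (1 - t * re y).
pose F t := atan (g t) + \sum_(0 <= n < N) im (y ^+ n.+1) / n.+1%:R * t ^+ n.+1.
have -> : im (clog (1 - y) + \sum_(0 <= n < N) y ^+ n.+1 / n.+1%:R) = F 1 - F 0.
  have -> : F 0 = 0.
    rewrite /F /g !mul0r oppr0 mul0r atan0 add0r.
    by rewrite big1 // => i _; rewrite expr0n mulr0.
  rewrite /F /g subr0.
  rewrite imD im_sum -[im (clog _)]/(carg (1 - y)) carg_atan ?re_1sub_gt0 //.
  rewrite !(reD, imD, reN, imN) /= !mul1r add0r; congr (_ + _).
  apply: eq_bigr => n _; rewrite expr1n mulr1.
  have -> : n.+1%:R^-1 = (n.+1%:R^-1 : R)%:C :> C by rewrite fmorphV rmorph_nat.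
  by rewrite imM /= mulr0 add0r.
apply: (@mvt01 F (fun t => im (rem t))) => t ht; last first.
  exact: le_trans (im_le_nc _) (rem_le ht).
have h := ty1 ht; have q0 : 0 < Q t.
  by rewrite -ncQ exprn_gt0 // nc_gt0 (cutplane0_neq0 (cutplane0_re (re_1sub_gt0 h))).
have u0 : 1 - t * re y != 0.
  by have := re_1sub_gt0 h; rewrite reD reN reM /= mul0r subr0 => /lt0r_neq0.
rewrite remE // imD im_sum.
have -> : \sum_(0 <= n < N) im (y ^+ n.+1 * (t ^+ n)%:C) = \sum_(0 <= n < N) im (y ^+ n.+1) * t ^+ n.
  by apply: eq_bigr => n _; rewrite imM /= mulr0 add0r.
apply: is_deriveD; last exact: is_derive_psum.
have dV : is_derive t 1 (fun t : R => (1 - t * re y)^-1) (re y / (1 - t * re y) ^+ 2).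
  have d1 : is_derive t 1 (fun t : R => 1 - t * re y) (- re y).
    by apply: is_derive_eq; rewrite /GRing.scale /=; ring.
  have := @is_deriveV R (fun t : R => 1 - t * re y) t (- re y) 1 u0 d1.
  suff -> : - (1 - t * re y) ^- 2 *: - re y = re y / (1 - t * re y) ^+ 2 by [].
  by rewrite /GRing.scale /=; field.
have dg : is_derive t 1 g (- im y * (1 - t * re y)^-1 + - (t * im y) * (re y / (1 - t * re y) ^+ 2)).
  by apply: is_derive_eq; rewrite /GRing.scale /=; ring.
have dL := is_derive1_comp (is_derive1_atan (g t)) dg.
apply: is_derive_eq; rewrite imM reV imV ncQ !(reD, imD, reN, imN, reM, imM) /= /g.
rewrite /Q in q0 *; by field; rewrite u0 /= lt0r_neq0.
Qed.

Lemma clog_remainder :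
  nc (\sum_(0 <= n < N) y ^+ n.+1 / n.+1%:R - (- clog (1 - y))) <= 2 / (1 - nc y) * nc y ^+ N.
Proof.
rewrite opprK addrC; apply: le_trans (nc_le_reim _) _.
have -> : 2 / (1 - nc y) * nc y ^+ N = nc y ^+ N / (1 - nc y) + nc y ^+ N / (1 - nc y) by ring.
exact: lerD clog_rem_re clog_rem_im.
Qed.

End Remainder.

Lemma clog_series y : nc y < 1 ->
  series (fun n => y ^+ n.+1 / n.+1%:R) @ \oo --> - clog (1 - y).
Proof.
move=> y1; apply: (@squeezeC _ _ _ (fun N => 2 / (1 - nc y) * nc y ^+ N)).
  by move=> N; exact: clog_remainder.
rewrite -(mulr0 (2 / (1 - nc y))); apply: cvgMr; apply: cvgX_lt1.
by rewrite nc_ge0.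
Qed.

(** As x - 1 = (u - 1)^2 / (2 u) and x + 1 = (u + 1)^2 / (2 u), this is the parallelogram law. *)
Lemma nc_jouk u : u != 0 ->
  nc ((u + u^-1) / 2 - 1) + nc ((u + u^-1) / 2 + 1) = nc u + (nc u)^-1.
Proof.
move=> u0; have n0 : nc u != 0 by rewrite nc_eq0.
have c2 : nc 2%:R = 2 by rewrite nc_nat.
have -> : (u + u^-1) / 2 - 1 = (u - 1) ^+ 2 / (2 * u) by field.
have -> : (u + u^-1) / 2 + 1 = (u + 1) ^+ 2 / (2 * u) by field.
rewrite !ncM !ncV !ncM -!expr2 !c2 -mulrDl !sqr_nc !(reD, imD, reN, imN) /= subr0 addr0.
have -> : (re u - 1) ^+ 2 + im u ^+ 2 + ((re u + 1) ^+ 2 + im u ^+ 2) = 2 * (nc u ^+ 2 + 1).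
  by rewrite sqr_nc; ring.
by field.
Qed.

(** (q + 1/q) - (w + 1/w) = (q - w) (1 - 1 / (q w)) is nonnegative when 1 < w <= q; this is used for
    q = r and for q = 1/r. *)
Lemma add_inv_lt (r w : R) : 0 < r -> 1 < w -> r + r^-1 < w + w^-1 -> r < w /\ r^-1 < w.
Proof.
move=> r0 w1 h; have w0 : 0 < w by lra.
have key (q : R) : 0 < q -> q + q^-1 < w + w^-1 -> q < w.
  move=> q0 hq; rewrite ltNge; apply/negP => wq.
  have : 0 <= (q - w) * (1 - (q * w)^-1).
    rewrite mulr_ge0 ?subr_ge0 // invf_le1 ?mulr_gt0 //; nra.
  have -> : (q - w) * (1 - (q * w)^-1) = (q + q^-1) - (w + w^-1).
    by field; rewrite !lt0r_neq0.
  lra.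
by split; apply: key; rewrite ?invr_gt0 // ?invrK // addrC.
Qed.

(** Either square root of x^2 - 1 will do: the other one exchanges u and 1/u, in which the
    conclusion is symmetric. *)
Lemma jouk_param x (w : R) : 1 < w -> nc (x - 1) + nc (x + 1) < w + w^-1 ->
  exists u, [/\ u != 0, x = (u + u^-1) / 2, nc u < w & nc u^-1 < w].
Proof.
move=> w1 h; pose sq := sqrtc (x ^+ 2 - 1); pose u := x + sq.
have uv : u * (x - sq) = 1.
  by rewrite mulrC -subr_sqr sqr_sqrtc; ring.
have u0 : u != 0 by apply/eqP => e; move: uv; rewrite e mul0r => /eqP; rewrite eq_sym oner_eq0.
have uV : u^-1 = x - sq by apply: (mulfI u0); rewrite uv divff.
have xE : x = (u + u^-1) / 2 by rewrite uV /u; field.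
exists u; move: h; rewrite {1 2}xE nc_jouk // => h.
have [] := add_inv_lt _ w1 h; first by rewrite nc_gt0.
by rewrite -ncV.
Qed.

Section Branch.
Variables z x : C.
Hypotheses (zcut : cutplane 1 z) (x_ell : nc (x - 1) + nc (x + 1) < nc (z - 1) + nc (z + 1)).

Local Notation s := (cpow_sqr_sub1 z 2^-1).
Local Notation w := (z + s).
Local Notation t := (z - s).

Let w1 : 1 < nc w. Proof. exact: jouk_out. Qed.
Let w0 : w != 0. Proof. by rewrite -nc_gt0; apply: lt_trans w1. Qed.
Let tE : t = w^-1. Proof. by apply: (mulfI w0); rewrite jouk_mul // divff. Qed.
Let zE : z = (w + w^-1) / 2. Proof. by rewrite -tE; field. Qed.

Lemma nc_jouk_z : nc (z - 1) + nc (z + 1) = nc w + (nc w)^-1.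
Proof. by rewrite {1 2}zE nc_jouk. Qed.

Lemma cutplane1_neq0 : z != 0.
Proof. by apply: (cutplane0_neq0 (cutplane0_sub ler01 zcut)). Qed.

Let nct : nc t < 1.
Proof. by rewrite tE ncV invf_lt1 // (lt_trans ltr01). Qed.

Lemma ell_param : exists u, [/\ u != 0, x = (u + u^-1) / 2, nc u < nc w & nc u^-1 < nc w].
Proof. by apply: jouk_param => //; rewrite -nc_jouk_z. Qed.

Let nc_ge2 y : 2 <= nc (y - 1) + nc (y + 1).
Proof.
have := ncB (y + 1) (y - 1); rewrite (_ : y + 1 - (y - 1) = 2%:R); last by ring.
by rewrite nc_nat addrC.
Qed.

(** The sum of the focal distances is convex, equals 2 at the origin and is nowhere less. So the
    ellipse is star-shaped about 0, which keeps the segments followed below inside it. *)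
Lemma ell_scale (r : R) y : 0 <= r <= 1 ->
  nc (r%:C * y - 1) + nc (r%:C * y + 1) <= nc (y - 1) + nc (y + 1).
Proof.
move=> /andP[r0 r1].
have nr : nc (1 - r%:C) = 1 - r.
  have -> : 1 - r%:C = (1 - r)%:C by rewrite rmorphB.
  by rewrite nc_real ger0_norm // subr_ge0.
have nr' : nc r%:C = r by rewrite nc_real ger0_norm.
have h1 : nc (r%:C * y - 1) <= r * nc (y - 1) + (1 - r).
  have -> : r%:C * y - 1 = r%:C * (y - 1) - (1 - r%:C) by ring.
  by apply: le_trans (ncB _ _) _; rewrite ncM nr' nr.
have h2 : nc (r%:C * y + 1) <= r * nc (y + 1) + (1 - r).
  have -> : r%:C * y + 1 = r%:C * (y + 1) + (1 - r%:C) by ring.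
  by apply: le_trans (ncD _ _) _; rewrite ncM nr' nr.
by have := nc_ge2 y; nra.
Qed.

Lemma nc_mult_lt1 u : nc u < nc w -> nc (u * t) < 1.
Proof.
move=> h; rewrite tE ncM ncV ltr_pdivrMr ?mul1r //.
exact: lt_trans w1.
Qed.

(** If x / z were real and at least 1, then z = r x with 0 < r <= 1, and by [ell_scale] the focal
    sum of z could not exceed that of x. *)
Let cut_ratio : cutplane 0 (1 - x / z).
Proof.
move=> [i0 r0]; have z0 := cutplane1_neq0.
have [rho rhoE] : exists rho : R, x / z = rho%:C.
  exists (re (x / z)); apply: eqC_reim => //=.
  by move: i0; rewrite imD imN /= add0r => /eqP; rewrite oppr_eq0 => /eqP.
have rho1 : 1 <= rho by move: r0; rewrite reD reN rhoE /= subr_le0.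
have rho0 : rho != 0 by rewrite lt0r_neq0 // (lt_le_trans ltr01).
have zx : z = (rho^-1)%:C * x.
  by rewrite -(divfK z0 x) rhoE mulrA -rmorphM /= mulVf // mul1r.
have r01 : 0 <= rho^-1 <= 1.
  by rewrite invr_ge0 (le_trans ler01) // invf_le1 // (lt_le_trans ltr01).
by have := ell_scale x r01; rewrite -zx leNgt x_ell.
Qed.

(** Since z = (w / 2) (1 + t^2), the segment consists of the points (w + r / w) / 2. As |w| > 1,
    their real and imaginary parts are positive multiples of those of w, so that a point on the cut
    would force w, hence z, to be real and nonpositive. *)
Let clog_z : clog z = clog (w / 2) + clog (1 + t ^+ 2).
Proof.
have t2 : cutplane 0 (1 + t ^+ 2).
  apply: cutplane0_re; rewrite -[t ^+ 2]opprK re_1sub_gt0 // ncN ncX.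
  by rewrite exprn_ilt1 ?nc_ge0.
have E r : w / 2 * (1 - r%:C + r%:C * (1 + t ^+ 2)) = (w + r%:C * t) / 2.
  by rewrite tE; field.
have wz : w / 2 * (1 + t ^+ 2) = z.
  by have := E 1; rewrite subrr add0r mul1r => ->; rewrite mul1r; field.
rewrite -[in LHS]wz clogM_segment // => r /andP[r0 r1]; rewrite E => -[i0 re0].
have nw : 1 < nc w ^+ 2 by rewrite exprn_egt1.
have c2V : (2 : C)^-1 = (2^-1 : R)%:C by rewrite fmorphV rmorph_nat.
have nN : nc w ^+ 2 != 0 by rewrite lt0r_neq0 // (lt_trans ltr01).
have rn : r / nc w ^+ 2 < 1.
  by rewrite ltr_pdivrMr ?mul1r ?(lt_trans ltr01 nw) // (le_lt_trans r1).
have rn0 : 0 <= r / nc w ^+ 2 by rewrite divr_ge0 // exprn_ge0 // nc_ge0.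
have iw : im w = 0.
  have : im w * (1 - r / nc w ^+ 2) = 0.
    transitivity (2 * im ((w + r%:C * t) / 2)); last by rewrite i0 mulr0.
    by rewrite tE; move: nN; move: (w) => W nN; rewrite c2V imM imD imM imV reV /=;
      move: nN; move: (nc W ^+ 2) => N nN; field.
  move=> /eqP; rewrite mulf_eq0 => /orP[/eqP //|]; rewrite subr_eq0 => /eqP e.
  by move: rn; rewrite -e ltxx.
have rw : re w <= 0.
  have : re w * (1 + r / nc w ^+ 2) <= 0.
    have -> : re w * (1 + r / nc w ^+ 2) = 2 * re ((w + r%:C * t) / 2).
      by rewrite tE; move: nN; move: (w) => W nN; rewrite c2V reM reD reM imV reV /=;
        move: nN; move: (nc W ^+ 2) => N nN; field.
    by rewrite pmulr_rle0.
  by rewrite pmulr_lle0 // ltr_wpDr.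
apply: zcut; rewrite {1 2}zE; move: iw rw; move: (w) => W iw rw.
rewrite c2V imM reM imD reD imV reV /= iw.
split; first by rewrite mul0r oppr0 addr0 mul0r mulr0 addr0.
apply: (@le_trans _ _ 0) => //; rewrite mulr0 subr0 pmulr_lle0 ?invr_gt0 //.
have : re W / nc W ^+ 2 <= 0 by rewrite mulr_le0_ge0 // invr_ge0 exprn_ge0 // nc_ge0.
lra.
Qed.

(** From 1 + t^2 = 2 z t, (1 + t^2) (1 - r x / z) = (1 - v t) (1 - t / v) where v parametrizes the
    scaled point r x. Both factors have positive real part, so the segment over r in [0, 1] avoids
    the cut and no multiple of 2 i pi arises. *)
Lemma clog_sub_jouk u : u != 0 -> x = (u + u^-1) / 2 -> nc u < nc w -> nc u^-1 < nc w ->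
  clog_sub z x = clog (w / 2) + (clog (1 - u * t) + clog (1 - u^-1 * t)).
Proof.
move=> u0 xE hu hv; rewrite /clog_sub clog_z -addrA; congr (_ + _).
have z0 := cutplane1_neq0.
have t2z : 1 + t ^+ 2 = 2 * z * t.
  have z2 : 2 * z = w + t by ring.
  by rewrite z2 mulrDl jouk_mul // -expr2.
have re1 v : nc v < nc w -> 0 < re (1 - v * t) by move=> hv'; rewrite re_1sub_gt0 // nc_mult_lt1.
rewrite -clogM_re ?re1 //.
have E (r : R) (v : C) : v != 0 -> r%:C * x = (v + v^-1) / 2 ->
    (1 + t ^+ 2) * (1 - r%:C + r%:C * (1 - x / z)) = (1 - v * t) * (1 - v^-1 * t).
  move=> v0 rx; transitivity (1 + t ^+ 2 - 2 * t * (r%:C * x)).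
    by rewrite t2z; field.
  by rewrite rx; field.
have E1 := E 1 u u0; rewrite subrr add0r !mul1r in E1.
rewrite -E1 // clogM_segment // => r r01.
have [v [v0 rx hv1 hv2]] : exists v, [/\ v != 0, r%:C * x = (v + v^-1) / 2, nc v < nc w & nc v^-1 < nc w].
  apply: jouk_param => //; rewrite -nc_jouk_z; apply: le_lt_trans x_ell; exact: ell_scale.
by rewrite (E r v) //; apply: cutplane0M_re; exact: re1.
Qed.

Lemma clog_sub_principal :
  (forall r : R, 0 <= r <= 1 -> cutplane 0 (z - r%:C * x)) -> clog_sub z x = clog (z - x).
Proof.
move=> h; have z0 := cutplane1_neq0; rewrite /clog_sub -clogM_segment.
- by congr clog; field.
- exact: cut_ratio.
- by move=> r r01; have := h r r01; congr cutplane; field.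
Qed.

End Branch.

End LogarithmSeries.

(** * Summation of the series in 1/z of the Legendre functions *)

Section LegendreSeries.
Variable R : realType.
Local Notation C := R[i].
Local Notation nc := (@Normc.normc R).

Lemma contract_cvg0 (q : R) (a e : nat -> R) : 0 <= q < 1 -> (forall n, 0 <= a n) ->
  (forall n, a n.+1 <= q * a n + e n) -> e @ \oo --> (0 : R) -> a @ \oo --> (0 : R).
Proof.
move=> /andP[q0 q1] a0 ha /cvgrPdist_lt he; apply/cvgrPdist_lt => d d0.
have d1 : 0 < d / 2 * (1 - q) by rewrite mulr_gt0 ?divr_gt0 // subr_gt0.
have [N _ hN] := he _ d1.
have step n : a (N + n)%N <= q ^+ n * a N + d / 2.
  elim: n => [|n IH]; first by rewrite addn0 expr0 mul1r lerDl ltW // divr_gt0.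
  rewrite addnS; apply: le_trans (ha _) _.
  have /= := hN (N + n)%N (leq_addr _ _); rewrite sub0r normrN => /ltW hn.
  have {}hn := le_trans (ler_norm _) hn.
  apply: le_trans (lerD (ler_wpM2l q0 IH) hn) _.
  by rewrite exprS le_eqVlt; apply/orP; left; apply/eqP; ring.
have /cvgrPdist_lt qc : (fun n => q ^+ n * a N) @ \oo --> (0 : R).
  by rewrite -(mul0r (a N)); apply: cvgMl; apply: cvgX_lt1; rewrite q0.
have d2 : 0 < d / 2 by rewrite divr_gt0.
have [M _ hM] := qc _ d2.
exists (N + M)%N => // n /= nNM.
have nE : (N + (n - N) = n)%N by rewrite subnKC // (leq_trans (leq_addr _ _) nNM).
rewrite sub0r normrN ger0_norm // -nE; apply: le_lt_trans (step _) _.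
have /= := hM (n - N)%N; rewrite leq_subRL ?(leq_trans (leq_addr _ _) nNM) // => /(_ nNM).
rewrite sub0r normrN => h; have := le_lt_trans (ler_norm _) h; lra.
Qed.

(** Partial sums linked by z^2 P_(N+1) - P_N = B_N satisfy such a recurrence with q = z^(-2); their
    convergence is thereby obtained along with the limit. *)
Lemma affine_rec_cvg (q : C) (P B : nat -> C) (b : C) : nc q < 1 ->
  (forall n, P n.+1 = q * P n + B n) -> B @ \oo --> b -> P @ \oo --> b / (1 - q).
Proof.
move=> q1 hP hB; set L := b / (1 - q).
have q1' : 1 - q != 0 by exact: cutplane0_neq0 (cutplane0_re (re_1sub_gt0 q1)).
have LE : b = L - q * L by rewrite /L; field.
apply/cvgC_nc; apply: (@contract_cvg0 (nc q) _ (fun n => nc (B n - b))).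
- by rewrite nc_ge0.
- by move=> n; exact: nc_ge0.
- move=> n; rewrite hP -ncM; have -> : q * P n + B n - L = q * (P n - L) + (B n - b).
    by rewrite {1}LE; ring.
  exact: ncD.
- by apply/cvgC_nc.
Qed.

Lemma cvgC_cst_le0 (a : C) (v : nat -> R) :
  (forall n, nc a <= v n) -> v @ \oo --> (0 : R) -> a = 0.
Proof.
move=> h v0; apply: (@cvgC_unique _ (fun=> a)); first exact: cvg_cst.
by apply: (squeezeC _ v0) => n; rewrite subr0.
Qed.

Lemma cvgC_S (u : nat -> C) (l : C) : u @ \oo --> l -> (fun n => u n.+1) @ \oo --> l.
Proof. by move/(cvgC_shift u l 1).2; under eq_fun do rewrite addn1. Qed.

Lemma bin_le_exp2 n m : ('C(n, m) <= 2 ^ n)%N.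
Proof.
elim: n m => [|n IH] [|m]; rewrite ?bin0 ?bin0n ?expn_gt0 //.
by rewrite binS expnS mul2n -addnn leq_add.
Qed.

Variable z : C.
Hypotheses (zcut : cutplane 1 z) (z1 : 1 < nc z).

Local Notation s := (cpow_sqr_sub1 z 2^-1).
Local Notation w := (z + s).
Local Notation t := (z - s).
Local Notation y := (z^-1).

Let z0 : z != 0. Proof. exact: cutplane1_neq0. Qed.
Let c2 : (2 : C) != 0. Proof. by rewrite pnatr_eq0. Qed.
Let s0 : s != 0. Proof. exact: sqr_sub1_neq0. Qed.
Let wt : w * t = 1. Proof. exact: jouk_mul. Qed.
Let w0 : w != 0. Proof. by apply/eqP => e; move: wt; rewrite e mul0r => /eqP; rewrite eq_sym oner_eq0. Qed.
Let tE : t = w^-1. Proof. by apply: (mulfI w0); rewrite wt divff. Qed.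
Let t0 : t != 0. Proof. by rewrite tE invr_eq0. Qed.
Let ss : s ^+ 2 = z ^+ 2 - 1. Proof. exact: sqr_sub1_sqr. Qed.
Let nct : nc t < 1.
Proof. by rewrite tE ncV invf_lt1 ?jouk_out // (lt_trans ltr01) ?jouk_out. Qed.
Let y1 : nc y < 1. Proof. by rewrite ncV invf_lt1 // (lt_trans ltr01). Qed.
Let y2 : nc (y ^+ 2) < 1. Proof. by rewrite ncX exprn_ilt1 ?nc_ge0. Qed.

(** The hypergeometric series of Q_(m-1/2)^(k+1/2), with (m + k)! / (2^m m! z^(m+k+1)) taken into
    the terms and the two numerator Pochhammer symbols merged by duplication. *)
Definition legterm (m k j : nat) : C :=
  (m + k + j.*2)`!%:R / (2 ^+ (m + j.*2) * j`!%:R * (m + j)`!%:R) * y ^+ (m + k + 1 + j.*2).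

Let T m k := series (legterm m k).

Let legterm0 m j : legterm m 0 j = 'C(m + j.*2, j)%:R / 2 ^+ (m + j.*2) * y ^+ (m + j.*2).+1.
Proof.
rewrite /legterm addn0 addn1 addSn; congr (_ * _).
have jm : (j <= m + j.*2)%N by rewrite -addnn addnA leq_addl.
have jE : (m + j.*2 - j = m + j)%N by rewrite -addnn addnA addnK.
by rewrite -(bin_fact jm) jE !natrM; field; rewrite !factC_neq0 expf_neq0.
Qed.

Let legterm0_le m j : nc (legterm m 0 j) <= 1 * nc (y ^+ 2) ^+ j.
Proof.
rewrite legterm0 ncM [X in X * _]ncM ncV !ncX -exprM mul2n nc_nat.
have -> : nc 2 = 2 by rewrite (nc_nat R 2).
apply: ler_pM; rewrite ?mulr_ge0 ?invr_ge0 ?exprn_ge0 ?nc_ge0 //.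
  by rewrite ler_pdivrMr ?exprn_gt0 // mul1r -natrX ler_nat bin_le_exp2.
by rewrite -addSn exprD ler_piMl ?exprn_ge0 ?nc_ge0 // exprn_ile1 ?nc_ge0 // ltW.
Qed.

Let T0_cvg : exists E : nat -> C, exists M : R, forall m,
  T m 0 @ \oo --> E m /\ nc (E m) <= M.
Proof.
have q01 : 0 <= nc (y ^+ 2) < 1 by rewrite nc_ge0 y2.
have [E hE] := choice (fun m => series_geom_cvg q01 (legterm0_le m)).
exists E, (1 / (1 - nc (y ^+ 2))) => m; split; first exact: hE.
exact: (series_geom_le q01 (legterm0_le m) (hE m)).
Qed.

Let TS m k N : T m k N.+1 = legterm m k 0 + \sum_(0 <= j < N) legterm m k j.+1.
Proof. by rewrite /T /series /= big_nat_recl. Qed.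

Let TE m k N : T m k N = \sum_(0 <= j < N) legterm m k j.
Proof. by []. Qed.

Let zy n : z * y ^+ n.+1 = y ^+ n.
Proof. by rewrite exprS mulrA divff ?mul1r. Qed.

(** Pascal's rule for C(m + 2 j + 3, j + 1); its second part is the term j, not j + 1, of the row m
    + 2, whose partial sum therefore stops one term earlier. *)
Let T0_rec m N : 2 * z * T m.+1 0 N.+1 = T m 0 N.+1 + T m.+2 0 N.
Proof.
rewrite !TS !TE mulrDr -addrA mulr_sumr -big_split /=.
congr (_ + _).
  rewrite !legterm0 !addn0 !bin0.
  transitivity (2 * (1 / 2 ^+ m.+1) * (z * y ^+ m.+2)); first by ring.
  by rewrite zy exprS; field; rewrite expf_neq0.
apply: eq_bigr => j _; rewrite !legterm0.
have -> : (m.+1 + j.+1.*2 = (m + j.+1.*2).+1)%N by rewrite addSn.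
have -> : (m.+2 + j.*2 = m + j.+1.*2)%N by rewrite doubleS !addnS !addSn.
rewrite binS natrD -(zy (m + j.+1.*2).+1) exprS [y ^+ _.+2]exprS.
by field; rewrite z0 expf_neq0.
Qed.

Let T00_rec N : z * T 0 0 N.+1 = 1 + T 1 0 N.
Proof.
rewrite TS TE mulrDr mulr_sumr; congr (_ + _).
  by rewrite legterm0 double0 addn0 bin0 expr0 divr1 mul1r zy expr0.
apply: eq_bigr => j _; rewrite !legterm0 !add0n mulrCA zy.
have -> : (1 + j.*2).+1 = j.+1.*2 by rewrite doubleS.
rewrite add1n doubleS; have -> : 'C(j.*2.+2, j.+1) = (2 * 'C(j.*2.+1, j))%N.
  rewrite binS -bin_sub; last by rewrite -addnn ltnS leq_addr.
  by rewrite subSS -{2}addnn addnK mul2n addnn.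
by rewrite natrM exprS; field; rewrite expf_neq0.
Qed.

(** The limits satisfy E_m + E_(m+2) = 2 z E_(m+1), with characteristic roots t and w = 1 / t. They
    are bounded in m while |w| > 1, so the component along w vanishes and E_m = t^m E_0. Finally z
    E_0 = 1 + E_1 gives E_0 = 1 / (z - t) = 1 / s. *)
Let T0_lim m : T m 0 @ \oo --> t ^+ m / s.
Proof.
have [E [M hE]] := T0_cvg.
have sh m' : (fun N => T m' 0 N.+1) @ \oo --> E m'.
  exact: (cvgC_S (hE m').1).
have rec n : 2 * z * E n.+1 = E n + E n.+2.
  apply: (@cvgC_unique _ (fun N => 2 * z * T n.+1 0 N.+1)); first by apply: cvgMr; exact: sh.
  rewrite (_ : (fun _ => _) = fun N => T n 0 N.+1 + T n.+2 0 N); last by apply/funext => N; exact: T0_rec.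
  by apply: cvgD; [exact: sh | exact: (hE _).1].
have rec0 : z * E 0%N = 1 + E 1%N.
  apply: (@cvgC_unique _ (fun N => z * T 0 0 N.+1)); first by apply: cvgMr; exact: sh.
  rewrite (_ : (fun _ => _) = fun N => 1 + T 1 0 N); last by apply/funext => N; exact: T00_rec.
  by apply: cvgD; [exact: cvg_cst | exact: (hE _).1].
pose D n := E n.+1 - t * E n.
have Drec n : D n = w ^+ n * D 0%N.
  elim: n => [|n IH]; first by rewrite expr0 mul1r.
  rewrite exprS -mulrA -IH /D; apply/eqP; rewrite -subr_eq0; apply/eqP.
  transitivity (E n + E n.+2 - 2 * z * E n.+1 + (w * t - 1) * E n); first by ring.
  by rewrite rec subrr wt subrr mul0r addr0.
have D0 : D 0%N = 0.
  apply: (@cvgC_cst_le0 _ (fun n => (2 * M) * nc t ^+ n)) => [n|]; last first.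
    by rewrite -(mulr0 (2 * M)); apply: cvgMr; apply: cvgX_lt1; rewrite nc_ge0.
  have -> : D 0%N = D n * t ^+ n.
    by rewrite [D n]Drec mulrAC -exprMn wt expr1n mul1r.
  rewrite ncM ncX ler_wpM2r ?exprn_ge0 ?nc_ge0 //; apply: le_trans (ncB _ _) _.
  rewrite ncM mulrDl mul1r lerD ?(hE _).2 // -[leRHS]mul1r ler_pM ?nc_ge0 ?(hE _).2 //.
  exact: ltW.
have EE n : E n = t ^+ n * E 0%N.
  elim: n => [|n IH]; first by rewrite expr0 mul1r.
  have := Drec n; rewrite D0 mulr0 /D => /eqP; rewrite subr_eq0 => /eqP ->.
  by rewrite IH mulrA -exprS.
have E0 : E 0%N = s^-1.
  apply: (mulfI s0); rewrite divff //; move: rec0; rewrite (EE 1%N) expr1 => e.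
  by rewrite -[s](subKr z) mulrBl e addrK.
by rewrite -E0 -EE; exact: (hE _).1.
Qed.

Local Notation tau := (t / (2 * s)).
Local Notation W := (legW tau).

Definition legval (m k : nat) : C := t ^+ m / s ^+ k.+1 * (m + k)`!%:R * W k m.

Let legval1 m : legval m.+1 1 =
  (m.+1%:R / 2 * (t ^+ m / s - t ^+ m.+2 / s) + z * (t ^+ m.+1 / s)) / s ^+ 2.
Proof.
rewrite /legval legW1 addn1 [(m.+2)`!]factS natrM.
have -> : t ^+ m = w * t ^+ m.+1 by rewrite exprS mulrA wt mul1r.
rewrite [t ^+ m.+2]exprS; move: (factC_neq0 (R := R) m.+1) (natSC_neq0 (R := R) m.+1).
move: (t ^+ m.+1) (m.+1`!%:R) => tm f f0; rewrite -[m.+2%:R]natr1 => m0; field.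
by rewrite s0 f0 nat1r natr1 natSC_neq0.
Qed.

Let TSr m k N : T m k N.+1 = T m k N + legterm m k N.
Proof. by rewrite !TE big_nat_recr. Qed.

Let T_0 m k : T m k 0 = 0.
Proof. by rewrite TE big_nil. Qed.

Let lin1 (z2 c q P e e' A a' B b D d' : C) :
  z2 * (P + e) - P = c * (A - B) + q * D -> z2 * e' - e = c * (a' - b) + q * d' ->
  z2 * (P + e + e') - (P + e) = c * ((A + a') - (B + b)) + q * (D + d').
Proof.
move=> h1 h2; transitivity ((z2 * (P + e) - P) + (z2 * e' - e)); first by ring.
by rewrite h1 h2; ring.
Qed.

Let lin2 (z2 c q P e e' B b' D d' : C) :
  z2 * (P + e) - P = q * B - c * D -> z2 * e' - e = q * b' - c * d' ->
  z2 * (P + e + e') - (P + e) = q * (B + b') - c * (D + d').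
Proof.
move=> h1 h2; transitivity ((z2 * (P + e) - P) + (z2 * e' - e)); first by ring.
by rewrite h1 h2; ring.
Qed.

(** Multiplication by z^2 shifts the power of 1/z by two, so the term j + 1 pairs with the term j:
    hence the lengths N + 1 and N. The induction only compares the last terms ([lin1]). *)
Let T1_rec m N : z ^+ 2 * T m.+1 1 N.+1 - T m.+1 1 N =
  m.+1%:R / 2 * (T m 0 N.+1 - T m.+2 0 N) + z * T m.+1 0 N.+1.
Proof.
elim: N => [|N IH].
  rewrite !TSr !T_0 !add0r !subr0 /legterm double0 !addn0 !addn1 !fact0 !factCS !exprS.
  move: (factC_neq0 (R := R) m); move: (m`!%:R) (2 ^+ m) (expf_neq0 m c2) (y ^+ m) => f p p0 ym f0.
  by field; rewrite z0 f0 p0 nat1r natSC_neq0.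
rewrite (TSr m.+1 1 N) in IH.
rewrite (TSr m.+1 1 N.+1) (TSr m.+1 1 N) (TSr m 0 N.+1) (TSr m.+2 0 N) (TSr m.+1 0 N.+1).
apply: (lin1 IH); rewrite /legterm doubleS !addn0 !addn1 ?addSn !addnS ?addSn !factCS !exprS.
have hM : (m + N.*2)%:R = m%:R + 2 * N%:R :> C by rewrite natrD -mul2n natrM.
have n0 : N%:R + 1 != 0 :> C by rewrite natr1 natSC_neq0.
have mn0 : m%:R + N%:R + 1 != 0 :> C by rewrite -natrD natr1 natSC_neq0.
have mn1 : m%:R + N%:R + 1 + 1 != 0 :> C by rewrite -natrD !natr1 natSC_neq0.
rewrite -[(_ + N.*2).+4%:R]natr1 -[(_ + N.*2).+3%:R]natr1 -[(_ + N.*2).+2%:R]natr1.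
rewrite -[(_ + N.*2).+1%:R]natr1 hM -[N.+1%:R]natr1 -[(m + N).+2%:R]natr1 -[(m + N).+1%:R]natr1.
rewrite -[m.+1%:R]natr1 [(m + N)%:R]natrD.
move: (factC_neq0 (R := R) N) (factC_neq0 (R := R) (m + N)) (expf_neq0 (m + N.*2) c2).
move: (N`!%:R) ((m + N)`!%:R) ((m + N.*2)`!%:R) (2 ^+ (m + N.*2)) (y ^+ (m + N.*2)).
move=> f g F p ym f0 g0 p0.
by field; rewrite z0 f0 p0 g0 n0 mn0 mn1.
Qed.

(** The recurrence of the Legendre functions in the order, already valid for partial sums;
    [legval_rec] is its counterpart for the closed form. *)
Let Tk_rec m k N : z ^+ 2 * T m k.+2 N.+1 - T m k.+2 N =
  (2 * k + 3)%:R * z * T m k.+1 N.+1 - (k.+1%:R ^+ 2 - m%:R ^+ 2) * T m k N.+1.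
Proof.
elim: N => [|N IH].
  rewrite !TSr !T_0 !add0r subr0 /legterm double0 !addn0 !addn1 !addnS !fact0 !factCS !exprS.
  have -> : (2 * k + 0).+3%:R = 2 * k%:R + 3 :> C by rewrite addn0 -addn3 natrD natrM.
  rewrite -[(m + k).+2%:R]natr1 -![(m + k).+1%:R]natr1 -![k.+1%:R]natr1 !natrD.
  move: (factC_neq0 (R := R) m) (factC_neq0 (R := R) (m + k)) (expf_neq0 m c2).
  move: (m`!%:R) ((m + k)`!%:R) (2 ^+ m) (y ^+ (m + k)) => f g p ym f0 g0 p0.
  by field; rewrite z0 f0 p0.
rewrite (TSr m k.+2 N) in IH.
rewrite (TSr m k.+2 N.+1) (TSr m k.+2 N) (TSr m k.+1 N.+1) (TSr m k N.+1).
apply: (lin2 IH); rewrite /legterm doubleS !addn1 !addSn !addnS !addSn !factCS !exprS.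
have -> : (2 * k + 0).+3%:R = 2 * k%:R + 3 :> C by rewrite addn0 -addn3 natrD natrM.
have hM : (m + k + N.*2)%:R = m%:R + k%:R + 2 * N%:R :> C by rewrite !natrD -mul2n natrM.
have n0 : N%:R + 1 != 0 :> C by rewrite natr1 natSC_neq0.
have mn0 : m%:R + N%:R + 1 != 0 :> C by rewrite -natrD natr1 natSC_neq0.
rewrite -[(_ + N.*2).+4%:R]natr1 -[(_ + N.*2).+3%:R]natr1 -[(_ + N.*2).+2%:R]natr1 -[(_ + N.*2).+1%:R]natr1 hM.
rewrite -[N.+1%:R]natr1 -[(m + N).+1%:R]natr1 -[k.+1%:R]natr1 [(m + N)%:R]natrD.
move: (factC_neq0 (R := R) N) (factC_neq0 (R := R) (m + N)) (expf_neq0 (m + N.*2) c2).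
move: (N`!%:R) ((m + N)`!%:R) ((m + k + N.*2)`!%:R) (2 ^+ (m + N.*2)) (y ^+ (m + k + N.*2)).
move=> f g F p ym f0 g0 p0.
by field; rewrite z0 f0 p0 g0 n0 mn0.
Qed.

Let legval_rec m k : legval m k.+2 = ((2 * k + 3)%:R * z * legval m k.+1
    - (k.+1%:R ^+ 2 - m%:R ^+ 2) * legval m k) / s ^+ 2.
Proof.
have := legW_rec tau k m; rewrite /legval !addnS !factCS !exprS.
move: (W k.+2 _) (W k.+1 _) (W k _) => W2 W1 W0 /eqP.
rewrite addrAC subr_eq add0r => /eqP WE.
have {}WE : (m + k).+2%:R * W2 =
    (2 * k + 0).+3%:R * (1 + 2 * tau) * W1 - (k.+1%:R - m%:R) * W0.
  by rewrite -WE; ring.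
transitivity (t ^+ m / (s * (s * (s * s ^+ k))) * ((m + k).+1%:R * (m + k)`!%:R)
   * ((m + k).+2%:R * W2)); first by ring.
have kE : (2 * k + 0).+3%:R = 2 * k%:R + 3 :> C by rewrite addn0 -addn3 natrD natrM.
have mkE : (m + k).+1%:R = m%:R + k%:R + 1 :> C by rewrite -natr1 natrD.
rewrite WE mkE kE -[k.+1%:R]natr1.
move: (s0) (expf_neq0 k s0); move: ((m + k)`!%:R) (t ^+ m) (s ^+ k) => f tm sk s00 sk0.
by field; rewrite s0 sk0.
Qed.

Lemma legterm_cvg m k : (0 < m)%N -> series (legterm m k) @ \oo --> legval m k.
Proof.
case: m => // m _; rewrite -/(T m.+1 k).
have sh m' k' (l : C) : T m' k' @ \oo --> l -> (fun N => T m' k' N.+1) @ \oo --> l.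
  exact: cvgC_S.
have s2 : s ^+ 2 != 0 by rewrite expf_neq0.
(* Divided by z^2, the hypothesis is an affine recurrence with ratio z^(-2), of modulus less than 1,
   and the limit is b / (z^2 - 1). *)
have key m' k' (B : nat -> C) (b : C) : (forall N, z ^+ 2 * T m' k' N.+1 - T m' k' N = B N) ->
    B @ \oo --> b -> T m' k' @ \oo --> (b / s ^+ 2 : C).
  move=> hT hB; have -> : b / s ^+ 2 = (y ^+ 2 * b) / (1 - y ^+ 2).
    by rewrite ss; field; rewrite -ss s2 z0.
  apply: (@affine_rec_cvg (y ^+ 2) _ (fun N => y ^+ 2 * B N)); first exact: y2.
    by move=> N; rewrite -hT; move: (T m' k' N) (T m' k' N.+1) => P P'; field.
  exact: cvgMr.
(* The recurrence has order two in k, so two consecutive values are carried. The case k = 1 uses the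
   rows of k = 0 on both sides of the given one, whence 0 < m. *)
suff [h _] : T m.+1 k @ \oo --> legval m.+1 k /\ T m.+1 k.+1 @ \oo --> legval m.+1 k.+1 by [].
elim: k => [|k [IH0 IH1]].
  split.
    have -> : legval m.+1 0 = t ^+ m.+1 / s; last exact: T0_lim.
    by rewrite /legval legW0 addn0 expr1 mulfK // factC_neq0.
  rewrite legval1; apply: (key _ _ _ _ (T1_rec m)).
  apply: cvgD; apply: cvgMr; first by apply: cvgB; [apply: sh |]; exact: T0_lim.
  by apply: sh; exact: T0_lim.
split; first exact: IH1.
rewrite legval_rec; apply: (key _ _ _ _ (Tk_rec _ _)); apply: cvgB; apply: cvgMr; last exact: sh.
exact: sh.
Qed.

End LegendreSeries.

(** * The closed form of the Legendre functions for |z| > 1 *)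

Section LegendreQSeries.
Variable R : realType.
Local Notation C := R[i].
Local Notation re := (@complex.Re R).
Local Notation im := (@complex.Im R).
Local Notation nc := (@Normc.normc R).

Lemma cvgC_lim (u : nat -> C) (l : C) : u @ \oo --> l -> limn u = l.
Proof. by move=> h; apply: cvg_lim h; exact: norm_hausdorff. Qed.

Lemma cvgCMr (c : C) (u : nat -> C) (l : C) : u @ \oo --> l -> (fun n => c * u n) @ \oo --> c * l.
Proof. exact: cvgMr. Qed.

Lemma poch0 (a : C) : poch a 0 = 1.
Proof. by rewrite /poch big_geq. Qed.

Lemma pochS (a : C) n : poch a n.+1 = poch a n * (a + n%:R).
Proof. by rewrite /poch big_nat_recr. Qed.

Lemma poch_nat n k : poch (n.+1%:R : C) k = (n + k)`!%:R / n`!%:R.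
Proof.
elim: k => [|k IH]; first by rewrite poch0 addn0 divff // factC_neq0.
by rewrite pochS IH addnS factCS -natrD addSn; ring.
Qed.

Lemma poch_half N j : poch ((N.+1%:R : C) / 2) j * poch (N.+2%:R / 2) j =
  (N + j.*2)`!%:R / N`!%:R / 4 ^+ j.
Proof.
have c4 : (4 : C) != 0 by rewrite pnatr_eq0.
elim: j => [|j IH].
  by rewrite !poch0 addn0 expr0 divr1 mul1r divff // factC_neq0.
rewrite !pochS mulrACA IH doubleS !addnS !factCS exprS.
have h1 : (N + j.*2).+1%:R = N%:R + 2 * j%:R + 1 :> C by rewrite -natr1 natrD -mul2n natrM.
rewrite -[(N + j.*2).+2%:R]natr1 h1 -[N.+2%:R]natr1 -[N.+1%:R]natr1.
move: (factC_neq0 (R := R) N) (expf_neq0 j c4).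
move: (N`!%:R) ((N + j.*2)`!%:R) (4 ^+ j) => f g q f0 q0.
by field; rewrite f0 q0.
Qed.

Lemma cGamma_nat n : cGamma (n.+1%:R : C) = n`!%:R.
Proof.
have h1 k : (fun N : nat => (N%:R : C) / (k + N).+1%:R) @ \oo --> (1 : C).
  apply: (@squeezeC _ _ _ (fun N => k.+1%:R * harmonic N)); last first.
    rewrite -(mulr0 k.+1%:R); apply: cvgMr; exact: cvg_harmonic.
  move=> N; have -> : (N%:R : C) / (k + N).+1%:R - 1 = - (k.+1%:R / (k + N).+1%:R).
    have kN : (k + N).+1%:R = k.+1%:R + N%:R :> C by rewrite -natrD addSn.
    have := natSC_neq0 (R := R) (k + N); rewrite kN.
    by move: (k.+1%:R : C) => K kN0; field.
  rewrite ncN ncM ncV !nc_nat ler_wpM2l // lef_pV2 ?posrE ?ltr0n // ler_nat ltnS.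
  exact: leq_addl.
have h2 k : (fun N : nat => (N`!%:R : C) * N%:R ^+ k / (k + N)`!%:R) @ \oo --> (1 : C).
  elim: k => [|k IH].
    rewrite (_ : (fun _ => _) = fun=> 1); first exact: cvg_cst.
    by apply/funext => N; rewrite expr0 mulr1 divff // factC_neq0.
  rewrite (_ : (fun _ => _) = fun N : nat => ((N`!%:R : C) * N%:R ^+ k / (k + N)`!%:R)
     * (N%:R / (k + N).+1%:R)); last first.
    apply/funext => N; rewrite addSn factCS exprS; field.
    by rewrite factC_neq0 -natrD nat1r natSC_neq0.
  by rewrite -[X in _ --> X]mulr1; apply: cvgM.
rewrite /cGamma; apply: cvgC_lim.
have := cvgCMr (c := n`!%:R) (h2 n.+1); rewrite mulr1; apply: cvg_trans.
apply: near_eq_cvg; near=> N.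
have N0 : (N%:R : C) != 0 by rewrite pnatr_eq0 -lt0n; near: N; exact: nbhs_infty_gt.
rewrite /= cpow_nat // poch_nat addnS addSn invf_div; field.
by rewrite !factC_neq0.
Unshelve. all: by end_near. Qed.

Lemma cexp_ipi : cexp ('i%C * pi%:C) = -1 :> C.
Proof.
apply: eqC_reim; rewrite ?re_cexp ?im_cexp reM imM /= !mul0r !mul1r subr0 ?addr0 ?add0r.
  by rewrite expR0 mul1r cospi.
by rewrite expR0 mul1r sinpi oppr0.
Qed.

Lemma cexp_ipi_half : cexp ('i%C * pi%:C * 2^-1) = 'i%C :> C.
Proof.
have -> : 'i%C * pi%:C * 2^-1 = 'i%C * (pi / 2)%:C :> C.
  by rewrite -mulrA rmorphM fmorphV rmorph_nat.
apply: eqC_reim; rewrite ?re_cexp ?im_cexp reM imM /= !mul0r !mul1r subr0 ?addr0 ?add0r.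
  by rewrite expR0 mul1r cos_pihalf.
by rewrite expR0 mul1r sin_pihalf.
Qed.

(** The factor i (-1)^k is exp (i pi (k + 1/2)), and the power 2^(1/2) is what is left of 2^(nu + 1)
    = 2^m 2^(1/2) for nu = m - 1/2. *)
Definition legQ (m k : nat) (z : C) : C :=
  (Num.sqrt pi)%:C * ('i%C * (-1) ^+ k) / cpow 2 2^-1
  * cpow_sqr_sub1 z ((k%:R + 2^-1) / 2) * legval z m k.

(** For these parameters nu + ka + 1 and nu + 3/2 are positive integers, so the Gamma values are
    factorials and the power of z in the denominator is integral. *)
Lemma legendreQ_seriesE m k z : (0 < m)%N -> cutplane 1 z -> 1 < nc z ->
  legendreQ_series (m%:R - 2^-1) (k%:R + 2^-1) z = legQ m k z.
Proof.
move=> m0 zcut z1; have z0 : z != 0 by exact: cutplane1_neq0.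
have c2 : (2 : C) != 0 by rewrite pnatr_eq0.
have c4 : (4 : C) != 0 by rewrite pnatr_eq0.
have sq2 : cpow 2 2^-1 != 0 :> C by exact: cpow_neq0.
rewrite /legendreQ_series.
have E1 : m%:R - 2^-1 + (k%:R + 2^-1) + 1 = (m + k).+1%:R :> C.
  by rewrite -[(m + k).+1%:R]natr1 natrD; field.
have E2 : m%:R - 2^-1 + (k%:R + 2^-1) + 2 = (m + k).+2%:R :> C.
  by rewrite -[(m + k).+2%:R]natr1 -[(m + k).+1%:R]natr1 natrD; field.
have E3 : m%:R - 2^-1 + 3 / 2 = m.+1%:R :> C by rewrite -[m.+1%:R]natr1; field.
have E4 : m%:R - 2^-1 + 1 = m%:R + 2^-1 :> C by field.
rewrite E1 E2 E3 E4 !cGamma_nat cpow_nat // cpowD cpow_nat //.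
have -> : cexp ('i%C * pi%:C * (k%:R + 2^-1)) = 'i%C * (-1) ^+ k :> C.
  by rewrite mulrDr cexpD cexp_ipi_half mulr_natr cexpMn cexp_ipi mulrC.
pose c : C := (m + k)`!%:R / (2 ^+ m * m`!%:R * z ^+ (m + k).+1).
have c0 : c != 0.
  by rewrite /c mulf_neq0 ?invr_eq0 ?factC_neq0 // !mulf_neq0 ?factC_neq0 ?expf_neq0.
have -> : hyp2F1 ((m + k).+1%:R / 2) ((m + k).+2%:R / 2) m.+1%:R (z ^- 2) = c^-1 * legval z m k.
  rewrite /hyp2F1; apply: cvgC_lim.
  rewrite (_ : series _ = fun N => c^-1 * series (legterm z m k) N).
    by apply: cvgMr; exact: legterm_cvg.
  apply/funext => N; rewrite /series /= mulr_sumr; apply: eq_bigr => j _.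
  rewrite poch_half poch_nat /c /legterm addn1 exprD.
  have -> : z ^- 2 ^+ j = (z ^+ j.*2)^-1 by rewrite exprVn -exprM mul2n.
  rewrite exprD !exprVn.
  have -> : 2 ^+ j.*2 = 4 ^+ j :> C by rewrite -mul2n exprM; congr (_ ^+ _); ring.
  move: (factC_neq0 (R := R) (m + k)) (factC_neq0 (R := R) m) (factC_neq0 (R := R) j)
    (factC_neq0 (R := R) (m + j)) (expf_neq0 m c2) (expf_neq0 j c4)
    (expf_neq0 (m + k).+1 z0) (expf_neq0 j.*2 z0).
  move: ((m + k)`!%:R) (m`!%:R) (j`!%:R) ((m + j)`!%:R) (2 ^+ m) (4 ^+ j) (z ^+ (m + k).+1)
    (z ^+ j.*2) ((m + k + j.*2)`!%:R) => a1 a2 a3 a4 a5 a6 a7 a8 a9 b1 b2 b3 b4 b5 b6 b7 b8.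
  by field; rewrite b1 b2 b3 b4 b5 b6 b7 b8.
rewrite /legQ /c.
move: (factC_neq0 (R := R) (m + k)) (factC_neq0 (R := R) m) (expf_neq0 m c2) (expf_neq0 (m + k).+1 z0).
move: ((m + k)`!%:R) (m`!%:R) (2 ^+ m) (z ^+ (m + k).+1) sq2 => a1 a2 a3 a4 sq2 b1 b2 b3 b4.
by field; rewrite b1 b2 b3 b4 sq2.
Qed.

End LegendreQSeries.

(** * Local power series, their algebra, and the power - 1/4 *)

Section LocalPowerSeries.
Variable R : realType.
Local Notation C := R[i].
Local Notation re := (@complex.Re R).
Local Notation im := (@complex.Im R).
Local Notation nc := (@Normc.normc R).

Lemma triangle_sum (V : nmodType) (F : nat -> nat -> V) N :
  \sum_(0 <= n < N) \sum_(0 <= i < n.+1) F i (n - i)%N =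
  \sum_(0 <= i < N) \sum_(0 <= j < N - i) F i j.
Proof.
elim: N => [|N IH]; first by rewrite !big_nil.
rewrite big_nat_recr //= IH [RHS]big_nat_recr //= subSnn big_nat1.
rewrite [in LHS]big_nat_recr //= subnn addrA -big_split /=; congr (_ + _).
apply: eq_big_nat => i /andP[_ iN]; rewrite subSn ?(ltnW iN) //.
by rewrite big_nat_recr.
Qed.

Lemma cvgCM (u v : nat -> C) (l m : C) : u @ \oo --> l -> v @ \oo --> m ->
  (fun n => u n * v n) @ \oo --> l * m.
Proof. by move=> hu hv; exact: (cvgM hu hv). Qed.

Lemma cvgCD (u v : nat -> C) (l m : C) : u @ \oo --> l -> v @ \oo --> m ->
  (fun n => u n + v n) @ \oo --> l + m.
Proof. by move=> hu hv; exact: (cvgD hu hv). Qed.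

Lemma cvgCB (u v : nat -> C) (l m : C) : u @ \oo --> l -> v @ \oo --> m ->
  (fun n => u n - v n) @ \oo --> l - m.
Proof. by move=> hu hv; exact: (cvgB hu hv). Qed.

Lemma eq_series_cvg (a b : nat -> C) (l : C) : a =1 b -> series a @ \oo --> l -> series b @ \oo --> l.
Proof. by move=> /funext ->. Qed.

(** The product of the partial sums exceeds the partial sum of the product by the terms with i, j <
    N and i + j >= N: at most N^2 of them, each bounded by Ma Mb q^N. *)
Lemma cauchy_product_cvg (a b : nat -> C) (Ma Mb q : R) (A B : C) : 0 <= q < 1 ->
  (forall n, nc (a n) <= Ma * q ^+ n) -> (forall n, nc (b n) <= Mb * q ^+ n) ->
  series a @ \oo --> A -> series b @ \oo --> B ->
  series (fun n => \sum_(0 <= i < n.+1) a i * b (n - i)%N) @ \oo --> A * B.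
Proof.
move=> /andP[q0 q1] ha hb hA hB.
have Ma0 : 0 <= Ma by have := ha 0%N; rewrite expr0 mulr1; apply: le_trans; exact: nc_ge0.
have Mb0 : 0 <= Mb by have := hb 0%N; rewrite expr0 mulr1; apply: le_trans; exact: nc_ge0.
have AB : (fun N => series a N * series b N) @ \oo --> A * B by exact: cvgCM hA hB.
have rest : (fun N => series a N * series b N
    - series (fun n => \sum_(0 <= i < n.+1) a i * b (n - i)%N) N) @ \oo --> (0 : C).
  apply: (@squeezeC _ _ _ (fun N => (Ma * Mb) * (N%:R ^+ 2 * q ^+ N))); last first.
    by rewrite -(mulr0 (Ma * Mb)); apply: cvgMr; apply: polygeom_cvg0; rewrite q0.
  move=> N; rewrite subr0 /series /= (triangle_sum (fun i j => a i * b j)).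
  rewrite mulr_suml -sumrB.
  have -> : \sum_(0 <= i < N) (a i * \sum_(0 <= k < N) b k - \sum_(0 <= j < N - i) a i * b j)
      = \sum_(0 <= i < N) \sum_(N - i <= j < N) a i * b j.
    apply: eq_bigr => i _; rewrite mulr_sumr.
    by rewrite (big_cat_nat (leq0n (N - i)) (leq_subr i N)) /= addrAC subrr add0r.
  apply: le_trans (nc_sum _ _ _) _.
  apply: (@le_trans _ _ (\sum_(0 <= i < N) \sum_(0 <= j < N) Ma * Mb * q ^+ N)).
    apply: ler_sum_nat => i /andP[_ iN]; apply: le_trans (nc_sum _ _ _) _.
    apply: (@le_trans _ _ (\sum_(N - i <= j < N) Ma * Mb * q ^+ N)).
      apply: ler_sum_nat => j /andP[ij jN]; rewrite ncM.
      apply: (@le_trans _ _ ((Ma * q ^+ i) * (Mb * q ^+ j))).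
        by apply: ler_pM; rewrite ?nc_ge0.
      rewrite mulrACA -exprD ler_wpM2l ?mulr_ge0 // ler_wiXn2l ?(ltW q1) //.
      by rewrite -leq_subLR.
    rewrite [leRHS](big_cat_nat (leq0n (N - i)) (leq_subr i N)) /= lerDr sumr_ge0 // => j _.
    by rewrite !mulr_ge0 // exprn_ge0.
  rewrite !sumr_const_nat subn0 -[_ *+ N *+ N]mulr_natr -[_ *+ N]mulr_natr expr2.
  by rewrite le_eqVlt; apply/orP; left; apply/eqP; ring.
have := cvgCB AB rest; rewrite subr0; apply: cvg_trans; apply: near_eq_cvg.
by near=> N; rewrite /= opprB addrC subrK.
Unshelve. all: by end_near. Qed.

(* The sum of a power series at z0, with a Cauchy bound on its coefficients that
   makes products and polynomials in such functions of the same kind. *)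
Definition psat (z0 : C) (f : C -> C) := exists (a : nat -> C) (r M : R),
  [/\ 0 < r, forall n, nc (a n) * r ^+ n <= M
    & forall z, nc (z - z0) < r -> series (fun n => a n * (z - z0) ^+ n) @ \oo --> f z].

Lemma psat_term_le (a : nat -> C) (r M : R) (h : C) n : 0 < r ->
  (forall n, nc (a n) * r ^+ n <= M) -> nc (a n * h ^+ n) <= M * (nc h / r) ^+ n.
Proof.
move=> r0 ha; rewrite ncM ncX expr_div_n.
have -> : M * (nc h ^+ n / r ^+ n) = M / r ^+ n * nc h ^+ n by ring.
apply: ler_wpM2r; first by rewrite exprn_ge0 ?nc_ge0.
by rewrite ler_pdivlMr ?exprn_gt0.
Qed.

Lemma psat_q_lt1 (h : C) (r : R) : 0 < r -> nc h < r -> 0 <= nc h / r < 1.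
Proof. by move=> r0 hr; rewrite divr_ge0 ?nc_ge0 ?(ltW r0) //= ltr_pdivrMr ?mul1r. Qed.

Lemma psat_ext z0 (f g : C -> C) (e : R) : 0 < e ->
  (forall z, nc (z - z0) < e -> f z = g z) -> psat z0 f -> psat z0 g.
Proof.
move=> e0 fg [a [r [M [r0 ha hf]]]]; exists a, (Num.min r e), M; split.
- by rewrite lt_min r0.
- move=> n; apply: le_trans (ha n); rewrite ler_wpM2l ?nc_ge0 //.
  by rewrite lerXn2r ?nnegrE ?le_min ?ge_min ?lexx ?(ltW r0) ?(ltW e0).
- by move=> z; rewrite lt_min => /andP[h1 h2]; rewrite -fg //; exact: hf.
Qed.

Lemma psat_cst z0 (c : C) : psat z0 (fun=> c).
Proof.
exists (fun n => if n is 0 then c else 0), 1, (nc c); split => //.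
  by case=> [|n]; rewrite expr1n mulr1 // nc0 nc_ge0.
move=> z _; apply/(cvgC_shift _ _ 1); rewrite (_ : (fun _ => _) = fun=> c); first exact: cvg_cst.
apply/funext => n; rewrite addn1 /series /= big_nat_recl //= expr0 mulr1 big1 ?addr0 //.
by move=> i _; rewrite mul0r.
Qed.

Lemma psat_id z0 : psat z0 id.
Proof.
exists (fun n => if n is 0 then z0 else if n is 1 then 1 else 0), 1, (nc z0 + 1); split => //.
  case=> [|[|n]]; rewrite expr1n mulr1 ?nc1 ?nc0; have := nc_ge0 z0; lra.
move=> z _; apply/(cvgC_shift _ _ 2); rewrite (_ : (fun _ => _) = fun=> z); first exact: cvg_cst.
apply/funext => n; rewrite addn2 /series /= !big_nat_recl //= expr0 mulr1 big1 ?addr0.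
  by rewrite expr1 mul1r addrC subrK.
by move=> i _; rewrite mul0r.
Qed.

Let common z0 f g : psat z0 f -> psat z0 g -> exists (a b : nat -> C) (r Ma Mb : R),
  [/\ 0 < r, forall n, nc (a n) * r ^+ n <= Ma, forall n, nc (b n) * r ^+ n <= Mb,
    forall z, nc (z - z0) < r -> series (fun n => a n * (z - z0) ^+ n) @ \oo --> f z
    & forall z, nc (z - z0) < r -> series (fun n => b n * (z - z0) ^+ n) @ \oo --> g z].
Proof.
move=> [a [r [M [r0 ha hf]]]] [b [r' [M' [r0' hb hg]]]].
exists a, b, (Num.min r r'), M, M'; split.
- by rewrite lt_min r0.
- move=> n; apply: le_trans (ha n); rewrite ler_wpM2l ?nc_ge0 //.
  by rewrite lerXn2r ?nnegrE ?le_min ?ge_min ?lexx ?(ltW r0) ?(ltW r0').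
- move=> n; apply: le_trans (hb n); rewrite ler_wpM2l ?nc_ge0 //.
  by rewrite lerXn2r ?nnegrE ?le_min ?ge_min ?lexx ?(ltW r0) ?(ltW r0') ?orbT.
- by move=> z; rewrite lt_min => /andP[h1 h2]; exact: hf.
- by move=> z; rewrite lt_min => /andP[h1 h2]; exact: hg.
Qed.

Lemma psatD z0 f g : psat z0 f -> psat z0 g -> psat z0 (fun z => f z + g z).
Proof.
move=> pf pg; have [a [b [r [Ma [Mb [r0 ha hb hf hg]]]]]] := common pf pg.
exists (fun n => a n + b n), r, (Ma + Mb); split; [exact: r0 | move=> n | move=> z hz].
  apply: le_trans (lerD (ha n) (hb n)); rewrite -mulrDl ler_wpM2r ?ncD //.
  by rewrite exprn_ge0 // ltW.
rewrite (_ : series _ = series (fun n => a n * (z - z0) ^+ n) \+ series (fun n => b n * (z - z0) ^+ n)).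
  exact: cvgCD (hf z hz) (hg z hz).
apply/funext => N; rewrite /series /= -big_split /=; apply: eq_bigr => i _.
by rewrite mulrDl.
Qed.

Lemma psatM z0 f g : psat z0 f -> psat z0 g -> psat z0 (fun z => f z * g z).
Proof.
move=> pf pg; have [a [b [r [Ma [Mb [r0 ha hb hf hg]]]]]] := common pf pg.
have Ma0 : 0 <= Ma by have := ha 0%N; apply: le_trans; rewrite mulr_ge0 ?nc_ge0 ?exprn_ge0 ?ltW.
have Mb0 : 0 <= Mb by have := hb 0%N; apply: le_trans; rewrite mulr_ge0 ?nc_ge0 ?exprn_ge0 ?ltW.
(* Halving the radius frees a factor 2^n, which absorbs the n + 1 terms of the convolution. *)
exists (fun n => \sum_(0 <= i < n.+1) a i * b (n - i)%N), (r / 2), (Ma * Mb); split.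
- by rewrite divr_gt0.
- move=> n; rewrite expr_div_n mulrA ler_pdivrMr ?exprn_gt0 //.
  apply: (@le_trans _ _ (\sum_(0 <= i < n.+1) Ma * Mb)); last first.
    rewrite sumr_const_nat subn0 -[_ *+ n.+1]mulr_natr ler_wpM2l ?mulr_ge0 // -natrX ler_nat.
    exact: ltn_expl.
  apply: le_trans (ler_wpM2r _ (nc_sum _ _ _)) _; first by rewrite exprn_ge0 // ltW.
  rewrite mulr_suml; apply: ler_sum_nat => i /andP[_ iN].
  rewrite ncM; have -> : r ^+ n = r ^+ i * r ^+ (n - i) by rewrite -exprD subnKC.
  by rewrite mulrACA ler_pM ?mulr_ge0 ?nc_ge0 ?exprn_ge0 ?(ltW r0).
- move=> z hz; have hz' : nc (z - z0) < r by apply: lt_trans hz _; lra.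
  have := cauchy_product_cvg (psat_q_lt1 r0 hz') (fun n => psat_term_le (z - z0) n r0 ha)
    (fun n => psat_term_le (z - z0) n r0 hb) (hf z hz') (hg z hz').
  apply: eq_series_cvg => n.
  rewrite mulr_suml; apply: eq_big_nat => i /andP[_ iN].
  by rewrite mulrACA -exprD subnKC.
Qed.

Lemma psatX z0 f n : psat z0 f -> psat z0 (fun z => f z ^+ n).
Proof.
move=> pf; elim: n => [|n IH].
  by apply: (@psat_ext _ (fun=> 1) _ 1 ltr01) => [z _|]; [rewrite expr0 | exact: psat_cst].
by apply: (@psat_ext _ (fun z => f z * f z ^+ n) _ 1 ltr01) => [z _|]; [rewrite exprS | exact: psatM].
Qed.

Lemma psat_sum z0 (F : nat -> C -> C) N : (forall n, psat z0 (F n)) ->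
  psat z0 (fun z => \sum_(0 <= n < N) F n z).
Proof.
move=> pf; elim: N => [|N IH].
  by apply: (@psat_ext _ (fun=> 0) _ 1 ltr01) => [z _|]; [rewrite big_nil | exact: psat_cst].
apply: (@psat_ext _ (fun z => (\sum_(0 <= n < N) F n z) + F N z) _ 1 ltr01) => [z _|].
  by rewrite big_nat_recr.
exact: (psatD IH (pf N)).
Qed.

Definition binc (a : C) n : C := \prod_(0 <= j < n) ((a - j%:R) / j.+1%:R).

Lemma binc0 a : binc a 0 = 1. Proof. by rewrite /binc big_nil. Qed.

Lemma bincS a n : n.+1%:R * binc a n.+1 = (a - n%:R) * binc a n.
Proof. by rewrite /binc big_nat_recr //= mulrCA [n.+1%:R * _]mulrC divfK ?natSC_neq0 // mulrC. Qed.

(** Write n + 1 = i + (n + 1 - i) and apply [bincS] to the binomial carrying each part: the factors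
    (a - i) and (b - (n - i)) add up to a + b - n. *)
Lemma vandermonde a b n : \sum_(0 <= i < n.+1) binc a i * binc b (n - i)%N = binc (a + b) n.
Proof.
elim: n => [|n IH]; first by rewrite big_nat1 !binc0 mulr1.
apply: (mulfI (natSC_neq0 n)); rewrite bincS -IH.
transitivity (\sum_(0 <= i < n.+2) (i%:R * binc a i * binc b (n.+1 - i)%N)
  + \sum_(0 <= i < n.+2) (binc a i * ((n.+1 - i)%:R * binc b (n.+1 - i)%N))).
  rewrite -big_split mulr_sumr /=; apply: eq_big_nat => i /andP[_ iN].
  by rewrite natrB //; ring.
rewrite big_nat_recl // [X in _ + X]big_nat_recr //= subnn !mul0r mulr0 add0r addr0.
rewrite -big_split mulr_sumr /=; apply: eq_big_nat => i /andP[_ iN].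
by rewrite subSS bincS subSn // bincS natrB //; ring.
Qed.

Lemma binc_le1 (a : R) n : 0 <= a <= 1 -> nc (binc (- a%:C) n) <= 1.
Proof.
move=> /andP[a0 a1]; elim: n => [|n IH]; first by rewrite binc0 nc1.
rewrite /binc big_nat_recr //= ncM -[leRHS]mulr1; apply: ler_pM; rewrite ?nc_ge0 //.
rewrite ncM ncV nc_nat ler_pdivrMr ?ltr0n // mul1r -opprD ncN.
have -> : a%:C + n%:R = (a + n%:R)%:C :> C by rewrite rmorphD rmorph_nat.
by rewrite nc_real ger0_norm ?addr_ge0 // -natr1 addrC lerD2l.
Qed.

Lemma binc_N1 n : binc (-1) n = (-1) ^+ n.
Proof.
elim: n => [|n IH]; first by rewrite binc0.
apply: (mulfI (natSC_neq0 n)); rewrite bincS IH exprS -natr1; ring.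
Qed.

Lemma re_inv_gt0 (y : C) : 0 < re y -> 0 < re y^-1.
Proof.
move=> h; rewrite reV divr_gt0 // exprn_gt0 // nc_gt0.
exact: (cutplane0_neq0 (cutplane0_re h)).
Qed.

Lemma sqr_inj_re (y w : C) : 0 < re y -> 0 < re w -> y ^+ 2 = w ^+ 2 -> y = w.
Proof.
move=> hy hw /eqP; rewrite -subr_eq0 subr_sqr mulf_eq0 subr_eq0 => /orP[/eqP//|/eqP e].
by have := addr_gt0 hy hw; rewrite -reD e ltxx.
Qed.

Let q4 : (4^-1 : C) = (4^-1 : R)%:C. Proof. by rewrite fmorphV rmorph_nat. Qed.
Let q2 : (2^-1 : C) = (2^-1 : R)%:C. Proof. by rewrite fmorphV rmorph_nat. Qed.
Let q1 : (1 : C) = (1 : R)%:C. Proof. by rewrite rmorph1. Qed.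

(** By Vandermonde and Cauchy products the sum l satisfies l^4 = 1 / (1 + d). From |d| < 1/4 follow
    |l - 1| <= 1/3 and |l^2 - 1| <= 7/9; so l and l^2 have positive real part, like the principal
    powers, and two square roots can be taken without ambiguity. *)
Lemma binomial_series_quarter (d : C) : nc d < 4^-1 ->
  series (fun n => binc (- 4^-1) n * d ^+ n) @ \oo --> cpow (1 + d) (- 4^-1).
Proof.
move=> hd; have d1 : nc d < 1 by apply: lt_trans hd _; lra.
have qd : 0 <= nc d < 1 by rewrite nc_ge0.
have le1 (a : R) n : 0 <= a <= 1 -> nc (binc (- a%:C) n * d ^+ n) <= 1 * nc d ^+ n.
  by move=> ha; rewrite ncM ncX ler_wpM2r ?exprn_ge0 ?nc_ge0 // binc_le1.
have h4 : 0 <= (4^-1 : R) <= 1 by apply/andP; split; lra.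
have h2 : 0 <= (2^-1 : R) <= 1 by apply/andP; split; lra.
have b4 n : nc (binc (- 4^-1) n * d ^+ n) <= 1 * nc d ^+ n by rewrite q4; exact: le1.
have b2 n : nc (binc (- 2^-1) n * d ^+ n) <= 1 * nc d ^+ n by rewrite q2; exact: le1.
have [l hl] := series_geom_cvg qd b4.
have prod (a b : C) n : \sum_(0 <= i < n.+1) (binc a i * d ^+ i) * (binc b (n - i) * d ^+ (n - i))
    = binc (a + b) n * d ^+ n.
  rewrite -vandermonde mulr_suml; apply: eq_big_nat => i /andP[_ iN].
  by rewrite mulrACA -exprD subnKC.
have l2 : series (fun n => binc (- 2^-1) n * d ^+ n) @ \oo --> l * l.
  have := cauchy_product_cvg qd b4 b4 hl hl; apply: eq_series_cvg => n.
  by rewrite prod; congr (binc _ _ * _); field.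
have l4 : series (fun n => (- d) ^+ n) @ \oo --> (l * l) * (l * l).
  have := cauchy_product_cvg qd b2 b2 l2 l2; apply: eq_series_cvg => n.
  rewrite prod (exprNn d); congr (_ * _); rewrite -binc_N1.
  by congr (binc _ _); field.
have d0 : 1 + d != 0.
  have := re_1sub_gt0 (y := - d); rewrite ncN opprK => /(_ d1) h.
  exact: cutplane0_neq0 (cutplane0_re h).
have re1d : 0 < re (1 + d) by have := re_1sub_gt0 (y := - d); rewrite ncN opprK; apply.
have l4E : (l * l) * (l * l) = (1 + d)^-1.
  apply: (cvgC_unique l4).
  have geo N : series (fun n => (- d) ^+ n) N = (1 + d)^-1 - (1 + d)^-1 * (- d) ^+ N.
    elim: N => [|N IH]; first by rewrite /series /= big_nil expr0 mulr1 subrr.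
    rewrite /series /= big_nat_recr //=; rewrite /series /= in IH; rewrite IH exprS.
    by field.
  rewrite (_ : series _ = fun N => (1 + d)^-1 - (1 + d)^-1 * (- d) ^+ N); last exact/funext.
  apply: (@squeezeC _ _ _ (fun N => nc (1 + d)^-1 * nc d ^+ N)) => [N|].
    by rewrite addrAC subrr add0r ncN ncM ncX ncN.
  by rewrite -(mulr0 (nc (1 + d)^-1)); apply: cvgMr; exact: cvgX_lt1.
have l1 : nc (l - 1) <= 3^-1.
  have := series0_cvg hl; rewrite binc0 expr0 mulr1 => hl1.
  have b4' n : nc (binc (- 4^-1) n.+1 * d ^+ n.+1) <= nc d * nc d ^+ n by rewrite -exprS -[leRHS]mul1r.
  apply: le_trans (series_geom_le qd b4' hl1) _.
  rewrite ler_pdivrMr ?subr_gt0 //; lra.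
have rel : 0 < re l.
  have := le_trans (re_le_nc (l - 1)) l1; rewrite reD reN /= ler_norml => /andP[h _]; lra.
have rel2 : 0 < re (l ^+ 2).
  have : nc (l ^+ 2 - 1) <= 7 / 9.
    have -> : l ^+ 2 - 1 = (l - 1) * ((l - 1) + 2%:R) by ring.
    rewrite ncM (_ : 7 / 9 = 3^-1 * (3^-1 + 2)); last by field.
    apply: ler_pM; rewrite ?nc_ge0 //; apply: le_trans (ncD _ _) _.
    by rewrite nc_nat lerD2r.
  move=> h; have := le_trans (re_le_nc _) h; rewrite reD reN /= ler_norml => /andP[h' _]; lra.
set P := cpow (1 + d) (- 4^-1).
suff lP : l = P by rewrite -lP; exact: hl.
have cut := cutplane0_re re1d.
have reP : 0 < re P.
  rewrite /P cpowN re_inv_gt0 // q4 re_cpow_gt0 //; apply/andP; split; lra.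
have P2 : P ^+ 2 = (cpow (1 + d) 2^-1)^-1.
  by rewrite /P -cpowX -cpowN; congr (cpow _ _); field.
have reP2 : 0 < re (P ^+ 2).
  rewrite P2 re_inv_gt0 // q2 re_cpow_gt0 //; apply/andP; split; lra.
apply: sqr_inj_re => //; apply: sqr_inj_re => //.
rewrite P2 exprVn cpow_half_sqr // -l4E; ring.
Qed.

Lemma cutplane0_open (y : C) : cutplane 0 y ->
  exists2 r : R, 0 < r & forall h, nc h < r -> cutplane 0 (y + h).
Proof.
move=> hy; have [i0|i0] := eqVneq (im y) 0.
  have r0 : 0 < re y by rewrite ltNge; apply/negP => h; apply: hy.
  exists (re y) => // h hr [_]; rewrite reD => h2.
  have := le_trans (ler_norm (- re h)); rewrite normrN => /(_ _ (re_le_nc h)); lra.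
exists `|im y|; first by rewrite normr_gt0.
move=> h hr [+ _]; rewrite imD => /eqP; rewrite addr_eq0 => /eqP e.
by move: hr; rewrite e normrN ltNge im_le_nc.
Qed.

Lemma psat_cpow_quarter (z0 c : C) : cutplane 0 (z0 + c) ->
  psat z0 (fun z => cpow (z + c) (- 4^-1)).
Proof.
move=> hy; set y := z0 + c in hy *; have y0 := cutplane0_neq0 hy.
have ny : 0 < nc y by rewrite nc_gt0.
have [e e0 he] := cutplane0_open hy.
exists (fun n => cpow y (- 4^-1) * (binc (- 4^-1) n / y ^+ n)), (Num.min e (nc y / 4)),
  (nc (cpow y (- 4^-1))); split.
- by rewrite lt_min e0 divr_gt0.
- move=> n; rewrite ncM -mulrA ler_piMr ?nc_ge0 // ncM ncV ncX.
  have h4 : 0 <= (4^-1 : R) <= 1 by apply/andP; split; lra.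
  have hb := binc_le1 n h4; rewrite -q4 in hb.
  rewrite -mulrA -[leRHS]mulr1; apply: ler_pM => //; rewrite ?nc_ge0 //.
    by rewrite mulr_ge0 ?invr_ge0 ?exprn_ge0 ?nc_ge0 // le_min (ltW e0) divr_ge0 ?nc_ge0.
  rewrite mulrC ler_pdivrMr ?exprn_gt0 // mul1r lerXn2r ?nnegrE ?nc_ge0 //.
    by rewrite le_min (ltW e0) divr_ge0 ?nc_ge0.
  by rewrite ge_min; apply/orP; right; lra.
- move=> z; set h := z - z0; rewrite lt_min => /andP[h1 h2].
  have zE : z + c = y * (1 + h / y) by rewrite /h /y; field.
  have dlt : nc (h / y) < 4^-1 by rewrite ncM ncV ltr_pdivrMr // mulrC.
  have E : cpow (z + c) (- 4^-1) = cpow y (- 4^-1) * cpow (1 + h / y) (- 4^-1).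
    rewrite zE /cpow clogM_segment ?mulrDr ?cexpD //.
      apply: cutplane0_re; have := re_1sub_gt0 (y := - (h / y)); rewrite ncN opprK; apply.
      by apply: lt_trans dlt _; lra.
    move=> t /andP[t0 t1].
    have -> : y * (1 - t%:C + t%:C * (1 + h / y)) = y + t%:C * h by field.
    apply: he; apply: le_lt_trans h1; rewrite ncM nc_real ger0_norm //.
    by rewrite ler_piMl // nc_ge0.
  rewrite E (_ : series _ = fun N => cpow y (- 4^-1) * series (fun n => binc (- 4^-1) n * (h / y) ^+ n) N).
    by apply: cvgCMr; exact: binomial_series_quarter.
  apply/funext => N; rewrite /series /= mulr_sumr; apply: eq_bigr => n _.
  by rewrite expr_div_n; ring.
Qed.

End LocalPowerSeries.

(** * The identity theorem, and the closed form on all of [cutplane 1] *)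

Section IdentityTheorem.
Variable R : realType.
Local Notation C := R[i].
Local Notation re := (@complex.Re R).
Local Notation im := (@complex.Im R).
Local Notation nc := (@Normc.normc R).

Lemma nearC_ball (z0 : C) (P : C -> Prop) :
  (\forall z \near z0, P z) <-> exists2 r : R, 0 < r & forall z, nc (z - z0) < r -> P z.
Proof.
split=> [/nbhs_ballP[e /= e0 he]|[r r0 hr]].
  have [r rE] : exists r, e = r%:C.
    by exists (re e); move: e0; rewrite ltcE /= => /andP[/eqP i0 _]; case: (e) i0 => a b /= ->.
  exists r; first by rewrite -ltcR -rE.
  move=> z hz; apply: he; rewrite /ball /= rE -opprB normrN normcE_real ltcR //.
apply/nbhs_ballP; exists r%:C; first by rewrite /= ltcR.
by move=> z; rewrite /ball /= -opprB normrN normcE_real ltcR; exact: hr.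
Qed.

Lemma psat_analytic (D : set C) (f : C -> C) : (forall z, D z -> psat z f) -> analytic_on D f.
Proof.
move=> h z0 /h [a [r [M [r0 ha hf]]]]; exists a; apply/nearC_ball.
by exists r.
Qed.

(** Convergence at a single point at distance r / 2 makes the terms bounded there, which is the
    Cauchy bound. *)
Lemma analytic_psat (D : set C) (f : C -> C) z0 : analytic_on D f -> D z0 -> psat z0 f.
Proof.
move=> hf /hf [a /nearC_ball [r r0 h]].
have r2 : 0 < r / 2 by rewrite divr_gt0.
have hr2 : nc (z0 + (r / 2)%:C - z0) < r.
  rewrite addrAC subrr add0r nc_real ger0_norm ?(ltW r2) //; lra.
have hs := h _ hr2.
have [M hM] := cvgC_bound (series_cvg0 hs).
exists a, (r / 2), M; split; first exact: r2.
- move=> n; have := hM n; rewrite addrAC subrr add0r ncM ncX nc_real.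
  by rewrite (ger0_norm (ltW r2)).
- by move=> z hz; apply: h; lra.
Qed.

(** Once the coefficients below n vanish, dividing by h^n for h = e v leaves a_n plus terms that are
    O(e); the total being 0, |a_n| is at most a constant times e for all small e. *)
Lemma psat_ray_zero (F : C -> C) (z0 v : C) (e0 : R) : psat z0 F -> v != 0 -> 0 < e0 ->
  (forall e : R, 0 < e < e0 -> F (z0 + e%:C * v) = 0) ->
  exists2 r : R, 0 < r & forall z, nc (z - z0) < r -> F z = 0.
Proof.
move=> [a [r [M [r0 ha hF]]]] v0 e00 hz.
have nv : 0 < nc v by rewrite nc_gt0.
suff a0 n : a n = 0.
  exists r => // z hzr; apply: (cvgC_unique (hF z hzr)).
  rewrite (_ : series _ = fun=> 0); first exact: cvg_cst.
  by apply/funext => N; rewrite /series /= big1 // => i _; rewrite a0 mul0r.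
elim/ltn_ind: n => n IH.
apply/eqP; rewrite -nc_eq0; apply/eqP; apply/le_anti; rewrite nc_ge0 andbT.
have M0 : 0 <= M by have := ha 0%N; apply: le_trans; rewrite mulr_ge0 ?nc_ge0 ?exprn_ge0 ?ltW.
have key e : 0 < e -> e < e0 -> e * nc v < r / 2 -> nc (a n) <= M / r ^+ n * (2 / r * nc v) * e.
  move=> e1 e2 e3; set h := e%:C * v.
  have nh : nc h = e * nc v by rewrite ncM nc_real gtr0_norm.
  have h0 : h != 0 by rewrite -nc_gt0 nh mulr_gt0.
  have hE : z0 + h - z0 = h by rewrite addrAC subrr add0r.
  have hr : nc (z0 + h - z0) < r by rewrite hE nh; lra.
  have := hF _ hr; rewrite hz ?e1 // hE => hs.
  have hs1 : series (fun j => a (j + n)%N * h ^+ j) @ \oo --> (0 : C).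
    have := (cvgC_shift _ _ n).2 hs => hs'.
    have -> : series (fun j => a (j + n)%N * h ^+ j) =
        fun N => (h ^+ n)^-1 * series (fun j => a j * h ^+ j) (N + n)%N.
      apply/funext => N; rewrite /series /=.
      rewrite (big_cat_nat (leq0n n) (leq_addl N n)) /= [X in _ * (X + _)]big_nat_cond [X in _ * (X + _)]big1 ?add0r; last first.
        by move=> i /andP[/andP[_ iN] _]; rewrite IH // mul0r.
      rewrite -{3}[n]add0n big_addn addnK mulr_sumr; apply: eq_bigr => j _.
      by rewrite exprD; field; rewrite expf_neq0.
    by rewrite -[X in _ --> X](mulr0 (h ^+ n)^-1); exact: cvgCMr hs'.
  have q01 : 0 <= nc h / r < 1 by apply: psat_q_lt1 => //; rewrite -hE.
  have tl j : nc (a (j.+1 + n)%N * h ^+ j.+1) <= M / r ^+ n * (nc h / r) * (nc h / r) ^+ j.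
    have ha' m : nc (a (m + n)%N) * r ^+ m <= M / r ^+ n.
      by rewrite ler_pdivlMr ?exprn_gt0 // -mulrA -exprD.
    by apply: le_trans (psat_term_le h j.+1 r0 ha') _; rewrite exprS mulrA.
  have := series_geom_le q01 tl (series0_cvg hs1).
  rewrite add0n expr0 mulr1 sub0r ncN => /le_trans; apply.
  have q2 : nc h / r <= 2^-1 by rewrite ler_pdivrMr // nh; lra.
  have Mr : 0 <= M / r ^+ n by rewrite divr_ge0 // exprn_ge0 // ltW.
  case/andP: q01 => q0 q1.
  have -> : M / r ^+ n * (2 / r * nc v) * e = M / r ^+ n * (nc h / r) * 2.
    by rewrite nh; ring.
  have A0 : 0 <= M / r ^+ n * (nc h / r) by rewrite mulr_ge0.
  rewrite ler_pdivrMr ?subr_gt0 //; move: A0; move: (M / r ^+ n * _) => A A0; nra.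
rewrite leNgt; apply/negP => an0.
set K := M / r ^+ n * (2 / r * nc v) in key.
have K0 : 0 <= K.
  apply: mulr_ge0; first by rewrite divr_ge0 // exprn_ge0 // ltW.
  by apply: mulr_ge0; rewrite ?nc_ge0 // divr_ge0 // ltW.
(* The three bounds keep the point on the segment, within r / 2 of z0, and make K e smaller than the
   modulus of a_n; K + 1 allows K = 0. *)
pose e := Num.min (e0 / 2) (Num.min (r / 4 / nc v) (nc (a n) / (2 * (K + 1)))).
have K1 : 0 < 2 * (K + 1) by lra.
have e1 : 0 < e by rewrite !lt_min !divr_gt0.
have e2 : e <= e0 / 2 by rewrite ge_min lexx.
have e3 : e <= r / 4 / nc v by rewrite !ge_min lexx !orbT.
have e4 : e <= nc (a n) / (2 * (K + 1)) by rewrite !ge_min lexx !orbT.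
have : nc (a n) <= K * e.
  apply: key => //; first by lra.
  move: e3; rewrite ler_pdivlMr //; lra.
move: e4; rewrite ler_pdivlMr // => e4; nra.
Qed.

Lemma cutplane1_ray (z : C) (T : R) : cutplane 1 z -> 1 <= T -> cutplane 1 (T%:C * z).
Proof.
move=> hz T1 [i0 r0]; apply: hz; move: i0 r0; rewrite imM reM /= !mul0r subr0 addr0.
have T0 : 0 < T by lra.
move=> /eqP; rewrite mulf_eq0 (gt_eqF T0) /= => /eqP -> h; split=> //; nra.
Qed.

(** For T >= 1 the points T z stay in [cutplane 1] and eventually satisfy |T z| > 1. If f and g
    differed at z, let T0 be the supremum of the T where they differ: they agree beyond T0, hence
    around T0 z by [psat_ray_zero], which contradicts the choice of T0. *)
Lemma identity_cutplane1 (f g : C -> C) : analytic_on (cutplane 1) f -> analytic_on (cutplane 1) g ->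
  (forall z, cutplane 1 z -> 1 < nc z -> f z = g z) -> forall z, cutplane 1 z -> f z = g z.
Proof.
move=> hf hg fg z hz; apply/eqP; apply/negPn/negP => fgz.
pose D y := f y + (-1) * g y.
have DP y : (D y == 0) = (f y == g y) by rewrite /D mulN1r subr_eq0.
have pD y : cutplane 1 y -> psat y D.
  move=> hy; apply: psatD; first exact: analytic_psat hf hy.
  apply: psatM; first exact: psat_cst.
  exact: analytic_psat hg hy.
have z0 : z != 0 by exact: cutplane0_neq0 (cutplane0_sub ler01 hz).
have nz : 0 < nc z by rewrite nc_gt0.
pose B : set R := [set T | 1 <= T /\ D (T%:C * z) != 0].
have B1 : B 1 by split=> //; rewrite mul1r DP.
have ubB : ubound B (1 + (nc z)^-1).
  move=> T [T1 DT]; rewrite leNgt; apply/negP => hT; move: DT; apply/negP; rewrite negbK DP fg //.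
    exact: cutplane1_ray.
  rewrite ncM nc_real ger0_norm ?(le_trans ler01) // -ltr_pdivrMr // div1r; lra.
have hsB : has_sup B by split; [exists 1 | exists (1 + (nc z)^-1)].
pose T0 := sup B.
have T01 : 1 <= T0 by apply: ub_le_sup => //; case: hsB.
have above T : T0 < T -> D (T%:C * z) = 0.
  move=> hT; apply/eqP/negPn/negP => DT.
  have BT : B T by split=> //; lra.
  have : T <= T0 by apply: ub_le_sup => //; case: hsB.
  lra.
have [r r0 hr] : exists2 r : R, 0 < r & forall y, nc (y - T0%:C * z) < r -> D y = 0.
  apply: (@psat_ray_zero D (T0%:C * z) z 1) => // [|e /andP[e0 e1]].
    by apply: pD; exact: cutplane1_ray.
  rewrite -mulrDl -rmorphD; apply: above; lra.
have e0 : 0 < r / nc z by rewrite divr_gt0.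
have [T [T1 DT] hT] := sup_adherent e0 hsB.
have : T <= T0 by apply: ub_le_sup => //; case: hsB.
move=> TT0; move: DT; rewrite hr ?eqxx //.
have -> : T%:C * z - T0%:C * z = (T - T0)%:C * z by rewrite rmorphB mulrBl.
rewrite ncM nc_real -ltr_pdivlMr // ler0_norm ?subr_le0 //; rewrite -/T0 in hT; lra.
Qed.

Lemma cutplane1_open (z : C) : cutplane 1 z ->
  exists2 r : R, 0 < r & forall y, nc (y - z) < r -> cutplane 1 y.
Proof.
move=> /cutplane1_sub1/cutplane0_open [r r0 hr]; exists r => // y hy.
have := hr _ hy; rewrite addrAC addrCA subrr addr0 => h [i0 r1]; apply: h.
by rewrite imD reD imN reN /= subr0; split=> //; lra.
Qed.

(** [legQ] is a polynomial in z and G = (z^2 - 1)^(-1/4): s is (z^2 - 1) G^2, written so as to avoid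
    the inverse G^(-2), tau is t G^2 / 2, and (z^2 - 1)^((k + 1/2) / 2) / s^(k+1) reduces to G.
    Hence - 1/4 is the only non-integral exponent to expand. *)
Lemma legQ_psat m k z0 : cutplane 1 z0 -> psat z0 (@legQ R m k).
Proof.
move=> hz0; pose G (z : C) := cpow (z + 1) (- 4^-1) * cpow (z - 1) (- 4^-1).
pose T (z : C) := z + (-1) * (z ^+ 2 + (-1)) * G z ^+ 2.
pose c : C := (Num.sqrt pi)%:C * ('i%C * (-1) ^+ k) / cpow 2 2^-1 * (m + k)`!%:R.
pose F (z : C) := c * (G z * (T z ^+ m * \sum_(0 <= i < k.+1)
   (@cffact R k i * ifact R (m%:Z + i%:Z) / i`!%:R) * (2^-1 * (T z * G z ^+ 2)) ^+ i)).
have [r r0 hr] := cutplane1_open hz0.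
have pG : psat z0 G.
  by apply: psatM; apply: psat_cpow_quarter; [exact: cutplane1_add1 | exact: cutplane1_sub1].
have pT : psat z0 T.
  apply: psatD; first exact: psat_id.
  apply: psatM; last exact: psatX.
  apply: psatM; first exact: psat_cst.
  apply: psatD; last exact: psat_cst.
  by apply: psatX; exact: psat_id.
apply: (@psat_ext _ _ F _ r r0) => [z /hr hz|]; last first.
  apply: psatM; first exact: psat_cst.
  apply: psatM; first exact: pG.
  apply: psatM; first exact: psatX.
  apply: psat_sum => i; apply: psatM; first exact: psat_cst.
  apply: psatX; apply: psatM; first exact: psat_cst.
  by apply: psatM; last exact: psatX.
have G0 : G z != 0 by rewrite mulf_neq0 ?cpow_neq0.
have GX n : cpow_sqr_sub1 z (n%:R * - 4^-1) = G z ^+ n by rewrite /cpow_sqr_sub1 !cpowX -exprMn.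
have GN (a : C) : cpow_sqr_sub1 z (- a) = (cpow_sqr_sub1 z a)^-1.
  by rewrite /cpow_sqr_sub1 !cpowN; field; rewrite !cpow_neq0.
have sE : cpow_sqr_sub1 z 2^-1 = (G z ^+ 2)^-1.
  by rewrite -GX -GN; congr cpow_sqr_sub1; field.
have SE : cpow_sqr_sub1 z ((k%:R + 2^-1) / 2) = (G z ^+ (2 * k).+1)^-1.
  by rewrite -GX -GN -[(2 * k).+1%:R]natr1 natrM; congr cpow_sqr_sub1; field.
have s2 := sqr_sub1_sqr hz; rewrite sE in s2.
have tE : z - cpow_sqr_sub1 z 2^-1 = T z.
  by rewrite sE /T -s2; field.
rewrite /legQ /F /legval tE sE SE /legW.
have -> : T z / (2 * (G z ^+ 2)^-1) = 2^-1 * (T z * G z ^+ 2) by field.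
rewrite /c; set W := \sum_(_ <= i < _) _.
have -> : (G z ^+ (2 * k).+1)^-1 = G z / ((G z ^+ 2) ^+ k.+1).
  rewrite -exprM mulnS addnC addn2 [G z ^+ (2 * k).+2]exprS; field.
  by rewrite G0 expf_neq0.
move: (expf_neq0 k.+1 (expf_neq0 2 G0)) (cpow_neq0 (2 : C) 2^-1) => g1 sq.
rewrite exprVn; move: ((G z ^+ 2) ^+ k.+1) g1 (cpow 2 2^-1) sq => g g1 sq sq0.
by field; rewrite g1 sq0.
Qed.

(** [legQ] shows that the set given to [xget] is inhabited, so the chosen function is a continuation
    too and the identity theorem equates the two. *)
Lemma legendreQE m k (z : C) : (0 < m)%N -> cutplane 1 z ->
  legendreQ (m%:R - 2^-1) (k%:R + 2^-1) z = legQ m k z.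
Proof.
move=> m0 hz; have hQ : is_legendreQ (m%:R - 2^-1) (k%:R + 2^-1) (@legQ R m k).
  split; first by apply: psat_analytic => y; exact: legQ_psat.
  by move=> y hy y1; rewrite legendreQ_seriesE // -ltcR -normcE_real.
have [hQ1 hQ2] : is_legendreQ (m%:R - 2^-1) (k%:R + 2^-1)
    (@legendreQ R (m%:R - 2^-1) (k%:R + 2^-1)) by exact: (xgetPex _ (ex_intro _ _ hQ)).
apply: (identity_cutplane1 hQ1 hQ.1) => // y hy y1.
by rewrite hQ2 ?hQ.2 // normcE_real ltcR.
Qed.

End IdentityTheorem.

(** * Gegenbauer polynomials: raising mu, the Chebyshev case, growth *)

Section Gegenbauer.
Variable R : realType.
Local Notation C := R[i].
Local Notation nc := (@Normc.normc R).

Lemma pochSl (a : C) n : poch a n.+1 = a * poch (a + 1) n.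
Proof.
rewrite /poch big_nat_recl //= addr0; congr (_ * _); apply: eq_bigr => i _.
by rewrite -natr1 -addrA [1 + _]addrC.
Qed.

Lemma pochD (a : C) n k : poch a (n + k) = poch a n * poch (a + n%:R) k.
Proof.
elim: k => [|k IH]; first by rewrite addn0 poch0 mulr1.
by rewrite addnS !pochS IH -mulrA natrD addrA.
Qed.

Lemma poch_neg n k : poch (- n%:R : C) k = (-1) ^+ k * (n ^_ k)%:R.
Proof.
elim: k => [|k IH]; first by rewrite poch0 expr0 ffactn0 mulr1.
rewrite pochS IH ffactnSr natrM exprS; have [kn|kn] := leqP k n.
  by rewrite natrB //; ring.
by rewrite ffact_small // !(mul0r, mulr0).
Qed.

Lemma poch_half_neq0 mu k : poch (mu%:R + 2^-1 : C) k != 0.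
Proof.
elim: k => [|k IH]; first by rewrite poch0 oner_eq0.
by rewrite pochS mulf_neq0.
Qed.

(** In this coefficient the signs of (- n)_k and of ((1 - x) / 2)^k have cancelled, and (2 mu)_n (n
    + 2 mu)_k has become (2 mu)_(n+k). *)
Definition gcoef (mu n k : nat) : C :=
  poch (2 * mu%:R) (n + k) * (n ^_ k)%:R / (n`!%:R * k`!%:R * poch (mu%:R + 2^-1) k).

Definition gegpoly (n mu : nat) (x : C) : C :=
  \sum_(0 <= k < n.+1) gcoef mu n k * ((x - 1) / 2) ^+ k.

Lemma gcoef_gt mu n k : (n < k)%N -> gcoef mu n k = 0.
Proof. by move=> nk; rewrite /gcoef ffact_small // mulr0 mul0r. Qed.

Lemma gegpoly_widen n mu x N : (n < N)%N ->
  gegpoly n mu x = \sum_(0 <= k < N) gcoef mu n k * ((x - 1) / 2) ^+ k.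
Proof.
move=> nN; rewrite (big_cat_nat (leq0n n.+1) nN) //= [X in _ + X]big_nat_cond [X in _ + X]big1 ?addr0 //.
by move=> i /andP[/andP[ni _] _]; rewrite gcoef_gt // mul0r.
Qed.

Lemma gegenbauerE n mu x : gegenbauer n mu%:R x = gegpoly n mu x.
Proof.
rewrite /gegenbauer; have -> : hyp2F1 (- n%:R) (n%:R + 2 * mu%:R) (mu%:R + 2^-1) ((1 - x) / 2) =
    series (fun k => poch (- n%:R) k * poch (n%:R + 2 * mu%:R) k
      / (poch (mu%:R + 2^-1) k * k`!%:R) * ((1 - x) / 2) ^+ k) n.+1.
  rewrite /hyp2F1; apply: cvgC_lim; apply/(cvgC_shift _ _ n.+1).
  rewrite (_ : (fun _ => _) = fun=> series (fun k => poch (- n%:R) k * poch (n%:R + 2 * mu%:R) k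
      / (poch (mu%:R + 2^-1) k * k`!%:R) * ((1 - x) / 2) ^+ k) n.+1); first exact: cvg_cst.
  apply/funext => N; rewrite /series /= (big_cat_nat (leq0n n.+1) (leq_addl N n.+1)) /=.
  rewrite [X in _ + X]big_nat_cond [X in _ + X]big1 ?addr0 // => k /andP[/andP[nk _] _].
  by rewrite poch_neg ffact_small // mulr0 !mul0r.
rewrite /series /= mulr_sumr; apply: eq_bigr => k _.
rewrite /gcoef poch_neg addrC pochD.
have -> : (1 - x) / 2 = - ((x - 1) / 2) by rewrite -mulNr opprB.
rewrite (exprNn ((x - 1) / 2)).
transitivity (((-1) ^+ k * (-1) ^+ k) * (poch (2 * mu%:R) n * poch (2 * mu%:R + n%:R) k * (n ^_ k)%:R
    / (n`!%:R * k`!%:R * poch (mu%:R + 2^-1) k) * ((x - 1) / 2) ^+ k)).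
  move: (factC_neq0 (R := R) n) (factC_neq0 (R := R) k) (poch_half_neq0 mu k).
  move: (n`!%:R) (k`!%:R) (poch (mu%:R + 2^-1) k) => a b p a0 b0 p0.
  by field; rewrite a0 b0 p0.
by rewrite -expr2 sqrr_sign mul1r.
Qed.

Lemma gegpoly0 mu x : gegpoly 0 mu x = 1.
Proof.
rewrite /gegpoly big_nat1 /gcoef !poch0 ffactn0 fact0 expr0.
by rewrite !mulr1 divr1.
Qed.

Lemma gegpoly1 mu x : gegpoly 1 mu x = 2 * mu%:R * x.
Proof.
rewrite /gegpoly big_nat_recr //= big_nat1 /gcoef !pochS !poch0 !ffactn0 ffactn1 !fact0 expr0 expr1 !addr0.
have -> : 1`! = 1%N by [].
have h := poch_half_neq0 mu 1; rewrite pochS poch0 mul1r addr0 in h.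
have -> : 2 * mu%:R + 1 = 2 * (mu%:R + 2^-1) :> C by field.
by move: h; move: (mu%:R + 2^-1 : C) => q q0; field.
Qed.

Let ffact2 n k : (n ^_ k)%:R / n`!%:R =
  (n.+2 ^_ k)%:R * (n.+2%:R - k%:R) * (n.+1%:R - k%:R) / n.+2`!%:R :> C.
Proof.
have S m j : (m.+1 ^_ j)%:R * (m.+1%:R - j%:R) = m.+1%:R * (m ^_ j)%:R :> C.
  have [jm|jm] := leqP j m.+1; first by rewrite -natrB // -!natrM -ffactnSr ffactSS.
  by rewrite !ffact_small ?mul0r ?mulr0 // (ltn_trans _ jm).
rewrite S -[n.+2%:R * _ * _]mulrA S !factCS.
move: (factC_neq0 (R := R) n) (natSC_neq0 (R := R) n) (natSC_neq0 (R := R) n.+1).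
move: (n`!%:R) (n.+1%:R : C) (n.+2%:R : C) => a b d a0 b0 d0.
by field; rewrite a0 b0 d0.
Qed.

Let gcoef_step mu n k : (n.+2%:R + mu%:R) * gcoef mu n.+2 k =
  mu%:R * (gcoef mu.+1 n.+2 k - gcoef mu.+1 n k).
Proof.
rewrite /gcoef !addSn.
have -> : 2 * mu.+1%:R = 2 * mu%:R + 1 + 1 :> C by rewrite -natr1; ring.
rewrite !pochSl -!pochSl !(pochS (2 * mu%:R + 1 + 1)) [poch (2 * mu%:R) _]pochSl [poch (2 * mu%:R + 1) _]pochSl.
have -> : mu.+1%:R + 2^-1 = mu%:R + 2^-1 + 1 :> C by rewrite -natr1; ring.
set h := mu%:R + 2^-1 : C.
have h0 : h != 0 by have := poch_half_neq0 mu 1; rewrite pochS poch0 mul1r addr0.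
have hk : h + k%:R != 0.
  by have := poch_half_neq0 mu k.+1; rewrite pochS mulf_eq0 negb_or => /andP[].
have p0 := poch_half_neq0 mu k; rewrite -/h in p0.
have -> : poch (h + 1) k = poch h k * (h + k%:R) / h by rewrite -pochS pochSl; field.
have -> : forall q : C, poch (2 * mu%:R + 1 + 1) (n + k) * (n ^_ k)%:R / (n`!%:R * k`!%:R * q)
   = poch (2 * mu%:R + 1 + 1) (n + k) * ((n ^_ k)%:R / n`!%:R) / (k`!%:R * q).
  move=> q; rewrite -!mulrA; congr (_ * (_ * _)).
  by rewrite !invfM; ring.
rewrite ffact2.
have muE : mu%:R = h - 2^-1 by rewrite /h; ring.
have k2 : (n + k).+1%:R = n%:R + k%:R + 1 :> C by rewrite -natr1 natrD.
rewrite k2 -[n.+2%:R]natr1 -[n.+1%:R]natr1 natrD.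
move: (factC_neq0 (R := R) n.+2) (factC_neq0 (R := R) k) p0.
move: (poch _ (n + k)) (poch h k) ((n.+2)`!%:R) (k`!%:R) ((n.+2 ^_ k)%:R : C) => P p f g F f0 g0 p0.
rewrite muE; field.
by rewrite f0 g0 p0 h0 hk.
Qed.

Lemma gegpoly_step mu n x : (n.+2%:R + mu%:R) * gegpoly n.+2 mu x =
  mu%:R * (gegpoly n.+2 mu.+1 x - gegpoly n mu.+1 x).
Proof.
rewrite (@gegpoly_widen n mu.+1 x n.+3) //; last by do 2 apply: ltnW.
rewrite /gegpoly -sumrB !mulr_sumr; apply: eq_bigr => k _.
by rewrite mulrA gcoef_step; ring.
Qed.

Lemma gegpoly_step0 mu x : mu%:R * gegpoly 0 mu x = mu%:R * gegpoly 0 mu.+1 x.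
Proof. by rewrite !gegpoly0. Qed.

Lemma gegpoly_step1 mu x : (1 + mu%:R) * gegpoly 1 mu x = mu%:R * gegpoly 1 mu.+1 x.
Proof. by rewrite !gegpoly1 -natr1; ring. Qed.

Let gcoef1E n k : gcoef 1 n k = (n + k).+1`!%:R * (n ^_ k)%:R / (n`!%:R * k`!%:R * poch (1 + 2^-1) k).
Proof.
have f1 : 1`!%:R = 1 :> C by [].
by rewrite /gcoef mulr1 (poch_nat R 1) f1 divr1 add1n.
Qed.

Let gcoef1_rec n k : gcoef 1 n.+2 k.+1 - 2 * gcoef 1 n.+1 k.+1 + gcoef 1 n k.+1 = 4 * gcoef 1 n.+1 k.
Proof.
have p0 := poch_half_neq0 1 k; have p1 := poch_half_neq0 1 k.+1; rewrite pochS in p1.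
rewrite !gcoef1E !addSn !addnS pochS.
have F1 : (n.+2 ^_ k.+1)%:R = n.+2%:R * (n.+1 ^_ k)%:R :> C by rewrite ffactSS natrM.
have F2 : (n.+1 ^_ k.+1)%:R = (n.+1 ^_ k)%:R * (n%:R + 1 - k%:R) :> C.
  have [kn|kn] := leqP k n.+1; first by rewrite ffactnSr natrM natrB // -natr1.
  by rewrite !ffact_small ?mul0r // ltnW.
have F3 : (n ^_ k.+1)%:R = (n.+1 ^_ k)%:R * (n%:R + 1 - k%:R) * (n%:R - k%:R) / n.+1%:R :> C.
  rewrite -F2; apply: (canRL (mulfK (natSC_neq0 _))); rewrite -natrM mulnC -ffactSS.
  have [kn|kn] := leqP k.+1 n.+1; first by rewrite ffactnSr natrM natrB // -!natr1; congr (_ * _); ring.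
  by rewrite !ffact_small ?mul0r // ltnW.
rewrite F1 F2 F3 !factCS.
have nk2 : (n + k).+2%:R = n%:R + k%:R + 2 :> C by rewrite -natr1 -natr1 natrD; ring.
rewrite -[(n + k).+4%:R]natr1 -[(n + k).+3%:R]natr1 nk2 -[n.+2%:R]natr1 -[n.+1%:R]natr1 -[k.+1%:R]natr1.
have n0 : n%:R + 1 != 0 :> C by rewrite natr1 natSC_neq0.
have n1 : n%:R + 1 + 1 != 0 :> C by rewrite !natr1 natSC_neq0.
have k0 : k%:R + 1 != 0 :> C by rewrite natr1 natSC_neq0.
have kh : 3 + k%:R * 2 != 0 :> C.
  have <- : (2 * k + 2).+1%:R = 3 + k%:R * 2 :> C by rewrite -[LHS]natr1 natrD natrM; ring.
  exact: natSC_neq0.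
move: (factC_neq0 (R := R) n) (factC_neq0 (R := R) k) p0.
move: ((n + k)`!%:R) (n`!%:R) (k`!%:R) ((n.+1 ^_ k)%:R : C) ((n + k).+1%:R : C) (poch _ k) => a b d F e p b0 d0 p0.
field.
by rewrite b0 d0 p0 n0 n1 k0 kh.
Qed.

(** For mu = 1 these are the Chebyshev polynomials U_n. In y = (x - 1) / 2 the factor 2 x is 2 + 4
    y, so the coefficients must satisfy [gcoef1_rec]. *)
Lemma gegpoly_U_rec n x : gegpoly n.+2 1 x = 2 * x * gegpoly n.+1 1 x - gegpoly n 1 x.
Proof.
set y := (x - 1) / 2; have -> : 2 * x = 2 + 4 * y by rewrite /y; field.
apply/eqP; rewrite -subr_eq0; apply/eqP.
transitivity ((gegpoly n.+2 1 x - 2 * gegpoly n.+1 1 x + gegpoly n 1 x) - 4 * (y * gegpoly n.+1 1 x)).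
  by ring.
rewrite (@gegpoly_widen n 1 x n.+3) //; last by do 2 apply: ltnW.
rewrite {1}(@gegpoly_widen n.+1 1 x n.+3) // /gegpoly mulr_sumr -sumrB -big_split /=.
rewrite big_nat_recl //= -/y; set t0 := (X in X + \sum_(_ <= _ < _) _ - _ = _).
rewrite [y * _]mulr_sumr [4 * _]mulr_sumr -addrA -sumrB /= big1 /t0 => [|k _].
  rewrite !gcoef1E !addn0 !ffactn0 !expr0 !poch0 !factCS fact0.
  move: (factC_neq0 (R := R) n) (natSC_neq0 (R := R) n) (natSC_neq0 (R := R) n.+1).
  rewrite -[n.+3%:R]natr1 -[n.+2%:R]natr1 -[n.+1%:R]natr1.
  by move: (n`!%:R) => f f0 n0 n1; field; rewrite f0 n0 n1.
rewrite exprS; transitivity ((gcoef 1 n.+2 k.+1 - 2 * gcoef 1 n.+1 k.+1 + gcoef 1 n k.+1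
   - 4 * gcoef 1 n.+1 k) * (y * y ^+ k)); first by ring.
by rewrite gcoef1_rec subrr mul0r.
Qed.

(** This is U_(n+2) - U_n = 2 T_(n+2): both sides obey the same recurrence. *)
Lemma gegpoly_U_sub u n : u != 0 ->
  gegpoly n.+2 1 ((u + u^-1) / 2) - gegpoly n 1 ((u + u^-1) / 2) = u ^+ n.+2 + u^-1 ^+ n.+2.
Proof.
move=> u0; set x := (u + u^-1) / 2; have x2 : 2 * x = u + u^-1 by rewrite /x; field.
pose V n := u ^+ n + u^-1 ^+ n.
have VS m : V m.+2 = 2 * x * V m.+1 - V m.
  by rewrite x2 /V !exprS; field.
suff [//] : gegpoly n.+2 1 x - gegpoly n 1 x = V n.+2 /\ gegpoly n.+3 1 x - gegpoly n.+1 1 x = V n.+3.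
elim: n => [|n [IH1 IH2]].
  rewrite !gegpoly_U_rec gegpoly1 gegpoly0 !VS mulr1 /V !expr0 !expr1 -x2; split; ring.
split=> //; rewrite gegpoly_U_rec VS -IH1 -IH2 [gegpoly n.+3 1 x]gegpoly_U_rec.
by rewrite [gegpoly n.+2 1 x]gegpoly_U_rec; ring.
Qed.

(** Induction on mu by C_(n+2)^(mu+1) = ((n + 2 + mu) / mu) C_(n+2)^mu + C_n^(mu+1). Each step
    raises the degree of the polynomial factor by two, once for n + 2 + mu and once for the
    summation over n. *)
Lemma gegpoly_bound u mu (rho : R) : u != 0 -> nc u <= rho -> nc u^-1 <= rho -> (0 < mu)%N ->
  exists (M : R) (e : nat), 0 <= M /\
    forall n, nc (gegpoly n mu ((u + u^-1) / 2)) <= M * n.+1%:R ^+ e * rho ^+ n.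
Proof.
move=> u0 h1 h2; set x := (u + u^-1) / 2.
have rho1 : 1 <= rho.
  have : nc u * nc u^-1 = 1 by rewrite -ncM divff // nc1.
  have := nc_ge0 u; have := nc_ge0 u^-1; nra.
have rho0 : 0 <= rho by lra.
case: mu => // mu _; elim: mu => [|mu [M [e [M0 hM]]]].
  exists 2, 1%N; split=> // n; rewrite expr1.
  suff [//] : nc (gegpoly n 1 x) <= 2 * n.+1%:R * rho ^+ n /\
     nc (gegpoly n.+1 1 x) <= 2 * n.+2%:R * rho ^+ n.+1.
  elim: n => [|n [IH1 IH2]].
    rewrite gegpoly0 gegpoly1 nc1 expr0 expr1 !mulr1; split; first by lra.
    have -> : 2 * x = u + u^-1 by rewrite /x; field.
    apply: le_trans (ncD _ _) _; lra.
  split=> //; have -> : gegpoly n.+2 1 x = gegpoly n 1 x + (u ^+ n.+2 + u^-1 ^+ n.+2).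
    by rewrite -gegpoly_U_sub // addrC subrK.
  apply: le_trans (ncD _ _) _.
  have hV : nc (u ^+ n.+2 + u^-1 ^+ n.+2) <= 2 * rho ^+ n.+2.
    apply: le_trans (ncD _ _) _; rewrite !ncX mulrDl !mul1r.
    by apply: lerD; rewrite lerXn2r ?nnegrE ?nc_ge0.
  apply: le_trans (lerD IH1 hV) _.
  have hr : rho ^+ n <= rho ^+ n.+2 by rewrite ler_weXn2l // ltnW.
  have n0 : 0 <= n.+1%:R :> R by [].
  have -> : n.+3%:R = n.+1%:R + 2 :> R by rewrite -natrD addn2.
  have := ler_wpM2l n0 hr; have : 0 <= rho ^+ n.+2 by exact: exprn_ge0.
  nra.
exists (mu.+1%:R * M), (e.+2); split; first by rewrite mulr_ge0.
pose B (n : nat) : R := mu.+1%:R * M * n.+1%:R ^+ e.+2 * rho ^+ n.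
have mu0 : mu.+1%:R != 0 :> C by exact: natSC_neq0.
have hmu n : nc ((n%:R + mu.+1%:R) / mu.+1%:R * gegpoly n mu.+1 x) <= M * mu.+1%:R * n.+1%:R ^+ e.+1 * rho ^+ n.
  rewrite !ncM ncV -natrD !nc_nat.
  have -> : M * mu.+1%:R * n.+1%:R ^+ e.+1 * rho ^+ n = (mu.+1%:R * n.+1%:R) * (M * n.+1%:R ^+ e * rho ^+ n).
    by rewrite exprS; ring.
  apply: ler_pM; rewrite ?nc_ge0 ?mulr_ge0 ?invr_ge0 //.
  rewrite ler_pdivrMr ?ltr0n // -!natrM ler_nat.
  apply: leq_trans (leq_pmulr _ (ltn0Sn mu)).
  by rewrite mulnS addnC leq_add2l leq_pmull.
have B0 n : M * mu.+1%:R * n.+1%:R ^+ e.+1 * rho ^+ n <= B n.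
  rewrite /B [M * _]mulrC; apply: ler_wpM2r; first exact: exprn_ge0.
  apply: ler_wpM2l; first by rewrite mulr_ge0.
  by rewrite [leRHS]exprS ler_peMl ?exprn_ge0 // ler1n.
move=> n; suff [//] : nc (gegpoly n mu.+2 x) <= B n /\ nc (gegpoly n.+1 mu.+2 x) <= B n.+1.
elim: n => [|n [IH1 IH2]].
  split.
    have := hmu 0%N; rewrite add0r divff // mul1r !gegpoly0 => h; exact: le_trans h (B0 0%N).
  have := hmu 1%N; have -> : (1%:R + mu.+1%:R) / mu.+1%:R * gegpoly 1 mu.+1 x = gegpoly 1 mu.+2 x.
    by rewrite mulrAC gegpoly_step1; move: mu0; move: (mu.+1%:R : C) => q q0; field.
  by move=> h; exact: le_trans h (B0 1%N).
split=> //; have -> : gegpoly n.+2 mu.+2 x = (n.+2%:R + mu.+1%:R) / mu.+1%:R * gegpoly n.+2 mu.+1 x + gegpoly n mu.+2 x.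
  by rewrite mulrAC gegpoly_step; move: mu0; move: (mu.+1%:R : C) => q q0; field.
apply: le_trans (ncD _ _) _; apply: le_trans (lerD (hmu n.+2) IH1) _.
rewrite /B.
have hr : rho ^+ n <= rho ^+ n.+2 by rewrite ler_weXn2l // ltnW.
have hn : (n.+1%:R : R) ^+ e.+2 <= n.+1%:R * n.+3%:R ^+ e.+1.
  by rewrite exprS ler_wpM2l // lerXn2r ?nnegrE // ler_nat ltnW.
have -> : (n.+3%:R : R) ^+ e.+2 = (n.+1%:R + 2) * n.+3%:R ^+ e.+1.
  by rewrite exprS -natrD addn2.
have MM : 0 <= mu.+1%:R * M by rewrite mulr_ge0.
have h3 : mu.+1%:R * M * n.+1%:R ^+ e.+2 * rho ^+ n <= mu.+1%:R * M * (n.+1%:R * n.+3%:R ^+ e.+1) * rho ^+ n.+2.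
  apply: ler_pM; [|exact: exprn_ge0| |exact: hr].
    by apply: mulr_ge0; [exact: MM | exact: exprn_ge0].
  exact: ler_wpM2l.
apply: le_trans (lerD (lexx _) h3) _.
have h4 : 0 <= mu.+1%:R * M * n.+3%:R ^+ e.+1 * rho ^+ n.+2 by apply: mulr_ge0; [apply: mulr_ge0; [exact: MM|]|]; exact: exprn_ge0.
have -> : M * mu.+1%:R * n.+3%:R ^+ e.+1 * rho ^+ n.+2 + mu.+1%:R * M * (n.+1%:R * n.+3%:R ^+ e.+1) * rho ^+ n.+2
   = (n.+1%:R + 1) * (mu.+1%:R * M * n.+3%:R ^+ e.+1 * rho ^+ n.+2) by ring.
have -> : mu.+1%:R * M * ((n.+1%:R + 2) * n.+3%:R ^+ e.+1) * rho ^+ n.+2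
   = (n.+1%:R + 2) * (mu.+1%:R * M * n.+3%:R ^+ e.+1 * rho ^+ n.+2) by ring.
by apply: ler_wpM2r => //; lra.
Qed.

End Gegenbauer.

(** * From Laurent series in u to series of Gegenbauer polynomials *)

Section Expansion.
Variable R : realType.
Local Notation C := R[i].
Local Notation nc := (@Normc.normc R).

Variables z x : C.
Hypotheses (zcut : cutplane 1 z) (x_ell : nc (x - 1) + nc (x + 1) < nc (z - 1) + nc (z + 1)).

Local Notation s := (cpow_sqr_sub1 z 2^-1).
Local Notation w := (z + s).
Local Notation t := (z - s).

Let s0 : s != 0. Proof. exact: sqr_sub1_neq0. Qed.
Let wt : w * t = 1. Proof. exact: jouk_mul. Qed.
Let w0 : w != 0. Proof. by apply/eqP => e; move: wt; rewrite e mul0r => /eqP; rewrite eq_sym oner_eq0. Qed.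
Let tE : t = w^-1. Proof. by apply: (mulfI w0); rewrite wt divff. Qed.
Let t0 : t != 0. Proof. by rewrite tE invr_eq0. Qed.
Let st : 2 * s * t = 1 - t ^+ 2. Proof. by transitivity (w * t - t ^+ 2); [ring | rewrite wt]. Qed.
Let zE : s + t = z. Proof. by ring. Qed.
Let nct0 : 0 < nc t. Proof. by rewrite nc_gt0. Qed.

Section Param.
Variable u : C.
Hypotheses (u0 : u != 0) (xE : x = (u + u^-1) / 2) (u1 : nc u < nc w) (u2 : nc u^-1 < nc w).

Let rho : R := Num.max (nc u) (nc u^-1).
Let u_rho : nc u <= rho. Proof. by rewrite le_max lexx. Qed.
Let uV_rho : nc u^-1 <= rho. Proof. by rewrite le_max lexx orbT. Qed.
Let rho0 : 0 <= rho. Proof. exact: le_trans (nc_ge0 u) u_rho. Qed.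
Let q : R := nc t * rho.
Let q01 : 0 <= q < 1.
Proof.
rewrite mulr_ge0 ?nc_ge0 //= /q tE ncV mulrC ltr_pdivrMr ?mul1r ?nc_gt0 //.
by rewrite gt_max u1 u2.
Qed.

(** Coefficients decay like |t|^n, and what they multiply grows at most like a polynomial times
    rho^n. As |t| rho < 1, all boundary terms tend to 0 ([tr_cvg0]). *)
Definition tbounded (a : nat -> C) := exists M : R, forall n, nc (a n) <= M * nc t ^+ n.
Definition rbounded (g : nat -> C) :=
  exists (M : R) (e : nat), 0 <= M /\ forall n, nc (g n) <= M * n.+1%:R ^+ e * rho ^+ n.

Lemma tr_cvg0 a g : tbounded a -> rbounded g -> (fun n => a n * g n) @ \oo --> (0 : C).
Proof.
move=> [M hM] [M' [e [M'0 hM']]].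
have M0 : 0 <= M by have := hM 0%N; rewrite expr0 mulr1; apply: le_trans; exact: nc_ge0.
have rho_gt0 : 0 < rho by apply: lt_le_trans u_rho; rewrite nc_gt0.
have q0 : 0 < q by rewrite mulr_gt0.
apply: (@squeezeC _ _ _ (fun n => (M * M' / q) * (n.+1%:R ^+ e * q ^+ n.+1))).
  move=> n; rewrite subr0 ncM; apply: le_trans (ler_pM _ _ (hM n) (hM' n)) _; rewrite ?nc_ge0 //.
  rewrite le_eqVlt; apply/orP; left; apply/eqP; rewrite /q exprS !exprMn; field.
  by rewrite !lt0r_neq0.
rewrite -(mulr0 (M * M' / q)); apply: cvgMr.
have := polygeom_cvg0 e q01 => h.
have := h; rewrite -(cvg_shiftn 1); by under eq_fun do rewrite addn1.
Qed.

(** The zeros stand for C_(-1) = C_(-2) = 0, so that one relation between mu and mu + 1 covers n = 0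
    and n = 1. *)
Definition shift2 (g : nat -> C) (n : nat) : C := if n is m.+2 then g m else 0.

Lemma tbounded_shift a k : tbounded a -> tbounded (fun n => a (n + k)%N).
Proof.
move=> [M hM]; exists (M * nc t ^+ k) => n.
by apply: le_trans (hM _) _; rewrite addnC exprD mulrA.
Qed.

Lemma tboundedZ a (c : C) : tbounded a -> tbounded (fun n => c * a n).
Proof.
move=> [M hM]; exists (nc c * M) => n.
by rewrite ncM -mulrA ler_wpM2l ?nc_ge0.
Qed.

Lemma tboundedD a b : tbounded a -> tbounded b -> tbounded (fun n => a n + b n).
Proof.
move=> [M hM] [M' hM']; exists (M + M') => n.
by apply: le_trans (ncD _ _) _; rewrite mulrDl lerD.
Qed.

Let rho1 : 1 <= rho.
Proof.
have : nc u * nc u^-1 = 1 by rewrite -ncM divff // nc1.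
have := nc_ge0 u; have := nc_ge0 u^-1; have := u_rho; have := uV_rho; nra.
Qed.

Lemma rbounded_shift2 g : rbounded g -> rbounded (shift2 g).
Proof.
move=> [M [e [M0 hM]]]; exists M, e; split=> // -[|[|n]].
- by rewrite [shift2 g 0]/(0 : C) nc0 !mulr_ge0 ?exprn_ge0.
- by rewrite [shift2 g 1]/(0 : C) nc0 !mulr_ge0 ?exprn_ge0.
have -> : shift2 g n.+2 = g n by [].
apply: le_trans (hM n) _; apply: ler_pM; rewrite ?exprn_ge0 //.
- by apply: mulr_ge0 => //; exact: exprn_ge0.
- by apply: ler_wpM2l => //; rewrite lerXn2r ?nnegrE // ler_nat ltnS ltnW.
- by rewrite ler_weXn2l // ltnW.
Qed.

Lemma rbounded_gegpoly mu : (0 < mu)%N -> rbounded (fun n => gegpoly n mu x).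
Proof. by move=> mu0; rewrite xE; exact: gegpoly_bound. Qed.

Let v (n : nat) : C := u ^+ n + u^-1 ^+ n.

Lemma rbounded_v k : rbounded (fun n => v (n + k)%N).
Proof.
exists (2 * rho ^+ k), 0%N; split=> [|n]; first by rewrite mulr_ge0 // exprn_ge0.
rewrite expr0 mulr1 -mulrA -exprD; apply: le_trans (ncD _ _) _.
rewrite mulrDl !mul1r !ncX [(k + n)%N]addnC.
by apply: lerD; rewrite lerXn2r ?nnegrE ?nc_ge0.
Qed.

Lemma sum_shift2 (a g : nat -> C) N :
  \sum_(0 <= n < N) (a n - a n.+2) * g n = \sum_(0 <= n < N) a n * (g n - shift2 g n)
    - (a N * shift2 g N + a N.+1 * shift2 g N.+1).
Proof.
have E : \sum_(0 <= n < N) a n.+2 * g n = \sum_(0 <= n < N) a n * shift2 g n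
    + (a N * shift2 g N + a N.+1 * shift2 g N.+1).
  elim: N => [|N IH]; first by rewrite !big_nil /= !mulr0 !addr0.
  by rewrite !big_nat_recr //= IH /= -/(shift2 g N.+1); ring.
transitivity (\sum_(0 <= n < N) a n * g n - \sum_(0 <= n < N) a n.+2 * g n).
  by rewrite -sumrB; apply: eq_bigr => n _; ring.
rewrite E opprD addrA; congr (_ - _).
by rewrite -sumrB; apply: eq_bigr => n _; ring.
Qed.

Lemma sum_shift2_cvg a g (F : C) : tbounded a -> rbounded g ->
  series (fun n => a n * (g n - shift2 g n)) @ \oo --> F ->
  series (fun n => (a n - a n.+2) * g n) @ \oo --> F.
Proof.
move=> ha hg hF; rewrite (_ : series _ = fun N => series (fun n => a n * (g n - shift2 g n)) N
    - (a N * shift2 g N + a N.+1 * shift2 g N.+1)); last by apply/funext => N; exact: sum_shift2.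
have h0 := tr_cvg0 ha (rbounded_shift2 hg).
rewrite -[F]subr0; apply: cvgCB; first exact: hF.
by rewrite -[X in _ --> X]addr0; apply: cvgCD; [exact: h0 | exact: (cvgC_S h0)].
Qed.

Section Family.
Variables (c : nat -> int -> C) (p : nat) (F : C).
Hypothesis c_mul : forall K (m : int), m%:~R * c K.+1 m = c K (m - 1)%R - c K (m + 1)%R.
Hypothesis c_bounded : forall K, tbounded (fun n => c K n%:Z).
Hypothesis c_sum : (fun N => c p 0 + \sum_(0 <= i < N) c p i.+1%:Z * v i.+1) @ \oo --> F.

Let c_mul_nat K n : n.+1%:R * c K.+1 n.+1%:Z = c K n%:Z - c K n.+2%:Z.
Proof.
have := c_mul K n.+1%:Z; rewrite -[n.+1%:Z%:~R]/(n.+1%:R : C) => ->.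
by congr (c K _ - c K _); rewrite -?PoszD ?addn1 // intS addrC addKr.
Qed.

(** For mu = 1, summation by parts turns U_n into U_n - U_(n-2), which is v_n for n > 0 and 1 for n
    = 0, as in [c_sum]. The family c stays abstract because the lemma serves both [dcoef] and
    [ebcoef]. *)
Lemma gegenbauer_expansion mu : (0 < mu)%N ->
  (fun N => mu.-1`!%:R * series (fun n => (n%:R + mu%:R) * c (p + mu)%N (n + mu)%N%:Z * gegpoly n mu x) N)
  @ \oo --> F.
Proof.
case: mu => // mu _ /=; elim: mu => [|mu IH].
  rewrite (_ : (fun _ => _) = series (fun n => (c p n%:Z - c p n.+2%:Z) * gegpoly n 1 x)); last first.
    apply/funext => N; rewrite mul1r /series /=; apply: eq_bigr => n _.
    by rewrite !addn1 natr1 c_mul_nat.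
  apply: sum_shift2_cvg; [exact: c_bounded | exact: rbounded_gegpoly |].
  apply/(cvgC_shift _ _ 1); move: c_sum; apply: cvg_trans; apply: near_eq_cvg; near=> N.
  rewrite addn1 /series /= big_nat_recl //=; congr (_ + _); first by rewrite gegpoly0 subr0 mulr1.
  apply: eq_bigr => -[|i] _; congr (_ * _); rewrite /= ?subr0.
    by rewrite gegpoly1 xE /v !expr1; field.
  by rewrite xE gegpoly_U_sub.
have hs : series (fun n => mu.+1`!%:R * c (p + mu.+1)%N (n + mu.+1)%N%:Z
     * (gegpoly n mu.+2 x - shift2 (fun n => gegpoly n mu.+2 x) n)) @ \oo --> F.
  move: IH; apply: cvg_trans; apply: near_eq_cvg; near=> N.
  rewrite /series /= mulr_sumr; apply: eq_bigr => n _; rewrite factCS.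
  have -> : (n%:R + mu.+1%:R) * c (p + mu.+1)%N (n + mu.+1)%N%:Z * gegpoly n mu.+1 x =
     c (p + mu.+1)%N (n + mu.+1)%N%:Z * ((n%:R + mu.+1%:R) * gegpoly n mu.+1 x) by ring.
  have -> : (n%:R + mu.+1%:R) * gegpoly n mu.+1 x =
      mu.+1%:R * (gegpoly n mu.+2 x - shift2 (fun n => gegpoly n mu.+2 x) n).
    case: n => [|[|n]] /=; rewrite ?subr0.
    - by rewrite add0r gegpoly_step0.
    - by rewrite gegpoly_step1.
    - by rewrite gegpoly_step.
  by ring.
have h := sum_shift2_cvg _ _ hs.
rewrite (_ : (fun _ => _) = series (fun n => (mu.+1`!%:R * c (p + mu.+1)%N (n + mu.+1)%N%:Z
    - mu.+1`!%:R * c (p + mu.+1)%N (n.+2 + mu.+1)%N%:Z) * gegpoly n mu.+2 x)).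
  apply: h; last exact: rbounded_gegpoly.
  by apply: tboundedZ; exact: (tbounded_shift mu.+1 (c_bounded (p + mu.+1)%N)).
apply/funext => N; rewrite /series /= mulr_sumr; apply: eq_bigr => n _.
rewrite -natrD !addnS c_mul_nat !addSn; ring.
Unshelve. all: by end_near. Qed.

End Family.

Let vS n : v n.+2 = 2 * x * v n.+1 - v n.
Proof. by rewrite xE /v !exprS; field. Qed.

Section SymmetricSum.
Variables (c c' : int -> C).
Hypothesis cc' : forall m, c' m = z * c m - (c (m - 1)%R + c (m + 1)%R) / 2.
Hypothesis cN : forall m, c (- m) = c m.
Hypothesis c_bounded : tbounded (fun n => c n%:Z).

Let S (a : int -> C) N := a 0 + \sum_(0 <= i < N) a i.+1%:Z * v i.+1.

(** Multiplying the truncated series by z - x leaves an error at the two ends of the truncation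
    only, equal by symmetry. *)
Let S_rec N : S c' N = (z - x) * S c N + (c N%:Z * v N.+1 - c N.+1%:Z * v N) / 2.
Proof.
have x2 : x = v 1 / 2 by rewrite xE /v !expr1.
elim: N => [|N IH].
  rewrite /S !big_nil !addr0 cc' sub0r add0r (cN 1) x2.
  have -> : v 0 = 2 by rewrite /v !expr0.
  by field.
have := vS N; rewrite /S !big_nat_recr //= !addrA -!/(S _ _) -/(S c' N) IH cc'.
have -> : (N.+1%:Z - 1)%R = N%:Z by rewrite intS addrC addKr.
have -> : (N.+1%:Z + 1)%R = N.+2%:Z by rewrite intS addrC.
by move=> ->; rewrite -/(S c N); field.
Qed.

Lemma symmetric_sum_mul (F : C) : S c @ \oo --> F -> S c' @ \oo --> (z - x) * F.
Proof.
move=> hF; rewrite (_ : S c' = fun N => (z - x) * S c N + (c N%:Z * v N.+1 - c N.+1%:Z * v N) / 2).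
  rewrite -[X in _ --> X]addr0; apply: cvgCD; first exact: cvgCMr hF.
  have h1 : (fun N => c N%:Z * v N.+1) @ \oo --> (0 : C).
    by have := tr_cvg0 c_bounded (rbounded_v 1); under eq_fun do rewrite addn1.
  have h2 : (fun N => c N.+1%:Z * v N) @ \oo --> (0 : C).
    have := tr_cvg0 (tbounded_shift 1 c_bounded) (rbounded_v 0).
    by under eq_fun do rewrite addn0 addn1.
  rewrite (_ : (fun _ => _) = fun N => 2^-1 * (c N%:Z * v N.+1 - c N.+1%:Z * v N)).
    rewrite -[X in _ --> X](mulr0 2^-1); apply: cvgCMr; rewrite -[X in _ --> X](subrr 0); exact: cvgCB.
  by apply/funext => N; rewrite mulrC.
by apply/funext => N; exact: S_rec.
Qed.

Lemma tbounded_mul : tbounded (fun n => c' n%:Z).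
Proof.
have [M hM] := c_bounded; exists (M * (nc z + (nc t)^-1 + nc t)) => n.
have M0 : 0 <= M by have := hM 0%N; rewrite expr0 mulr1; apply: le_trans; exact: nc_ge0.
have tn : 0 <= nc t ^+ n by rewrite exprn_ge0 // nc_ge0.
have h1 : nc (c (n%:Z - 1)%R) <= M * (nc t ^+ n * ((nc t)^-1 + nc t)).
  case: n tn => [|n] tn.
    rewrite sub0r cN expr0 mul1r; apply: le_trans (hM 1%N) _; rewrite expr1 ler_wpM2l // lerDr.
    by rewrite invr_ge0 ltW.
  have -> : (n.+1%:Z - 1)%R = n%:Z by rewrite intS addrC addKr.
  apply: le_trans (hM n) _; rewrite ler_wpM2l // exprS mulrDr mulrAC divff ?lt0r_neq0 // mul1r lerDl.
  by rewrite mulr_ge0 ?(ltW nct0) // -exprS.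
have h2 : nc (c (n%:Z + 1)%R) <= M * (nc t ^+ n * ((nc t)^-1 + nc t)).
  have -> : (n%:Z + 1)%R = n.+1%:Z by rewrite intS addrC.
  apply: le_trans (hM n.+1) _; rewrite ler_wpM2l // exprSr ler_wpM2l // lerDr.
  by rewrite invr_ge0 ltW.
rewrite cc'; apply: le_trans (ncB _ _) _; rewrite !ncM ncV.
have -> : nc 2 = 2 by rewrite (nc_nat R 2).
have h3 : nc (c (n%:Z - 1)%R + c (n%:Z + 1)%R) / 2 <= M * (nc t ^+ n * ((nc t)^-1 + nc t)).
  by rewrite ler_pdivrMr //; apply: le_trans (ncD _ _) _; lra.
have h4 : nc z * nc (c n%:Z) <= nc z * (M * nc t ^+ n) by rewrite ler_wpM2l ?nc_ge0.
apply: le_trans (lerD h4 h3) _; rewrite le_eqVlt; apply/orP; left; apply/eqP; ring.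
Qed.

End SymmetricSum.

Lemma bcoef_bounded K : tbounded (fun n => bcoef s t K n%:Z).
Proof.
elim: K => [|K IH].
  exists 1 => n; rewrite (bcoef0 s t) mul1r; case: n => [|n].
    by rewrite eqxx nc1 expr0.
  have -> : (n.+1%:Z == 0) = false by [].
  by rewrite nc0 exprn_ge0 // nc_ge0.
apply: (tbounded_mul (c := bcoef s t K)) => // m; last exact: (bcoefN s0 t0 st).
by rewrite (bcoefS s0 t0 st) zE.
Qed.

Lemma ccoef_bounded K : tbounded (fun n => ccoef s t K n%:Z).
Proof.
elim: K => [|K IH].
  exists 1 => -[|n]; first by rewrite ccoef00 nc0 expr0 mulr1.
  rewrite ccoef0S ncM ncN ncX ncV nc_nat mul1r ler_piMr ?exprn_ge0 ?nc_ge0 //.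
  by rewrite invf_le1 ?ltr0n // ler1n.
apply: (tbounded_mul (c := ccoef s t K)) => // m; last exact: ccoefN.
by rewrite (ccoefS s0 t0 st) zE.
Qed.

Lemma bcoef_sum K : (fun N => bcoef s t K 0 + \sum_(0 <= i < N) bcoef s t K i.+1%:Z * v i.+1)
  @ \oo --> (z - x) ^+ K.
Proof.
elim: K => [|K IH].
  rewrite (_ : (fun _ => _) = fun=> 1); first exact: cvg_cst.
  apply/funext => N; rewrite (bcoef0 s t) big1 ?addr0 // => i _.
  by rewrite (bcoef0 s t) mul0r.
rewrite exprS; apply: (symmetric_sum_mul (c := bcoef s t K)).
- by move=> m; rewrite (bcoefS s0 t0 st) zE.
- exact: (bcoefN s0 t0 st).
- exact: bcoef_bounded.
- exact: IH.
Qed.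

Let L : C := clog (1 - u * t) + clog (1 - u^-1 * t).

(** At K = 0 this is the sum of the logarithm series of 1 - u t and 1 - t / u; each further K is one
    multiplication by z - x. *)
Lemma ccoef_sum K : (fun N => ccoef s t K 0 + \sum_(0 <= i < N) ccoef s t K i.+1%:Z * v i.+1)
  @ \oo --> (z - x) ^+ K * L.
Proof.
elim: K => [|K IH]; last first.
  rewrite exprS -mulrA; apply: (symmetric_sum_mul (c := ccoef s t K)).
  - by move=> m; rewrite (ccoefS s0 t0 st) zE.
  - exact: ccoefN.
  - exact: ccoef_bounded.
  - exact: IH.
have h1 := clog_series (nc_mult_lt1 zcut u1).
have h2 := clog_series (nc_mult_lt1 zcut u2).
rewrite expr0 mul1r.
have -> : L = - (- clog (1 - u * t) + - clog (1 - u^-1 * t)) by rewrite /L opprD !opprK.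
rewrite (_ : (fun _ => _) = fun N => - (series (fun n => (u * t) ^+ n.+1 / n.+1%:R) N
    + series (fun n => (u^-1 * t) ^+ n.+1 / n.+1%:R) N)).
  apply: cvgN; exact: cvgCD h1 h2.
apply/funext => N; rewrite ccoef00 add0r /series /= -big_split -sumrN /=.
by apply: eq_bigr => i _; rewrite ccoef0S /v !exprMn; ring.
Qed.

End Param.

End Expansion.

(** * Identification of the terms of the statement, and the final sum *)

Section Assembly.
Variable R : realType.
Local Notation C := R[i].
Local Notation nc := (@Normc.normc R).

Lemma cpow_sqr_sub1D (z a b : C) :
  cpow_sqr_sub1 z (a + b) = cpow_sqr_sub1 z a * cpow_sqr_sub1 z b.
Proof. by rewrite /cpow_sqr_sub1 !cpowD mulrACA. Qed.

Lemma cpow_sqr_sub1_half (z : C) n : cpow_sqr_sub1 z (n%:R / 2) = cpow_sqr_sub1 z 2^-1 ^+ n.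
Proof. by rewrite /cpow_sqr_sub1 !cpowX [RHS]exprMn. Qed.

Variables (z : C) (p mu : nat).
Hypothesis zcut : cutplane 1 z.

Local Notation s := (cpow_sqr_sub1 z 2^-1).
Local Notation w := (z + s).
Local Notation t := (z - s).
Local Notation K := (p + mu)%N.
Local Notation W := (legW (t / (2 * s))).

Let s0 : s != 0. Proof. exact: sqr_sub1_neq0. Qed.
Let wt : w * t = 1. Proof. exact: jouk_mul. Qed.
Let t0 : t != 0. Proof. by apply/eqP => e; move: wt; rewrite e mulr0 => /eqP; rewrite eq_sym oner_eq0. Qed.
Let st : 2 * s * t = 1 - t ^+ 2. Proof. by transitivity (w * t - t ^+ 2); [ring | rewrite wt]. Qed.

Let cst : C := 2 ^+ mu * p`!%:R * mu.-1`!%:R.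

Definition legfin m k : C := - (cst * (-1) ^+ k * (s ^+ K * t ^+ m * (m + k)`!%:R * W k m)).

(** The constant A cancels the roots of pi and of 2 in [legQ] and supplies a second factor i, whence
    the sign. The exponents (p + mu) / 2 + 1/4 and (k + 1/2) / 2 add up to (p + mu + k + 1) / 2, an
    integral power of s. *)
Lemma prefactor_legQ m k :
  'i%C * (cpow 2 (mu%:R + 2^-1) / (Num.sqrt pi)%:C) * p`!%:R * (mu.-1)`!%:R
    * cpow_sqr_sub1 z ((p%:R + mu%:R) / 2 + 4^-1) * legQ m k z = legfin m k.
Proof.
have hpi : (Num.sqrt pi)%:C != 0 :> C by rewrite lt0r_neq0 // ltcR sqrtr_gt0 pi_gt0.
have hc : cpow (2 : C) 2^-1 != 0 by exact: cpow_neq0.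
have h4 : cpow_sqr_sub1 z ((p%:R + mu%:R) / 2 + 4^-1) * cpow_sqr_sub1 z ((k%:R + 2^-1) / 2)
    = s ^+ K * s ^+ k.+1.
  rewrite -cpow_sqr_sub1D -exprD -cpow_sqr_sub1_half; congr (cpow_sqr_sub1 z _).
  rewrite -natr1 !natrD.
  have -> : (4 : C)^-1 = 2^-1 * 2^-1 by rewrite -invfM -natrM.
  by field.
rewrite /legQ /legval /legfin /cst cpowD cpow_nat //.
have ii : 'i%C * 'i%C = -1 :> C by rewrite -expr2 sqr_i.
transitivity ((cpow_sqr_sub1 z ((p%:R + mu%:R) / 2 + 4^-1) * cpow_sqr_sub1 z ((k%:R + 2^-1) / 2))
  * ('i%C * 'i%C) * (2 ^+ mu * p`!%:R * mu.-1`!%:R * (-1) ^+ k * (t ^+ m / s ^+ k.+1 * (m + k)`!%:R * W k m))).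
  move: (cpow_sqr_sub1 z (_ / _ + _)) (cpow_sqr_sub1 z (_ / _)) ((-1) ^+ k) (t ^+ m / s ^+ k.+1 * _ * _) => a b e f.
  move: ('i%C) p`! mu.-1`! (Num.sqrt pi)%:C (cpow 2 2^-1) hpi hc => i0 n1 n2 r c hr hc.
  by field; rewrite hr hc.
by rewrite h4 ii; field; rewrite expf_neq0.
Qed.

Lemma legfin_le n : (n <= p)%N ->
  (-1) ^+ mu * cst / K`!%:R
    * (ccoef s t K (n + mu)%N - 2 * harm R (K + K) * bcoef s t K (n + mu)%N) =
  (-1) ^+ K * ((-1) ^+ n / ((p - n)%N`!%:R * (p + n + 2 * mu)%N`!%:R)
      * (harm R (p + n + 2 * mu)%N + harm R (p - n)%N) * legfin (n + mu) K)
  + (-1) ^+ (K + 1) * ((-1) ^+ n / (p + n + 2 * mu)%N`!%:R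
      * \sum_(0 <= k < (p - n)%N)
            (2 * n + 2 * k + 2 * mu + 1)%N%:R
              / (k`!%:R * (p - n - k)%N%:R * (p + n + k + 2 * mu + 1)%N%:R)
            * (1 + (k`!%:R * (p + n + 2 * mu)%N`!%:R)
                     / ((k + 2 * n + 2 * mu)%N`!%:R * (p - n)%N`!%:R))
            * legfin (n + mu) (k + n + mu))
  + (-1) ^+ (K + 1) * ((-1) ^+ n / (p - n)%N`!%:R
      * \sum_(0 <= k < (n + mu)%N)
            (2 * k + 1)%N%:R
              / ((n + k + mu)%N`!%:R * (p + mu - k)%N%:R * (p + k + mu + 1)%N%:R)
            * legfin (n + mu) k).
Proof.
move=> np; set m := (n + mu)%N.
have mK : (m <= K)%N by rewrite leq_add2r.
have E1 : (p - n = K - m)%N by rewrite subnDr.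
have E2 : (p + n + 2 * mu = K + m)%N by rewrite mul2n -addnn addnACA.
have sgn : (-1) ^+ n = (-1) ^+ mu * (-1) ^+ m :> C.
  by rewrite /m exprD mulrCA -expr2 sqrr_sign mulr1.
have sq (j : nat) : (-1) ^+ j * (-1) ^+ j = 1 :> C by rewrite -expr2 sqrr_sign.
(* With k replaced by k + m, the bracket gathers the terms m <= k < K of both halves of [ccoef_le]:
   its 1 comes from - m, its quotient of factorials from m. *)
have T2 : \sum_(0 <= k < (p - n)%N)
            (2 * n + 2 * k + 2 * mu + 1)%N%:R
              / (k`!%:R * (p - n - k)%N%:R * (p + n + k + 2 * mu + 1)%N%:R)
            * (1 + (k`!%:R * (p + n + 2 * mu)%N`!%:R)
                     / ((k + 2 * n + 2 * mu)%N`!%:R * (p - n)%N`!%:R))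
            * legfin m (k + n + mu) =
   - (cst * s ^+ K * t ^+ m * (-1) ^+ K) * (\sum_(m <= k < K) wgt R K k * ((k + m)`!%:R / (k - m)`!%:R) * W k m
      + ((K + m)`!%:R / (K - m)`!%:R) * \sum_(m <= k < K) wgt R K k * W k m).
  have sh (f : nat -> C) : \sum_(m <= k < K) f k = \sum_(0 <= k < (K - m)%N) f (k + m)%N.
    by rewrite -{1}[m]add0n big_addn.
  rewrite !sh E1 E2 mulr_sumr -big_split mulr_sumr /=.
  apply: eq_big_nat => k /andP[_ kd].
  have -> : (2 * n + 2 * k + 2 * mu + 1 = 2 * (k + m) + 1)%N by rewrite /m; ring.
  have -> : (K - m - k = K - (k + m))%N by rewrite [(k + m)%N]addnC subnDA.
  have -> : (p + n + k + 2 * mu + 1 = K + (k + m) + 1)%N by rewrite /m; ring.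
  have -> : (k + 2 * n + 2 * mu = k + m + m)%N by rewrite /m; ring.
  have -> : (k + n + mu = k + m)%N by rewrite addnA.
  rewrite addnK /legfin /wgt [(m + (k + m))%N]addnC.
  have nz : (K - (k + m))%:R != 0 :> C by rewrite pnatr_eq0 subn_eq0 -ltnNge addnC -ltn_subRL.
  have nz' : (K + (k + m) + 1)%:R != 0 :> C by rewrite addn1 natSC_neq0.
  have f1 := @factC_neq0 R k; have f2 := @factC_neq0 R (K - m).
  have f3 := @factC_neq0 R (k + m + m).
  rewrite [(-1) ^+ (K + _)]exprD -[LHS]mul1r.
  have := sq K; move: ((-1) ^+ K) ((-1) ^+ (k + m)) (k`!%:R : C) ((K - m)`!%:R : C) ((k + m + m)`!%:R : C) ((K + m)`!%:R : C) (s ^+ K) (t ^+ m) (W _ _)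
    ((K - (k + m))%:R : C) ((K + (k + m) + 1)%:R : C) nz nz' f1 f2 f3 => a1 a2 a3 a4 a5 a6 a7 a8 a9 b1 b2 nz nz' f1 f2 f3 e.
  by rewrite -[X in X * _ = _]e; field; rewrite nz nz' f1 f2 f3.
(* The terms k < m of the half at m, which have no counterpart at - m. *)
have T3 : \sum_(0 <= k < m)
            (2 * k + 1)%N%:R
              / ((n + k + mu)%N`!%:R * (p + mu - k)%N%:R * (p + k + mu + 1)%N%:R)
            * legfin m k = - (cst * s ^+ K * t ^+ m * (-1) ^+ K) * \sum_(0 <= k < m) wgt R K k * W k m.
  rewrite mulr_sumr; apply: eq_big_nat => k /andP[_ km].
  have -> : (n + k + mu = m + k)%N by rewrite addnAC.
  have -> : (p + k + mu + 1 = K + k + 1)%N by rewrite (addnAC p k).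
  rewrite /legfin /wgt [(-1) ^+ (K + _)]exprD.
  have nz : (K - k)%:R != 0 :> C by rewrite pnatr_eq0 subn_eq0 -ltnNge (leq_trans km).
  have nz' : (K + k + 1)%:R != 0 :> C by rewrite addn1 natSC_neq0.
  have f1 := @factC_neq0 R (m + k).
  move: (sq K); move: ((-1) ^+ K) ((-1) ^+ k) ((m + k)`!%:R : C) (s ^+ K) (t ^+ m) (W _ _)
    ((K - k)%:R : C) ((K + k + 1)%:R : C) nz nz' f1 => a1 a2 a3 a4 a5 a6 a7 a8 n1 n2 n3 e.
  transitivity (- (cst * a4 * a5) * (a1 * a1) * (a2 * (2 * k + 1)%:R / (a7 * a8) * a6)).
    by rewrite e; field; rewrite n1 n2 n3.
  by field; rewrite n1 n2.
rewrite {}T2 {}T3 !E1 !E2 (ccoef_le s0 t0 st mK) (@bcoef_le R s t K m mK).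
rewrite (big_cat_nat (leq0n m) mK) /= /legfin sgn (exprNn t) [(-1) ^+ (K + 1)]exprD expr1.
rewrite [(m + K)%N]addnC.
have f1 := @factC_neq0 R (K - m); have f2 := @factC_neq0 R (K + m); have f3 := @factC_neq0 R K.
move: (sq K); move: (\sum_(0 <= k < m) _) (\sum_(m <= k < K) _) (\sum_(m <= k < K) _) => X1 X2 X3.
move: ((-1) ^+ K) ((-1) ^+ m) ((-1) ^+ mu) ((K - m)`!%:R : C) ((K + m)`!%:R : C) (K`!%:R : C) (s ^+ K) (t ^+ m) (W _ _)
  (harm _ _) (harm _ _) (harm _ _) f1 f2 f3 => a1 a2 a3 a4 a5 a6 a7 a8 a9 h1 h2 h3 n1 n2 n3 e.
transitivity (a3 * a2 * cst * a7 * a8 * ((- (h1 + h2) * a9 + X1 + X3) / a4 + X2 / a5)).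
  by field; rewrite n1 n2 n3.
transitivity (a3 * a2 * cst * a7 * a8 * (a1 * a1) * ((- (h1 + h2) * a9 + X1 + X3) / a4 + X2 / a5)).
  by rewrite e mulr1.
by field; rewrite n1 n2.
Qed.

Lemma legfin_gt n : (p < n)%N ->
  (-1) ^+ mu * cst / K`!%:R
    * (ccoef s t K (n + mu)%N - 2 * harm R (K + K) * bcoef s t K (n + mu)%N) =
  (-1) ^+ mu * ((n - p - 1)%N`!%:R / (p + n + 2 * mu)%N`!%:R * legfin (n + mu) K).
Proof.
move=> pn; have Km : (K < n + mu)%N by rewrite ltn_add2r.
rewrite bcoef_gt // mulr0 subr0 ccoef_gt // /legfin.
have -> : (p + n + 2 * mu = n + mu + K)%N by ring.
have -> : (n + mu - K.+1 = n - p - 1)%N by rewrite -addSn subnDr subn1 subnS.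
have f1 := @factC_neq0 R K; have f2 := @factC_neq0 R (n + mu + K).
move: ((-1) ^+ K) (_`!%:R : C) (_`!%:R : C) ((n - p - 1)`!%:R : C) f1 f2 => a b c d f1 f2.
by field; rewrite f1 f2.
Qed.

Variable x : C.
Hypothesis x_ell : nc (x - 1) + nc (x + 1) < nc (z - 1) + nc (z + 1).
Hypothesis mu_gt0 : (0 < mu)%N.

(** Up to (-2)^K / K!, [dcoef] is c - H_K b at K = p + mu, so c - 2 H_(2K) b is [dcoef] plus (H_K -
    2 H_(2K)) times [ebcoef]. Their expansions start from the exponent p, where [dcoef] contributes
    - H_p. *)
Lemma log_expansion :
  series (fun n => (n%:R + mu%:R) * gegpoly n mu x * ((-1) ^+ mu * cst / K`!%:R
    * (ccoef s t K (n + mu)%N - 2 * harm R (K + K) * bcoef s t K (n + mu)%N))) @ \oo -->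
  (z - x) ^+ p * (clog_sub z x - clog (w / 2) - 2 * harm R (K + K) - harm R p + harm R K).
Proof.
have [u [u0 xE u1 u2]] := ell_param zcut x_ell.
rewrite (clog_sub_jouk zcut x_ell u0 xE u1 u2) [_ - clog (w / 2)]addrC addKr.
set L : C := clog _ + clog _.
have hc := ccoef_sum zcut u0 xE u1 u2; have hb := bcoef_sum zcut u0 xE u1 u2.
have E : (fun N => mu.-1`!%:R * series (fun n => (n%:R + mu%:R) * ebcoef s t K (n + mu)%N * gegpoly n mu x) N)
    @ \oo --> (-2) ^+ p / p`!%:R * (z - x) ^+ p.
  apply: (gegenbauer_expansion zcut u0 xE u1 u2 (c := ebcoef s t)) mu_gt0.
  - exact: ebcoef_mul.
  - by move=> k; apply: tboundedZ; exact: bcoef_bounded.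
  - have := cvgCMr (c := (-2) ^+ p / p`!%:R) (hb p); apply: cvg_trans; apply: near_eq_cvg; apply: nearW => N.
    rewrite mulrDr mulr_sumr; apply: (congr1 (fun y => _ + y)).
    by apply: eq_bigr => i _; rewrite /ebcoef mulrA.
have D : (fun N => mu.-1`!%:R * series (fun n => (n%:R + mu%:R) * dcoef s t K (n + mu)%N * gegpoly n mu x) N)
    @ \oo --> (-2) ^+ p / p`!%:R * ((z - x) ^+ p * L - harm R p * (z - x) ^+ p).
  apply: (gegenbauer_expansion zcut u0 xE u1 u2 (c := dcoef s t)) mu_gt0.
  - exact: dcoef_mul.
  - move=> k; apply: tboundedZ.
    have := tboundedD (ccoef_bounded zcut k) (tboundedZ (- harm R k) (bcoef_bounded zcut k)).
    by under eq_fun do rewrite mulNr.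
  - have := cvgCMr (c := (-2) ^+ p / p`!%:R) (cvgCB (hc p) (cvgCMr (c := harm R p) (hb p))).
    apply: cvg_trans; apply: near_eq_cvg; apply: nearW => N.
    have -> : \sum_(0 <= i < N) dcoef s t p i.+1 * (u ^+ i.+1 + u^-1 ^+ i.+1) =
      (-2) ^+ p / p`!%:R * (\sum_(0 <= i < N) ccoef s t p i.+1 * (u ^+ i.+1 + u^-1 ^+ i.+1)
        - harm R p * \sum_(0 <= i < N) bcoef s t p i.+1 * (u ^+ i.+1 + u^-1 ^+ i.+1)).
      by rewrite mulr_sumr -sumrB mulr_sumr; apply: eq_bigr => i _; rewrite /dcoef; ring.
    by rewrite /dcoef; ring.
have e2 : ((-2) ^+ p : C) != 0 by rewrite expf_neq0 // oppr_eq0.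
have := cvgCMr (c := p`!%:R / (-2) ^+ p) (cvgCD D (cvgCMr (c := harm R K - 2 * harm R (K + K)) E)).
have -> : p`!%:R / (-2) ^+ p * ((-2) ^+ p / p`!%:R * ((z - x) ^+ p * L - harm R p * (z - x) ^+ p) +
    (harm R K - 2 * harm R (K + K)) * ((-2) ^+ p / p`!%:R * (z - x) ^+ p)) =
   (z - x) ^+ p * (L - 2 * harm R (K + K) - harm R p + harm R K).
  have f := @factC_neq0 R p.
  by move: (_ ^+ p) (_ ^+ p) (_`!%:R) e2 f => a b c e2 f; field; rewrite e2 f.
apply: cvg_trans; apply: near_eq_cvg; apply: nearW => N.
rewrite /series /= !mulr_sumr -big_split mulr_sumr /=; apply: eq_bigr => n _.
rewrite /dcoef /ebcoef /cst exprD.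
have -> : (-2) ^+ mu = (-1) ^+ mu * 2 ^+ mu :> C by rewrite exprNn.
move: (gegpoly _ _ _) (ccoef _ _ _ _) (bcoef _ _ _ _) => g c b.
have f := @factC_neq0 R p; have f' := @factC_neq0 R K.
move: (2 ^+ mu) ((-2) ^+ p) (_`!%:R) (_`!%:R) ((-1) ^+ mu) e2 f f' => y0 y1 y2 y3 y4 e2 f f'.
by field; rewrite e2 f'.
Qed.

End Assembly.

(** The identity holds for the branch [clog_sub], hence for the principal logarithm when the segment
    from z to z - x avoids the cut. Convergence of the infinite sum is a separate conclusion because
    [limn] has a default value on divergent sequences. *)
Theorem lemma4p5 (R : realType) (p mu : nat) (z x : R[i])
    (mu_gt0 : (0 < mu)%N)
    (z_cut : cutplane 1 z)
    (zx_cut : cutplane 0 (z - x))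
    (x_ell : `|x - 1| + `|x + 1| < `|z - 1| + `|z + 1|) :
  let A : R[i] := 'i%C * (cpow 2 (mu%:R + 2^-1) / (Num.sqrt pi)%:C)
    * p`!%:R * (mu.-1)`!%:R
    * cpow_sqr_sub1 z ((p%:R + mu%:R) / 2 + 4^-1) in
  let tail (n : nat) : R[i] :=
    (n%:R + mu%:R) * (n - p - 1)%N`!%:R * gegenbauer n mu%:R x
      / (p + n + 2 * mu)%N`!%:R
    * legendreQ (n%:R + mu%:R - 2^-1) (p%:R + mu%:R + 2^-1) z in
  let rhs : R[i] :=
    (z - x) ^+ p
      * (clog ((z + cpow_sqr_sub1 z 2^-1) / 2)
         + 2 * harm R (2 * p + 2 * mu)%N + harm R p - harm R (p + mu)%N)
    + (-1) ^+ (p + mu)%N * A * (\sum_(0 <= n < p.+1)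
        (n%:R + mu%:R) * (-1) ^+ n * gegenbauer n mu%:R x
          / ((p - n)%N`!%:R * (p + n + 2 * mu)%N`!%:R)
        * (harm R (p + n + 2 * mu)%N + harm R (p - n)%N)
        * legendreQ (n%:R + mu%:R - 2^-1) (p%:R + mu%:R + 2^-1) z)
    + (-1) ^+ (p + mu + 1)%N * A * (\sum_(0 <= n < p)
        (n%:R + mu%:R) * (-1) ^+ n * gegenbauer n mu%:R x
          / (p + n + 2 * mu)%N`!%:R
        * \sum_(0 <= k < (p - n)%N)
            (2 * n + 2 * k + 2 * mu + 1)%N%:R
              / (k`!%:R * (p - n - k)%N%:R * (p + n + k + 2 * mu + 1)%N%:R)
            * (1 + (k`!%:R * (p + n + 2 * mu)%N`!%:R)
                     / ((k + 2 * n + 2 * mu)%N`!%:R * (p - n)%N`!%:R))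
            * legendreQ (n%:R + mu%:R - 2^-1)
                (k%:R + n%:R + mu%:R + 2^-1) z)
    + (-1) ^+ (p + mu + 1)%N * A * (\sum_(0 <= n < p.+1)
        (n%:R + mu%:R) * (-1) ^+ n * gegenbauer n mu%:R x / (p - n)%N`!%:R
        * \sum_(0 <= k < (n + mu)%N)
            (2 * k + 1)%N%:R
              / ((n + k + mu)%N`!%:R * (p + mu - k)%N%:R * (p + k + mu + 1)%N%:R)
            * legendreQ (n%:R + mu%:R - 2^-1) (k%:R + 2^-1) z)
    + (-1) ^+ mu * A * limn (fun N => \sum_(p.+1 <= n < N) tail n) in
  [/\ cvgn (fun N => \sum_(p.+1 <= n < N) tail n),
      (forall t : R, 0 <= t <= 1 -> cutplane 0 (z - t%:C * x)) ->
        (z - x) ^+ p * clog (z - x) = rhs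
    & (z - x) ^+ p * clog_sub z x = rhs].
Proof.
move=> A tail rhs.
pose s := cpow_sqr_sub1 z 2^-1.
pose g n := (n%:R + mu%:R) * gegpoly n mu x.
(* The general term of [log_expansion]: its first p + 1 values make up the three finite sums
   ([finE]), the others are B times [tail]. *)
pose f n := g n * ((-1) ^+ mu * (2 ^+ mu * p`!%:R * mu.-1`!%:R) / (p + mu)`!%:R
  * (ccoef s (z - s) (p + mu) (n + mu)%N
     - 2 * harm R (p + mu + (p + mu)) * bcoef s (z - s) (p + mu) (n + mu)%N)).
have ell : Normc.normc (x - 1) + Normc.normc (x + 1) < Normc.normc (z - 1) + Normc.normc (z + 1).
  by move: x_ell; rewrite !normcE_real -!rmorphD ltcR.
have AQ n k : A * legendreQ (n%:R + mu%:R - 2^-1) (k%:R + 2^-1) z = legfin z p mu (n + mu) k.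
  by rewrite -natrD legendreQE ?addn_gt0 ?mu_gt0 ?orbT // prefactor_legQ.
have AQp n : A * legendreQ (n%:R + mu%:R - 2^-1) (p%:R + mu%:R + 2^-1) z = legfin z p mu (n + mu) (p + mu).
  by rewrite -AQ natrD.
have A0 : A != 0.
  have i0 : 'i%C != 0 :> R[i] by rewrite -sqrf_eq0 sqr_i oppr_eq0 oner_eq0.
  have pi0 : (Num.sqrt pi)%:C != 0 :> R[i] by rewrite lt0r_neq0 // ltcR sqrtr_gt0 pi_gt0.
  have S0 : cpow_sqr_sub1 z ((p%:R + mu%:R) / 2 + 4^-1) != 0 by rewrite mulf_neq0 ?cpow_neq0.
  apply: mulf_neq0 S0; apply: mulf_neq0 (factC_neq0 _); apply: mulf_neq0 (factC_neq0 _).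
  by apply: mulf_neq0 i0 _; apply: mulf_neq0 (cpow_neq0 _ _) _; rewrite invr_eq0.
pose B : R[i] := (-1) ^+ mu * A.
have B0 : B != 0 by rewrite mulf_neq0 // signr_eq0.
have tailE n : (p < n)%N -> tail n = B^-1 * f n.
  move=> pn; apply: (mulfI B0); rewrite (mulVKf B0) /f legfin_gt // -AQp /B /tail gegenbauerE /g.
  by move: (legendreQ _ _ _) (_ ^+ mu) => q e; field; exact: factC_neq0.
have finE : series f p.+1 =
  (-1) ^+ (p + mu)%N * A * (\sum_(0 <= n < p.+1)
        (n%:R + mu%:R) * (-1) ^+ n * gegenbauer n mu%:R x
          / ((p - n)%N`!%:R * (p + n + 2 * mu)%N`!%:R)
        * (harm R (p + n + 2 * mu)%N + harm R (p - n)%N)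
        * legendreQ (n%:R + mu%:R - 2^-1) (p%:R + mu%:R + 2^-1) z)
    + (-1) ^+ (p + mu + 1)%N * A * (\sum_(0 <= n < p)
        (n%:R + mu%:R) * (-1) ^+ n * gegenbauer n mu%:R x
          / (p + n + 2 * mu)%N`!%:R
        * \sum_(0 <= k < (p - n)%N)
            (2 * n + 2 * k + 2 * mu + 1)%N%:R
              / (k`!%:R * (p - n - k)%N%:R * (p + n + k + 2 * mu + 1)%N%:R)
            * (1 + (k`!%:R * (p + n + 2 * mu)%N`!%:R)
                     / ((k + 2 * n + 2 * mu)%N`!%:R * (p - n)%N`!%:R))
            * legendreQ (n%:R + mu%:R - 2^-1)
                (k%:R + n%:R + mu%:R + 2^-1) z)
    + (-1) ^+ (p + mu + 1)%N * A * (\sum_(0 <= n < p.+1)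
        (n%:R + mu%:R) * (-1) ^+ n * gegenbauer n mu%:R x / (p - n)%N`!%:R
        * \sum_(0 <= k < (n + mu)%N)
            (2 * k + 1)%N%:R
              / ((n + k + mu)%N`!%:R * (p + mu - k)%N%:R * (p + k + mu + 1)%N%:R)
            * legendreQ (n%:R + mu%:R - 2^-1) (k%:R + 2^-1) z).
  transitivity (\sum_(0 <= n < p.+1) g n * (
    (-1) ^+ (p + mu) * ((-1) ^+ n / ((p - n)%N`!%:R * (p + n + 2 * mu)%N`!%:R)
      * (harm R (p + n + 2 * mu)%N + harm R (p - n)%N) * legfin z p mu (n + mu) (p + mu)))
    + \sum_(0 <= n < p.+1) g n * ((-1) ^+ (p + mu + 1) * ((-1) ^+ n / (p + n + 2 * mu)%N`!%:R
      * \sum_(0 <= k < (p - n)%N)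
            (2 * n + 2 * k + 2 * mu + 1)%N%:R
              / (k`!%:R * (p - n - k)%N%:R * (p + n + k + 2 * mu + 1)%N%:R)
            * (1 + (k`!%:R * (p + n + 2 * mu)%N`!%:R)
                     / ((k + 2 * n + 2 * mu)%N`!%:R * (p - n)%N`!%:R))
            * legfin z p mu (n + mu) (k + n + mu)))
    + \sum_(0 <= n < p.+1) g n * ((-1) ^+ (p + mu + 1) * ((-1) ^+ n / (p - n)%N`!%:R
      * \sum_(0 <= k < (n + mu)%N)
            (2 * k + 1)%N%:R
              / ((n + k + mu)%N`!%:R * (p + mu - k)%N%:R * (p + k + mu + 1)%N%:R)
            * legfin z p mu (n + mu) k))).
    rewrite -!big_split; apply: eq_big_nat => n /andP[_ np].
    by rewrite /f legfin_le // !mulrDr.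
  congr (_ + _ + _).
  - rewrite mulr_sumr; apply: eq_bigr => n _; rewrite -AQp gegenbauerE /g; ring.
  (* The inner sum is empty at n = p, which is why the statement stops at n < p. *)
  - rewrite big_nat_recr //= subnn [X in _ * (_ * (_ * X))]big_geq // !mulr0 addr0 mulr_sumr.
    apply: eq_bigr => n _; rewrite gegenbauerE /g.
    rewrite (_ : \sum_(0 <= k < _) _ = A * \sum_(0 <= k < (p - n)%N)
            (2 * n + 2 * k + 2 * mu + 1)%N%:R
              / (k`!%:R * (p - n - k)%N%:R * (p + n + k + 2 * mu + 1)%N%:R)
            * (1 + (k`!%:R * (p + n + 2 * mu)%N`!%:R)
                     / ((k + 2 * n + 2 * mu)%N`!%:R * (p - n)%N`!%:R))
            * legendreQ (n%:R + mu%:R - 2^-1) (k%:R + n%:R + mu%:R + 2^-1) z).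
      by move: (\sum_(0 <= k < _) _) => X; ring.
    rewrite mulr_sumr; apply: eq_bigr => k _; rewrite -AQ !natrD mulrCA; congr (_ * _).
  - rewrite mulr_sumr; apply: eq_bigr => n _; rewrite gegenbauerE /g.
    rewrite (_ : \sum_(0 <= k < _) _ = A * \sum_(0 <= k < (n + mu)%N)
            (2 * k + 1)%N%:R
              / ((n + k + mu)%N`!%:R * (p + mu - k)%N%:R * (p + k + mu + 1)%N%:R)
            * legendreQ (n%:R + mu%:R - 2^-1) (k%:R + 2^-1) z).
      by move: (\sum_(0 <= k < _) _) => X; ring.
    by rewrite mulr_sumr; apply: eq_bigr => k _; rewrite -AQ mulrCA.
have hf := log_expansion (p := p) z_cut ell mu_gt0.
have tail_cvg : (fun N => \sum_(p.+1 <= n < N) tail n) @ \oo -->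
    B^-1 * ((z - x) ^+ p * (clog_sub z x - clog ((z + s) / 2) - 2 * harm R (p + mu + (p + mu))
      - harm R p + harm R (p + mu)) - series f p.+1).
  have hcst : (fun=> series f p.+1 : R[i]) @ \oo --> (series f p.+1 : R[i]) by exact: cvg_cst.
  have := cvgCMr (c := B^-1) (cvgCB hf hcst).
  apply: cvg_trans; apply: near_eq_cvg; near=> N.
  have pN : (p.+1 <= N)%N by near: N; exact: nbhs_infty_ge.
  rewrite [X in _ * (X - _)](_ : _ = series f p.+1 + \sum_(p.+1 <= n < N) f n); last first.
    by rewrite /series /= -(big_cat_nat (leq0n _) pN).
  rewrite [series f _ + _]addrC addrK mulr_sumr; apply: eq_big_nat => n /andP[pn _].
  by rewrite -tailE.
have subE : (z - x) ^+ p * clog_sub z x = rhs.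
  rewrite /rhs (cvgC_lim tail_cvg) -/B -/s (mulVKf B0) finE.
  have -> : (2 * p + 2 * mu = p + mu + (p + mu))%N by rewrite -mulnDr mul2n addnn.
  move: (\sum_(0 <= n < p.+1) _) (\sum_(0 <= n < p) _) (\sum_(0 <= n < p.+1) _) => X1 X2 X3.
  ring.
split; [exact: (cvgP _ tail_cvg) | move=> h | exact: subE].
by rewrite -(clog_sub_principal z_cut ell h).
Unshelve. all: by end_near. Qed.
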